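(* Assume the Template Hypothesis stated in the context. Then there exists $k\in\mathbb{Z}_+$ such that a $k$-connected binary matroid $M$ with at least $2k$ elements has no minor isomorphic to $M(K_6)$ or to $H_{12}^*$ if and only if $M$ is an even-cut matroid.
   Context: Binary frame template: a tuple $\Phi=(C,X,Y_0,Y_1,A_1,\Delta,\Lambda)$ where $C,X,Y_0,Y_1$ are disjoint finite sets, $A_1$ is a binary matrix with rows indexed by $X$ and columns by $Y_0\cup Y_1\cup C$, $\Lambda$ is a subgroup of $\mathrm{GF}(2)^X$ and $\Delta$ a subgroup of $\mathrm{GF}(2)^{Y_0\cup Y_1\cup C}$; moreover (standard form) there are partitions $C=C_0\cup C_1$, $X=X_0\cup X_1$ with $A_1[X_0,C_0]$ an identity matrix and $A_1[X_1,C]$ a zero matrix. A binary frame matrix is a binary matrix each of whose columns has at most two nonzero entries. A binary matrix $A'$ with rows indexed by $B$ and columns by $E$ ($B,E$ disjoint finite sets) respects $\Phi$ if: $X\subseteq B$ and $C,Y_0,Y_1\subseteq E$; $A'[X,C\cup Y_0\cup Y_1]=A_1$; there is $Z\subseteq E-(C\cup Y_0\cup Y_1)$ with $A'[X,Z]=0$, each column of $A'[B-X,Z]$ a unit vector, and $A'[B-X,E-(C\cup Y_0\cup Y_1\cup Z)]$ a binary frame matrix; each column of $A'[X,E-(C\cup Y_0\cup Y_1\cup Z)]$ lies in $\Lambda$; each row of $A'[B-X,C\cup Y_0\cup Y_1]$ lies in $\Delta$. A matrix $A\in\mathrm{GF}(2)^{B\times E}$ conforms to $\Phi$ if for such $A'$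 and $Z$ we have $A[B,E-Z]=A'[B,E-Z]$ and for each $i\in Z$ there is $j\in Y_1$ such that column $i$ of $A$ equals the sum of columns $i$ and $j$ of $A'$. A matroid $M$ conforms to $\Phi$ if $M\cong M(A)/C\backslash Y_1$ for some $A$ conforming to $\Phi$; $\mathcal{M}(\Phi)$ is the set of such matroids, and $\mathcal{M}^*(\Phi)$ the set of matroids whose duals conform to $\Phi$. Template Hypothesis: for every proper minor-closed class $\mathcal{M}$ of binary matroids there exist $k\in\mathbb{Z}_+$ and binary frame templates $\Phi_1,\dots,\Phi_s,\Psi_1,\dots,\Psi_t$ such that $\mathcal{M}$ contains each $\mathcal{M}(\Phi_i)$ and each $\mathcal{M}^*(\Psi_j)$, and every $k$-connected member of $\mathcal{M}$ with at least $2k$ elements either lies in some $\mathcal{M}(\Phi_i)$ or has its dual in some $\mathcal{M}(\Psi_j)$. An even-cut matroid is a matroid representable by a binary matrix having a row whose removal yields a matrix representing a cographic matroid. $H_{12}$ is the vector matroid over $\mathrm{GF}(2)$ of the matrix with rows $101010101010$, $000011110000$, $000011001100$, $110000000011$, $001100110011$. *)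

(* Defs.v *)
From HB Require Import structures.
From mathcomp Require Import all_boot all_order all_algebra zify.

Set Implicit Arguments.
Unset Strict Implicit.
Unset Printing Implicit Defensive.

Import GRing.Theory.
Local Open Scope ring_scope.
Local Open Scope nat_scope.

(* The rank axioms (R1)-(R3); the independent sets are recovered by indep below. *)
Record matroid := Matroid {
  ground :> finType;
  rk : {set ground} -> nat;
  rk_le_card : forall S : {set ground}, rk S <= #|S|;
  rk_mono : forall S T : {set ground}, S \subset T -> rk S <= rk T;
  rk_submod : forall S T : {set ground},
    rk (S :|: T) + rk (S :&: T) <= rk S + rk T }.

Arguments rk {m} S.
Arguments rk_le_card {m} S.
Arguments rk_mono {m} [S T] _.
Arguments rk_submod {m} S T.

Definition indep (M : matroid) (S : {set M}) : bool := rk S == #|S|.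

Definition matroid_iso (M N : matroid) : Prop :=
  exists2 f : M -> N, bijective f & forall S : {set M}, rk (f @: S) = rk S.

Section Dual.
Variable M : matroid.

(* The truncated subtraction is exact: see rk_setT_le. *)
Definition dual_rk (S : {set M}) : nat := #|S| + rk (~: S) - rk [set: M].

Lemma rk_setT_le (S : {set M}) : rk [set: M] <= #|S| + rk (~: S).
Proof. by have := rk_submod S (~: S); have := rk_le_card S; rewrite setUCr; lia. Qed.

Fact dual_rk_le_card (S : {set M}) : dual_rk S <= #|S|.
Proof. by rewrite /dual_rk; have := rk_mono (subsetT (~: S)); lia. Qed.

Fact dual_rk_mono (S T : {set M}) : S \subset T -> dual_rk S <= dual_rk T.
Proof.
move=> sST; rewrite /dual_rk leq_sub2r //.
have E : ~: S = ~: T :|: (T :\: S).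
  apply/setP=> x; rewrite !inE; have /implyP := subsetP sST x.
  by case: (x \in S); case: (x \in T).
have := rk_submod (~: T) (T :\: S); have := rk_le_card (T :\: S).
by have := cardsID S T; rewrite (setIidPr sST) -E; lia.
Qed.

Fact dual_rk_submod (S T : {set M}) :
  dual_rk (S :|: T) + dual_rk (S :&: T) <= dual_rk S + dual_rk T.
Proof.
rewrite /dual_rk.
have := rk_setT_le S; have := rk_setT_le T.
have := rk_setT_le (S :|: T); have := rk_setT_le (S :&: T).
have := rk_submod (~: S) (~: T); rewrite -setCI -setCU.
by have := cardsUI S T; lia.
Qed.

Definition dual : matroid :=
  Matroid dual_rk_le_card dual_rk_mono dual_rk_submod.
End Dual.

Section Minor.
Variables (M : matroid) (C D : {set M}).

Definition minor_ground : finType := {x : M | x \notin C :|: D}.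

Implicit Types S T : {set minor_ground}.

Definition minor_lift S : {set M} := [set val x | x in S].

Definition minor_rk S : nat := rk (minor_lift S :|: C) - rk C.

Fact minor_rk_le_card S : minor_rk S <= #|S|.
Proof.
have E : #|minor_lift S| = #|S| by apply: card_imset; exact: val_inj.
have := rk_submod (minor_lift S) C; have := rk_le_card (minor_lift S).
by rewrite /minor_rk; lia.
Qed.

Fact minor_rk_mono S T : S \subset T -> minor_rk S <= minor_rk T.
Proof. by move=> sST; rewrite leq_sub2r // rk_mono // setSU // imsetS. Qed.

Fact minor_rk_submod S T :
  minor_rk (S :|: T) + minor_rk (S :&: T) <= minor_rk S + minor_rk T.
Proof.
have EU : minor_lift (S :|: T) = minor_lift S :|: minor_lift T by exact: imsetU.
have EI : minor_lift (S :&: T) = minor_lift S :&: minor_lift T.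
  by apply: imsetI => x y _ _ /val_inj.
have := rk_submod (minor_lift S :|: C) (minor_lift T :|: C).
rewrite -setUIl -setUUl -EU -EI.
have H V := rk_mono (subsetUr (minor_lift V) C).
have := H S; have := H T; have := H (S :|: T); have := H (S :&: T).
by rewrite /minor_rk; lia.
Qed.

(* M / C \ D, on the elements of M outside C and D *)
Definition minor : matroid :=
  Matroid minor_rk_le_card minor_rk_mono minor_rk_submod.
End Minor.

Definition has_minor (M N : matroid) : Prop :=
  exists C D : {set M}, [disjoint C & D] /\ matroid_iso (minor C D) N.

(* This is Tutte's (not vertical) connectivity. *)
Definition separation (M : matroid) (l : nat) (S : {set M}) : bool :=
  [&& l <= #|S|, l <= #|~: S| & rk S + rk (~: S) < rk [set: M] + l].

Definition k_connected (k : nat) (M : matroid) : Prop :=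
  forall (l : nat) (S : {set M}), 0 < l < k -> ~~ separation l S.

Section Span.
Variables (K : fieldType) (vT : vectType K) (E : finType) (A : E -> vT).

Definition span_rk (S : {set E}) : nat := \dim <<[seq A e | e in S]>>.

Let spn (S : {set E}) := <<[seq A e | e in S]>>%VS.

Let spnS (S T : {set E}) : S \subset T -> (spn S <= spn T)%VS.
Proof.
move=> sST; apply: sub_span => v /imageP [e eS ->].
by apply: image_f; apply: (subsetP sST).
Qed.

Let spnU (S T : {set E}) : spn (S :|: T) = (spn S + spn T)%VS.
Proof.
rewrite -span_cat; apply: eq_span => v; rewrite mem_cat.
apply/imageP/orP.
  by case=> e; rewrite inE => /orP [] eS ->; [left|right]; apply: image_f.
by case=> /imageP [e eS ->]; exists e; rewrite // inE eS ?orbT.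
Qed.

Lemma span_rk_le_card (S : {set E}) : span_rk S <= #|S|.
Proof. by rewrite /span_rk (leq_trans (dim_span _)) // size_image. Qed.

Lemma span_rk_mono (S T : {set E}) : S \subset T -> span_rk S <= span_rk T.
Proof. by move=> /spnS /dimvS. Qed.

Lemma span_rk_submod (S T : {set E}) :
  span_rk (S :|: T) + span_rk (S :&: T) <= span_rk S + span_rk T.
Proof.
rewrite /span_rk -/(spn _) spnU -(dimv_sum_cap (spn S) (spn T)) leq_add2l.
by rewrite dimvS // subv_cap !spnS ?subsetIl ?subsetIr.
Qed.

Lemma free_setD1 (S : {set E}) e : e \in S ->
  free [seq A x | x in S] =
  (A e \notin <<[seq A x | x in S :\ e]>>%VS) && free [seq A x | x in S :\ e].
Proof.
move=> eS; rewrite -free_cons; apply: perm_free.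
rewrite -[A e :: _]/[seq A x | x <- e :: enum (S :\ e)]; apply: perm_map.
apply: uniq_perm; rewrite /= ?enum_uniq ?mem_enum ?inE ?eqxx // => x.
by rewrite !(inE, mem_enum); case: eqP => [->|].
Qed.

Lemma free_setP (S : {set E}) :
  reflect (forall e, e \in S -> A e \notin <<[seq A x | x in S :\ e]>>%VS)
          (free [seq A x | x in S]).
Proof.
apply: (iffP idP) => [fS e eS|]; first by move: fS; rewrite (free_setD1 eS) => /andP [].
elim: {S}_.+1 {-2}S (ltnSn #|S|) => // n IH S leS H.
have [->|[e eS]] := set_0Vmem S; first by rewrite /image_mem enum_set0 nil_free.
rewrite (free_setD1 eS) H //=; apply: IH; first by rewrite (cardsD1 e) eS in leS; lia.
move=> x /setD1P [_ xS]; apply: contra (H x xS); apply: subvP; apply: spnS.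
exact/setSD/subD1set.
Qed.

Lemma span_rk_max (S : {set E}) :
  \max_(F : {set E} | (F \subset S) && free [seq A x | x in F]) #|F| = span_rk S.
Proof.
apply/eqP; rewrite eqn_leq; apply/andP; split.
  apply/bigmax_leqP => F /andP [sFS fF].
  by rewrite -(size_image A F) -(eqnP fF) span_rk_mono.
pose P (F : {set E}) := (F \subset S) && free [seq A x | x in F].
have P0 : P set0 by rewrite /P sub0set /image_mem enum_set0 nil_free.
case: (@arg_maxnP _ set0 P (fun F => #|F|) P0) => F /andP [sFS fF] Fmax.
apply: leq_trans (leq_bigmax_cond F _); last by rewrite sFS.
rewrite -(size_image A F) -(eqnP fF) dimvS //.
apply/span_subvP => v /imageP [e eS ->].
have [eF|eF] := boolP (e \in F); first exact/memv_span/image_f.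
apply/negPn/negP => nF.
suff /Fmax : P (e |: F) by rewrite /= cardsU1 eF; lia.
rewrite /P subUset sub1set eS sFS /= (free_setD1 (setU11 _ _)) setU1K //.
by rewrite nF.
Qed.
End Span.

Definition bmatrix (B E : finType) := B -> E -> 'F_2.

Definition column (B E : finType) (A : bmatrix B E) (e : E) : {ffun B -> ('F_2)^o} :=
  [ffun b => A b e].

Definition vector_matroid (B E : finType) (A : bmatrix B E) : matroid :=
  Matroid (span_rk_le_card (column A)) (@span_rk_mono _ _ _ (column A))
          (span_rk_submod (column A)).

Definition binary (M : matroid) : Prop :=
  exists (B E : finType) (A : bmatrix B E), matroid_iso (vector_matroid A) M.

(* Loops (#|ends e| = 1) and parallel edges are allowed. *)
Record graph := Graph {
  vertex : finType;
  edge : finType;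
  ends : edge -> {set vertex};
  ends_card : forall e, 0 < #|ends e| <= 2 }.

Section CycleMatroid.
Variable G : graph.
Implicit Types D F S : {set edge G}.

(* D is the edge set of a cycle of length n.+1; ordS is the cyclic successor.
   Loops (length 1) and pairs of parallel edges (length 2) are cycles. *)
Definition is_cycle D : bool :=
  [exists n : 'I_#|vertex G|,
   exists v : {ffun 'I_n.+1 -> vertex G}, exists e : {ffun 'I_n.+1 -> edge G},
   [&& injectiveb v, injectiveb e,
       [forall i, ends (e i) == [set v i; v (ordS i)]]
     & D == [set e i | i : 'I_n.+1]]].

Definition acyclic F : bool := [forall D : {set edge G}, is_cycle D ==> ~~ (D \subset F)].

Definition cycle_rk S : nat :=
  \max_(F : {set edge G} | (F \subset S) && acyclic F) #|F|.

Definition vertex_vec (u : vertex G) : {ffun vertex G -> ('F_2)^o} := [ffun x => (x == u)%:R%R].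

(* Column of the incidence matrix of G over GF(2); loops give zero columns *)
Definition inc_vec (e : edge G) : {ffun vertex G -> ('F_2)^o} :=
  if #|ends e| == 2 then (\sum_(u in ends e) vertex_vec u)%R else 0%R.

Let F2add (x : {ffun vertex G -> ('F_2)^o}) : (x + x = 0)%R.
Proof.
by apply/ffunP => u; rewrite !ffunE; apply/eqP; case: (x u) => [[|[|n]] i].
Qed.

Let incE e u w : ends e = [set u; w] -> inc_vec e = (vertex_vec u + vertex_vec w)%R.
Proof.
move=> E; rewrite /inc_vec E cards2; case: (eqVneq u w) => [->|nuw] /=; first by rewrite F2add.
by rewrite big_setU1 ?big_set1 // inE.
Qed.

Let cycle_dep D F : is_cycle D -> D \subset F -> ~~ free [seq inc_vec e | e in F].
Proof.
move=> /existsP [n /existsP [v /existsP [e]]].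
case/and4P => /injectiveP vI /injectiveP eI /forallP J /eqP -> sDF.
apply/negP => /free_setP fF.
have eF i : e i \in F by apply: (subsetP sDF); apply: imset_f.
have S0 : (\sum_i inc_vec (e i) = 0)%R.
  under eq_bigr do rewrite (incE (eqP (J _))).
  rewrite big_split /= [X in (_ + X)%R](_ : _ = \sum_i vertex_vec (v i))%R ?F2add //.
  by rewrite [RHS](reindex _ (onW_bij _ (@ordS_bij _))).
have /negP[] := fF _ (eF ord0).
have -> : inc_vec (e ord0) = (- \sum_(i | i != ord0) inc_vec (e i))%R.
  by apply/eqP; rewrite -addr_eq0 -[X in (_ == X)]S0 [X in (_ == X)](bigD1 ord0).
rewrite rpredN; apply: rpred_sum => i i0; apply: memv_span; apply: image_f.
by rewrite !inE eF (inj_eq eI) i0.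
Qed.

Let joins F : rel (vertex G) :=
  fun x y => [exists f in F, ends f == [set x; y]].

Let joins_sym F : symmetric (joins F).
Proof. by move=> x y; rewrite /joins; apply: eq_existsb => f; rewrite setUC. Qed.

Let ends_ex (e : edge G) : exists u w, ends e = [set u; w].
Proof.
have /andP [] := ends_card e; rewrite leq_eqVlt => /orP [/eqP H _|H1 H2].
  have /cards1P [u ->] : #|ends e| == 1 by rewrite -H.
  by exists u, u; rewrite setUid.
have /cards2P [u [w [_ ->]]] : #|ends e| == 2 by rewrite eqn_leq H2 H1.
by exists u, w.
Qed.

Let span_connect F (e : edge G) u w : ends e = [set u; w] ->
  inc_vec e \in <<[seq inc_vec x | x in F]>>%VS -> connect (joins F) u w.
Proof.
move=> E /coord_span; set c := coord _; move=> Hc.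
pose phi (g : {ffun vertex G -> ('F_2)^o}) := (\sum_(x | connect (joins F) u x) g x)%R.
have phiD g h : phi (g + h)%R = (phi g + phi h)%R.
  by rewrite /phi -big_split; apply: eq_bigr => x _; rewrite ffunE.
have phid x : phi (vertex_vec x) = (connect (joins F) u x)%:R%R.
  rewrite /phi; case: (boolP (connect _ u x)) => cx.
    rewrite (bigD1 x) //= ffunE eqxx big1 ?addr0 // => y /andP [_ /negbTE nyx].
    by rewrite ffunE nyx.
  rewrite big1 // => y cy; rewrite ffunE; case: eqP => // yx.
  by rewrite yx in cy; rewrite cy in cx.
have phi_inc f : f \in F -> phi (inc_vec f) = 0%R.
  move=> fF; have [a [b Ef]] := ends_ex f; rewrite (incE Ef) phiD !phid.
  have jab : joins F a b by apply/existsP; exists f; rewrite fF Ef eqxx.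
  have -> : connect (joins F) u a = connect (joins F) u b.
    by apply: same_connect_r; [apply: sym_connect_sym; exact: joins_sym | apply: connect1].
  by case: connect; apply/eqP.
have : phi (inc_vec e) = 0%R.
  rewrite Hc /phi; under eq_bigr do rewrite sum_ffunE.
  rewrite exchange_big big1 //= => i _.
  have /imageP [f fF Ef] : nth 0%R (image_tuple inc_vec F) i \in [seq inc_vec x | x in F].
    by rewrite mem_nth // size_tuple.
  under eq_bigr do rewrite ffunE Ef.
  by rewrite -scaler_sumr [X in (_ *: X)%R]phi_inc ?scaler0.
rewrite (incE E) phiD !phid connect0; case: connect => //.
Qed.

Let connect_cycle F (e : edge G) u w : ends e = [set u; w] -> e \in F ->
  connect (joins (F :\ e)) u w -> exists2 D, is_cycle D & D \subset F.
Proof.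
move=> E eF /connectP [p0 pp0 Ew]; move: pp0 Ew; case/shortenP => p pp Up _ Ew.
have sz : size p < #|vertex G|.
  by rewrite -[(size p).+1]/(size (u :: p)) -(card_uniqP Up) max_card.
pose pickE x y := odflt e [pick f in F :\ e | ends f == [set x; y]].
pose vn i := nth u (u :: p) i.
pose en i := if i < size p then pickE (vn i) (vn i.+1) else e.
have pickP' i : i < size p -> (en i \in F :\ e) && (ends (en i) == [set vn i; vn i.+1]).
  move=> lti; rewrite /en lti /pickE; case: pickP => [f //|H].
  have /existsP [f fP] := (pathP u pp) i lti.
  by have := H f; rewrite -[vn i.+1]/(nth u p i) fP.
have vnI i j : i <= size p -> j <= size p -> (vn i == vn j) = (i == j).
  by move=> li lj; rewrite /vn nth_uniq.
pose v := [ffun i : 'I_(Ordinal sz).+1 => vn i].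
pose ed := [ffun i : 'I_(Ordinal sz).+1 => en i].
exists [set ed i | i : 'I_(Ordinal sz).+1]; last first.
  apply/subsetP => f /imsetP [i _ ->]; rewrite ffunE.
  have [li|li] := ltnP i (size p); last by rewrite /en ltnNge li.
  by have /andP [/setD1P []] := pickP' _ li.
apply/existsP; exists (Ordinal sz); apply/existsP; exists v; apply/existsP; exists ed.
have lei (i : 'I_(Ordinal sz).+1) : i <= size p by rewrite -ltnS.
apply/and4P; split=> //.
- apply/injectiveP => i j; rewrite !ffunE => /eqP; rewrite vnI //.
  by move=> /eqP /val_inj.
- apply/injectiveP => i j; rewrite !ffunE => Eij; apply: val_inj => /=.
  have [li|li] := ltnP i (size p); have [lj|lj] := ltnP j (size p).
  + have /andP [_ /eqP Ei] := pickP' _ li; have /andP [_ /eqP Ej] := pickP' _ lj.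
    have Es : [set vn i; vn i.+1] = [set vn j; vn j.+1] by rewrite -Ei -Ej Eij.
    have : vn i \in [set vn j; vn j.+1] by rewrite -Es set21.
    have : vn j \in [set vn i; vn i.+1] by rewrite Es set21.
    rewrite !in_set2 !vnI ?(ltnW li) ?(ltnW lj) //.
    by move: (nat_of_ord i) (nat_of_ord j) => a b /orP [] /eqP ? /orP [] /eqP ?; lia.
  + have /andP [/setD1P [+ _] _] := pickP' _ li.
    by rewrite Eij {1}/en ltnNge lj eqxx.
  + have /andP [/setD1P [+ _] _] := pickP' _ lj.
    by rewrite -Eij {1}/en ltnNge li eqxx.
  + have := lei i; have := lei j.
    by move: (nat_of_ord i) (nat_of_ord j) li lj => a b; lia.
- apply/forallP => i; rewrite !ffunE.
  have [li|li] := ltnP i (size p).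
    have /andP [_ /eqP ->] := pickP' _ li.
    by rewrite /= modn_small // ltnS.
  have Ei : i = size p :> nat by apply/eqP; rewrite eqn_leq lei li.
  rewrite /en Ei ltnn E /= Ei modnn /vn /= setUC.
  by rewrite -[size p]/((size (u :: p)).-1) nth_last /= -Ew.
Qed.

Lemma acyclic_free F : acyclic F = free [seq inc_vec e | e in F].
Proof.
apply/idP/idP => [aF|fF].
  apply/free_setP => e eF; apply/negP => sF; have [u [w E]] := ends_ex e.
  have [D cD sD] := connect_cycle E eF (span_connect E sF).
  by have := forallP aF D; rewrite cD sD.
apply/forallP => D; apply/implyP => cD; apply/negP => sD.
by have := cycle_dep cD sD; rewrite fF.
Qed.

Lemma cycle_rkE S : cycle_rk S = span_rk inc_vec S.
Proof.
by rewrite -span_rk_max; apply: eq_bigl => F; rewrite acyclic_free.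
Qed.

Fact cycle_rk_le_card S : cycle_rk S <= #|S|.
Proof. by rewrite cycle_rkE span_rk_le_card. Qed.

Fact cycle_rk_mono (S T : {set edge G}) : S \subset T -> cycle_rk S <= cycle_rk T.
Proof. by move=> sST; rewrite !cycle_rkE span_rk_mono. Qed.

Fact cycle_rk_submod (S T : {set edge G}) :
  cycle_rk (S :|: T) + cycle_rk (S :&: T) <= cycle_rk S + cycle_rk T.
Proof. by rewrite !cycle_rkE span_rk_submod. Qed.

Definition cycle_matroid : matroid :=
  Matroid cycle_rk_le_card cycle_rk_mono cycle_rk_submod.

Lemma indep_cycle_matroid (S : {set cycle_matroid}) : indep S = acyclic S.
Proof.
by rewrite /indep /= cycle_rkE acyclic_free /span_rk /free size_image.
Qed.
End CycleMatroid.

Lemma indep_vector_matroid (B E : finType) (A : bmatrix B E)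
    (S : {set vector_matroid A}) :
  indep S = free [seq column A e | e in S].
Proof. by rewrite /indep /= /span_rk /free size_image. Qed.

Definition cographic (M : matroid) : Prop :=
  exists G : graph, matroid_iso (dual (cycle_matroid G)) M.

Definition delete_row (B E : finType) (A : bmatrix B E) (b0 : B) :
    bmatrix {b : B | b != b0} E :=
  fun b e => A (val b) e.

Arguments delete_row {B E} A b0.

Definition even_cut (M : matroid) : Prop :=
  exists (B E : finType) (A : bmatrix B E) (b0 : B),
    matroid_iso (vector_matroid A) M /\
    cographic (vector_matroid (delete_row A b0)).

Fact complete_ends_card (n : nat) (e : {S : {set 'I_n} | #|S| == 2}) :
  0 < #|val e| <= 2.
Proof. by rewrite (eqP (valP e)). Qed.

Definition complete_graph (n : nat) : graph :=
  Graph (@complete_ends_card n).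

Definition H12_rows : seq (seq nat) :=
  [:: [:: 1; 0; 1; 0; 1; 0; 1; 0; 1; 0; 1; 0];
      [:: 0; 0; 0; 0; 1; 1; 1; 1; 0; 0; 0; 0];
      [:: 0; 0; 0; 0; 1; 1; 0; 0; 1; 1; 0; 0];
      [:: 1; 1; 0; 0; 0; 0; 0; 0; 0; 0; 1; 1];
      [:: 0; 0; 1; 1; 0; 0; 1; 1; 0; 0; 1; 1]].

Definition H12_matrix : bmatrix 'I_5 'I_12 :=
  fun i j => ((nth 0%N (nth [::] H12_rows i) j)%:R)%R.

Definition H12 : matroid := vector_matroid H12_matrix.

(* The sets C, X, Y0, Y1 are distinct types, hence disjoint; the set
   Y0 :|: Y1 :|: C of column indices is the sum type. *)
Definition tcols (Y0 Y1 C : finType) : finType := ((Y0 + Y1) + C)%type.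

(* Partitions C = C0 :|: ~: C0 and X = X0 :|: ~: X0 (parts may be empty) such that
   A1[X0, C0] is an identity matrix, under a bijection of row and column labels,
   and A1[~: X0, C] = 0. *)
Definition standard_form (C X Y0 Y1 : finType)
    (A1 : bmatrix X (tcols Y0 Y1 C)) : Prop :=
  exists (C0 : {set C}) (X0 : {set X}),
    (exists2 f : {x : X | x \in X0} -> {c : C | c \in C0}, bijective f &
       forall x c, A1 (val x) (inr (val c)) = ((f x == c)%:R)%R) /\
    (forall x c, x \notin X0 -> A1 x (inr c) = 0%R).

Record template := Template {
  tC : finType;
  tX : finType;
  tY0 : finType;
  tY1 : finType;
  tA1 : bmatrix tX (tcols tY0 tY1 tC);
  tDelta : {set {ffun tcols tY0 tY1 tC -> 'F_2}};
  tLambda : {set {ffun tX -> 'F_2}};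
  tDelta_subgroup : GRing.zmod_closed tDelta;
  tLambda_subgroup : GRing.zmod_closed tLambda;
  t_standard : standard_form tA1 }.

(* The row set B is the sum of X and R = B - X; the column set E is the sum of
   Y0 :|: Y1 :|: C and F = E - (Y0 :|: Y1 :|: C). *)
Definition brows (Phi : template) (R : finType) : finType := (tX Phi + R)%type.
Definition ecols (Phi : template) (F : finType) : finType :=
  (tcols (tY0 Phi) (tY1 Phi) (tC Phi) + F)%type.

Section Conform.
Variable Phi : template.

Definition respects (R F : finType) (A' : bmatrix (brows Phi R) (ecols Phi F))
    (Z : {set F}) : Prop :=
  [/\ forall x d, A' (inl x) (inl d) = tA1 x d,
      forall z, z \in Z ->
        (forall x, A' (inl x) (inr z) = 0%R) /\
        (exists r0, forall r, A' (inr r) (inr z) = ((r == r0)%:R)%R),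
      forall f, f \notin Z -> #|[set r | A' (inr r) (inr f) != 0%R]| <= 2,
      forall f, f \notin Z -> [ffun x => A' (inl x) (inr f)] \in tLambda Phi
    & forall r, [ffun d => A' (inr r) (inl d)] \in tDelta Phi].

Definition conforming_matrix (R F : finType)
    (A : bmatrix (brows Phi R) (ecols Phi F)) : Prop :=
  exists (A' : bmatrix (brows Phi R) (ecols Phi F)) (Z : {set F}),
    [/\ respects A' Z,
        forall b d, A b (inl d) = A' b (inl d),
        forall b f, f \notin Z -> A b (inr f) = A' b (inr f)
      & forall i, i \in Z -> exists j : tY1 Phi,
          forall b, A b (inr i) = (A' b (inr i) + A' b (inl (inl (inr j))))%R].

Definition conforms (M : matroid) : Prop :=
  exists (R F : finType) (A : bmatrix (brows Phi R) (ecols Phi F)),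
    conforming_matrix A /\
    matroid_iso
      (@minor (vector_matroid A)
         [set inl (inr c) | c : tC Phi] [set inl (inl (inr j)) | j : tY1 Phi]) M.
End Conform.

Definition proper_minor_closed_binary (P : matroid -> Prop) : Prop :=
  [/\ forall M, P M -> binary M,
      forall M N, P M -> has_minor M N -> P N
    & exists2 M, binary M & ~ P M].

Definition template_hypothesis : Prop :=
  forall P : matroid -> Prop, proper_minor_closed_binary P ->
  exists (k s t : nat) (Phi : 'I_s -> template) (Psi : 'I_t -> template),
    [/\ 0 < k,
        forall i M, conforms (Phi i) M -> P M,
        forall j M, conforms (Psi j) (dual M) -> P M
      & forall M, P M -> k_connected k M -> 2 * k <= #|M| ->
          (exists i, conforms (Phi i) M) \/ (exists j, conforms (Psi j) (dual M))].

(* Main.v *)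
From HB Require Import structures.
Require Import Defs.
From mathcomp Require Import all_boot all_order all_algebra zify.

(* The dual of an even-cut matroid is a quotient M(G)/d of a graphic matroid by one vector, so the class
   looked for is dual to one template class. Apply the hypothesis to the binary matroids without the two
   minors. Every template class contains all M(K_n) up to minors, so no Phi_i occurs and the dual N of a
   highly connected member conforms to some Psi whose class contains no H12. This forces two things.
   (1) Every lambda in Lambda vanishes modulo the contracted columns: otherwise the doubled edges
   phi, phi + lambda of a 5-cycle with a chord give H12. So, up to Y0, N consists of differences of points
   (0, unit vectors, columns of Y1) modulo the contracted columns.
   (2) Distinct such points, also modulo part of Y0, satisfy at most one affine relation: from two
   relations one reaches, by contracting pairs of points, six points with a + b = c + d = e + f, and these
   with two free points contain H12.
   Connectivity makes Y0 independent and coindependent, and then (2) makes N a graph modulo one vector.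
   Conversely, if Q is a minor of an even-cut matroid, the cycle space of Q has index at most two in the
   cut space of a graph. In such a graph the edges are covered twice by the vertex stars, which bounds the
   rank from above by the minimum size of a cut; passing to suitable minors (the dual of M(K_5) for K_6,
   F_7 and its dual for H12) this is violated. *)

Set Implicit Arguments.
Unset Strict Implicit.
Unset Printing Implicit Defensive.

Import GRing.Theory.
Local Open Scope ring_scope.
Local Open Scope nat_scope.

(** * Linear algebra over GF(2) *)

(** Matroids are handled through null sets, the sets of elements whose vectors sum to zero; over
    GF(2) they determine the rank function and conversely. Contraction restricts null sets, deletion
    keeps those avoiding a set, duality is orthogonality. The forward obstacle is [Y0], whose
    elements survive in N as arbitrary vectors, so (2) is needed modulo every subset of [Y0]. Modulo
    two such elements that are not edges, it makes their expressions through points differ in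
    exactly two points; these pairs form a star, and one new vertex turns all such elements into
    edges. The obstacle in the converse is a cut outside the null space: it may be tiny, so the
    counting bound cannot be applied to Q itself. For K_6, keeping only the cuts that avoid a
    suitable vertex star removes the foreign coset and leaves K_5, with rank 6, minimum 3 and 3 * 7
    > 2 * 10. For H12 the foreign coset is one of 2 ^ 7, and each is refuted by a minor with 4 * 4 >
    2 * 7 or 3 * 5 > 2 * 7. *)

Definition symd (E : finType) (S T : {set E}) : {set E} := (S :\: T) :|: (T :\: S).

Lemma in_symd (E : finType) (S T : {set E}) x : (x \in symd S T) = (x \in S) (+) (x \in T).
Proof. by rewrite !inE; case: (x \in S); case: (x \in T). Qed.

Lemma symdA (E : finType) : associative (@symd E).
Proof. by move=> S T U; apply/setP => x; rewrite !in_symd addbA. Qed.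

Lemma symdC (E : finType) : commutative (@symd E).
Proof. by move=> S T; apply/setP => x; rewrite !in_symd addbC. Qed.

Lemma sym0d (E : finType) : left_id set0 (@symd E).
Proof. by move=> S; apply/setP => x; rewrite in_symd inE. Qed.

Lemma symd0 (E : finType) : right_id set0 (@symd E).
Proof. by move=> S; rewrite symdC sym0d. Qed.

Lemma symdd (E : finType) (S : {set E}) : symd S S = set0.
Proof. by apply/setP => x; rewrite in_symd inE addbb. Qed.

Lemma symdK (E : finType) (S T : {set E}) : symd S (symd S T) = T.
Proof. by rewrite symdA symdd sym0d. Qed.

HB.instance Definition _ (E : finType) := Monoid.isComLaw.Build {set E} set0 (@symd E) (@symdA E) (@symdC E) (@sym0d E).

Lemma odd_symd (E : finType) (S T : {set E}) : odd #|symd S T| = odd #|S| (+) odd #|T|.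
Proof.
rewrite /symd cardsU.
have -> : (S :\: T) :&: (T :\: S) = set0.
  by apply/setP => x; rewrite !inE; case: (x \in S); case: (x \in T).
rewrite cards0 subn0 oddD -(cardsID T S) -(cardsID S T) !oddD (setIC T S).
by case: (odd #|S :&: T|); case: (odd _); case: (odd _).
Qed.

Lemma setI_symdr (E : finType) (U S T : {set E}) : U :&: symd S T = symd (U :&: S) (U :&: T).
Proof. by apply/setP => x; rewrite in_setI !in_symd !in_setI; case: (x \in U). Qed.

Lemma symd_sub (E : finType) (U S T : {set E}) : S \subset U -> T \subset U -> symd S T \subset U.
Proof.
move=> /subsetP sS /subsetP sT; apply/subsetP => x.
by rewrite in_symd; have := sS x; have := sT x; case: (x \in S); case: (x \in T) => //= h1 h2 _; rewrite ?h1 ?h2.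
Qed.

Lemma symd_eq0 (E : finType) (S T : {set E}) : (symd S T == set0) = (S == T).
Proof.
apply/eqP/eqP => [H|->]; last exact: symdd.
by apply/setP => x; have /setP/(_ x) := H; rewrite in_symd inE; case: (x \in S); case: (x \in T).
Qed.

Lemma F2P (k : 'F_2) : (k = 0%R) \/ (k = 1%R).
Proof. by case: k => [[|[|n]] i] //; [left|right]; apply/eqP. Qed.

Lemma addrr_F2 (vT : vectType 'F_2) (x : vT) : (x + x = 0)%R.
Proof.
rewrite -[x in (x + _)%R]scale1r -[x in (_ + x)%R]scale1r -scalerDl.
by rewrite (_ : 1 + 1 = 0 :> 'F_2)%R ?scale0r //; apply: val_inj.
Qed.

Lemma oppr_F2 (vT : vectType 'F_2) (x : vT) : (- x = x)%R.
Proof. by apply/eqP; rewrite eq_sym -addr_eq0 addrr_F2. Qed.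

Lemma addr_eq0_F2 (vT : vectType 'F_2) (x y : vT) : (x + y == 0)%R = (x == y).
Proof. by rewrite addr_eq0 oppr_F2. Qed.

Lemma sumv_symd (E : finType) (vT : vectType 'F_2) (a : E -> vT) (S T : {set E}) :
  (\sum_(e in symd S T) a e = \sum_(e in S) a e + \sum_(e in T) a e)%R.
Proof.
rewrite !(big_mkcond (fun e => e \in _)) -big_split; apply: eq_bigr => e _ /=.
by rewrite in_symd; case: (e \in S); case: (e \in T); rewrite /= ?addr0 ?add0r ?addrr_F2.
Qed.

Section Nul.
Variables (E : finType) (vT : vectType 'F_2).
Implicit Types (a : E -> vT) (S T : {set E}).

Definition sumv a S : vT := (\sum_(e in S) a e)%R.
Definition nul a S : bool := sumv a S == 0%R.

Lemma nul0 a : nul a set0.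
Proof. by rewrite /nul /sumv big_set0. Qed.

Lemma sumvD a S T : (sumv a (symd S T) = sumv a S + sumv a T)%R.
Proof. exact: sumv_symd. Qed.

Lemma sumv1 a e : sumv a [set e] = a e.
Proof. by rewrite /sumv big_set1. Qed.

Lemma nulD a S T : nul a S -> nul a T -> nul a (symd S T).
Proof. by rewrite /nul sumvD => /eqP -> /eqP ->; rewrite addr0. Qed.

Lemma mem_spanP a S (v : vT) :
  reflect (exists2 T : {set E}, T \subset S & v = sumv a T) (v \in <<[seq a e | e in S]>>%VS).
Proof.
apply: (iffP idP) => [|[T sTS ->]]; last first.
  apply: rpred_sum => e eT; apply: memv_span; apply: image_f; exact: (subsetP sTS).
elim: {S}_.+1 {-2}S (ltnSn #|S|) v => // n IH S leS v.
have [->|[e eS]] := set_0Vmem S.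
  rewrite /image_mem enum_set0 span_nil memv0 => /eqP ->.
  by exists set0; rewrite ?sub0set // /sumv big_set0.
have -> : <<[seq a x | x in S]>>%VS = (<[a e]> + <<[seq a x | x in S :\ e]>>)%VS.
  rewrite -span_cons; apply: eq_span => w; rewrite inE.
  apply/imageP/orP => [[x xS ->]|[/eqP ->|/imageP [x]]].
  - have [->|xe] := eqVneq x e; first by left.
    by right; apply: image_f; rewrite !inE xe.
  - by exists e.
  - by rewrite !inE => /andP [_ xS] ->; exists x.
have ltS : #|S :\ e| < n by move: leS; rewrite (cardsD1 e) eS add1n ltnS.
move=> /memv_addP [x /vlineP [k ->] [w /(IH _ ltS) [T sT ->] ->]].
have sTS : T \subset S by apply: (subset_trans sT); exact: subsetDl.
case: (F2P k) => ->; first by exists T; rewrite // scale0r add0r.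
exists (symd [set e] T); last by rewrite sumvD sumv1 scale1r.
by apply: symd_sub; rewrite ?sub1set.
Qed.

Lemma free_nulP a S :
  reflect (forall T, T \subset S -> nul a T -> T = set0) (free [seq a e | e in S]).
Proof.
apply: (iffP (free_setP a S)) => H.
  move=> T sTS nT; apply/eqP/set0Pn => [[e eT]].
  have eS := subsetP sTS e eT.
  have /negP [] := H e eS; apply/mem_spanP; exists (T :\ e); first exact: setSD.
  apply/eqP; rewrite -addr_eq0_F2 -(sumv1 a e) -sumvD.
  suff -> : symd [set e] (T :\ e) = T by [].
  by apply/setP => x; rewrite in_symd !inE; case: eqP => // ->; rewrite eT.
move=> e eS; apply/negP => /mem_spanP [T sT Ee].
have : symd [set e] T = set0.
  apply: H; last by rewrite /nul sumvD sumv1 Ee addrr_F2.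
  by apply: symd_sub; rewrite ?sub1set //; apply: (subset_trans sT); exact: subsetDl.
move/setP/(_ e); rewrite in_symd !inE eqxx; case eT: (e \in T) => //.
by have := subsetP sT _ eT; rewrite !inE eqxx.
Qed.

End Nul.

Lemma span_rk_nul (E : finType) (vT wT : vectType 'F_2) (a : E -> vT) (b : E -> wT) :
  nul a =1 nul b -> span_rk a =1 span_rk b.
Proof.
move=> H S; rewrite -!span_rk_max; apply: eq_bigl => F; congr (_ && _).
by apply/free_nulP/free_nulP => h T sT nT; apply: h => //; [rewrite H|rewrite -H].
Qed.

(** Equal ranks give the same free subsets, hence the same minimal dependent sets. Over GF(2) such a
    set is null in every representation: it contains a nonempty null subset, which by minimality is
    the whole set. Adding a minimal dependent subset to a null set shrinks it, so induction on the
    size applies. *)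
Lemma nul_span_rk (E : finType) (vT wT : vectType 'F_2) (a : E -> vT) (b : E -> wT) :
  span_rk a =1 span_rk b -> nul a =1 nul b.
Proof.
suff main (vT' wT' : vectType 'F_2) (a' : E -> vT') (b' : E -> wT') T :
    span_rk a' =1 span_rk b' -> nul a' T -> nul b' T.
  by move=> H T; apply/idP/idP; apply: main => // U; rewrite H.
move=> H.
have fr (S : {set E}) : free [seq a' x | x in S] = free [seq b' x | x in S].
  by have := H S; rewrite /free /span_rk !size_image => ->.
elim: {T}_.+1 {-2}T (ltnSn #|T|) => // n IH T leT nT.
have [->|nT0] := eqVneq T set0; first exact: nul0.
(* a minimal dependent subset of T is null for both families *)
have: exists m, [exists C : {set E}, [&& C \subset T, ~~ free [seq a' x | x in C] & #|C| == m]].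
  exists #|T|; apply/existsP; exists T; rewrite subxx eqxx andbT /=.
  by apply/negP => /free_nulP /(_ T (subxx T) nT) /eqP; rewrite (negbTE nT0).
case/ex_minnP => m /existsP [C /and3P [sCT dC /eqP cC]] mC.
have minC (D : {set E}) : D \subset C -> D != C -> free [seq a' x | x in D].
  move=> sD nD; apply/negPn/negP => dD.
  have : m <= #|D|.
    by apply: mC; apply/existsP; exists D; rewrite dD eqxx (subset_trans sD sCT).
  have : #|D| < #|C| by apply: proper_card; rewrite properEneq nD sD.
  lia.
have key (uT : vectType 'F_2) (c : E -> uT) : ~~ free [seq c x | x in C] ->
   (forall D : {set E}, D \subset C -> D != C -> free [seq c x | x in D]) -> nul c C /\ C != set0.
  move=> dc mc; suff [D [sD nD D0]] : exists D : {set E}, [/\ D \subset C, nul c D & D != set0].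
    have [<-//|nDC] := eqVneq D C.
    by have /free_nulP/(_ D (subxx D) nD)/eqP := mc D sD nDC; rewrite (negbTE D0).
  case: (pickP [pred D : {set E} | [&& D \subset C, nul c D & D != set0]]) => [D /and3P [? ? ?]|no].
    by exists D.
  case/negP: dc; apply/free_nulP => D sD nD; apply/eqP/negPn/negP => D0.
  by have := no D; rewrite /= sD nD D0.
have [nC C0] := key _ _ dC minC.
have [nC' _] : nul b' C /\ C != set0.
  by apply: key; [rewrite -fr|move=> D sD nD; rewrite -fr; apply: minC].
have -> : T = symd C (symd C T) by rewrite symdK.
apply: nulD => //; apply: IH; last exact: nulD.
have -> : symd C T = T :\: C.
  apply/setP => x; rewrite in_symd !inE; have := subsetP sCT x.
  by case: (x \in C); case: (x \in T) => // /(_ isT).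
rewrite cardsD (setIidPr sCT); have : 0 < #|C| by rewrite card_gt0.
have : 0 < #|T| by rewrite card_gt0.
have := subset_leq_card sCT; lia.
Qed.

Lemma span_rk_inj (E E' : finType) (K : fieldType) (vT : vectType K) (a : E -> vT) (h : E' -> E) (S : {set E'}) :
  span_rk (a \o h) S = span_rk a (h @: S).
Proof.
congr (\dim _); apply: eq_span => v; apply/imageP/imageP => [[e eS ->]|[e /imsetP [x xS ->] ->]].
  by exists (h e); rewrite ?imset_f.
by exists x.
Qed.

Lemma sumv_inj (E E' : finType) (vT : vectType 'F_2) (a : E -> vT) (h : E' -> E) (S : {set E'}) :
  injective h -> sumv (a \o h) S = sumv a (h @: S).
Proof. by move=> hI; rewrite /sumv big_imset // => x y _ _ /hI. Qed.

Lemma sumv_lin (E : finType) (vT wT : vectType 'F_2) (f : {linear vT -> wT}) (a : E -> vT) S :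
  f (sumv a S) = sumv (f \o a) S.
Proof. by rewrite /sumv raddf_sum. Qed.

(** Contraction becomes composition with an endomorphism whose kernel is the span of the contracted
    vectors, so a quotient stays in the same space. *)
Lemma quot_ex (K : fieldType) (vT : vectType K) (U : {vspace vT}) : exists f : 'End(vT), lker f = U.
Proof.
exists (\1%VF - projv U)%R; apply/vspaceP => x; rewrite memv_ker add_lfunE opp_lfunE id_lfunE subr_eq0.
apply/eqP/idP => [->|xU]; first exact: memv_proj.
by rewrite projv_id.
Qed.

Lemma span_rk_quot (E : finType) (K : fieldType) (vT : vectType K) (a : E -> vT) (f : 'End(vT)) (C S : {set E}) :
  lker f = <<[seq a e | e in C]>>%VS ->
  span_rk (f \o a) S = span_rk a (S :|: C) - span_rk a C.
Proof.
move=> kf; have := limg_ker_dim f <<[seq a e | e in S :|: C]>>.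
have -> : (f @: <<[seq a e | e in S :|: C]>> = <<[seq (f \o a) e | e in S]>>)%VS.
  rewrite limg_span; apply/eqP; rewrite eqEsubv; apply/andP; split; last first.
    apply: sub_span => v /imageP [e eS ->]; rewrite /=; apply: map_f; apply: image_f.
    by rewrite inE eS.
  apply/span_subvP => v /mapP [w /imageP [e]]; rewrite inE => /orP [] eS -> ->.
    by apply: memv_span; apply/imageP; exists e.
  suff -> : f (a e) = 0%R by rewrite mem0v.
  by apply/eqP; rewrite -memv_ker kf; apply: memv_span; apply: image_f.
rewrite (capv_idPr _); last first.
  rewrite kf; apply: sub_span => v /imageP [e eS ->]; apply: image_f.
  by rewrite inE eS orbT.
by rewrite /span_rk kf => <-; rewrite addKn.
Qed.

Lemma nul_quot (E : finType) (vT : vectType 'F_2) (a : E -> vT) (f : 'End(vT)) (C S : {set E}) :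
  lker f = <<[seq a e | e in C]>>%VS ->
  reflect (exists2 T : {set E}, T \subset C & sumv a S = sumv a T) (nul (f \o a) S).
Proof. by move=> kf; rewrite /nul -sumv_lin -memv_ker kf; exact: mem_spanP. Qed.

Lemma F2_neq0D (x y : 'F_2) : (x + y != 0)%R = (x != 0)%R (+) (y != 0)%R.
Proof. by case: (F2P x) => ->; case: (F2P y) => ->. Qed.

Lemma F2_natr_neq0 n : (n%:R != 0 :> 'F_2)%R = odd n.
Proof. by elim: n => // n IH; rewrite mulrS F2_neq0D IH. Qed.

(** Some coordinate of the image of [v] in the quotient by [U] is nonzero. Boolean values let
    [functional_sum] read the functional as a parity. *)
Lemma functional_sep (vT : vectType 'F_2) (U : {vspace vT}) (v : vT) : v \notin U ->
  exists phi : vT -> bool,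
    [/\ forall x y, phi (x + y)%R = phi x (+) phi y, forall u, u \in U -> ~~ phi u & phi v].
Proof.
have [f kf] := quot_ex U; rewrite -kf memv_ker => fv.
have [/existsP [i vi]|] := boolP [exists i, coord (vbasis fullv) i (f v) != 0%R].
  exists (fun w => coord (vbasis fullv) i (f w) != 0%R); split=> // [x y|u].
    by rewrite linearD linearD F2_neq0D.
  by rewrite memv_ker => /eqP ->; rewrite linear0 eqxx.
rewrite negb_exists => /forallP h; case/negP: fv.
rewrite (coord_vbasis (memvf (f v))) big1 // => i _.
by have /negPn/eqP -> := h i; rewrite scale0r.
Qed.

Lemma functional_sum (vT : vectType 'F_2) (phi : vT -> bool) :
  (forall x y, phi (x + y)%R = phi x (+) phi y) ->
  forall (E : finType) (a : E -> vT) (S : {set E}),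
  phi (sumv a S) = odd #|S :&: [set e | phi (a e)]|.
Proof.
move=> phiD E a S.
have phi0 : phi 0%R = false by have := phiD 0%R 0%R; rewrite addr0; case: (phi 0%R).
rewrite /sumv (big_morph phi phiD phi0) -sum1_card big_mkcond /= [in RHS]big_mkcond /=.
rewrite (big_morph odd oddD (erefl : odd 0 = false)); apply: eq_bigr => e _.
by rewrite !inE; case: (e \in S); case: (phi (a e)).
Qed.

(* Separate (0, 1) from the span of the vectors (a e, [e \in X]). *)
Lemma functional_ex (E : finType) (vT : vectType 'F_2) (a : E -> vT) (X : {set E}) :
  (forall S, nul a S -> ~~ odd #|X :&: S|) ->
  exists2 phi : vT -> bool, forall x y, phi (x + y)%R = phi x (+) phi y & forall e, (e \in X) = phi (a e).
Proof.
move=> H; pose a' e : vT * ('F_2)^o := (a e, (e \in X)%:R%R).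
have sum' S : sumv a' S = (sumv a S, (#|X :&: S|)%:R%R).
  rewrite [LHS]surjective_pairing; congr pair.
    by rewrite /sumv (big_morph fst (fun _ _ => erefl) erefl).
  rewrite /sumv (big_morph snd (fun _ _ => erefl) erefl) /= -sum1_card natr_sum.
  rewrite big_mkcond [in RHS]big_mkcond; apply: eq_bigr => e _.
  by rewrite !inE; case: (e \in S); case: (e \in X).
have [|phi [phiD phi0 phi1]] := @functional_sep _ <<[seq a' e | e in setT]>>%VS (0%R, 1%R).
  apply/negP => /mem_spanP [S _]; rewrite sum' => -[/esym /eqP /H nX h].
  by move: nX; rewrite -F2_natr_neq0 -[(_%:R)%R]h oner_neq0.
exists (fun v => phi (v, 0%R)) => [x y|e].
  by rewrite -phiD; congr phi; rewrite [RHS]surjective_pairing /= addr0.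
have : ~~ phi (a' e) by apply: phi0; apply: memv_span; apply: image_f.
have -> : a' e = ((a e, 0%R) + (0%R, (e \in X)%:R%R))%R.
  by rewrite [RHS]surjective_pairing /= addr0 add0r.
rewrite phiD; case: (e \in X); first by rewrite phi1; case: (phi _).
have : ~~ phi 0%R by apply: phi0; rewrite mem0v.
by rewrite -[(0, 0)%R]/(0%R : vT * ('F_2)^o) => /negPf ->; rewrite addbF => /negPf ->.
Qed.

(** * Minors, duals and representations *)

Lemma matroid_iso_refl (M : matroid) : matroid_iso M M.
Proof. by exists id => [|S]; [exists id | rewrite imset_id]. Qed.

Lemma matroid_iso_sym (M N : matroid) : matroid_iso M N -> matroid_iso N M.
Proof.
case=> f [g fK gK] Hf; exists g; first by exists f.
by move=> S; rewrite -(Hf (g @: S)) -imset_comp (eq_imset _ gK) imset_id.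
Qed.

Lemma matroid_iso_trans (M N Q : matroid) : matroid_iso M N -> matroid_iso N Q -> matroid_iso M Q.
Proof.
case=> f bf Hf [g bg Hg]; exists (g \o f); first exact: bij_comp.
by move=> S; rewrite imset_comp Hg Hf.
Qed.

Lemma rk_gen (M : matroid) (S I : {set M}) : I \subset S -> (forall e, e \in S -> rk (e |: I) = rk I) -> rk S = rk I.
Proof.
move=> sIS H; suff main (T : {set M}) : T \subset S -> rk (T :|: I) = rk I.
  by rewrite -(main S (subxx S)) (setUidPl sIS).
elim: {T}_.+1 {-2}T (ltnSn #|T|) => // n IH T leT sTS.
have [->|[e eT]] := set_0Vmem T; first by rewrite set0U.
have lt' : #|T :\ e| < n by move: leT; rewrite (cardsD1 e) eT add1n ltnS.
have := IH _ lt' (subset_trans (subsetDl _ _) sTS).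
have := H e (subsetP sTS e eT).
have := rk_submod (T :\ e :|: I) (e |: I).
have -> : (T :\ e :|: I) :|: (e |: I) = T :|: I.
  by rewrite setUACA setUid (setUC (T :\ e)) setD1K.
have := rk_mono (_ : I \subset (T :\ e :|: I) :&: (e |: I)).
rewrite subsetI !subsetUr => /(_ isT).
by have := rk_mono (subsetUr T I); lia.
Qed.

Lemma basis_ex (M : matroid) (S : {set M}) : exists2 I : {set M}, I \subset S & indep I && (rk S == #|I|).
Proof.
pose P (I : {set M}) := (I \subset S) && indep I.
have P0 : P set0 by rewrite /P sub0set /indep cards0 -leqn0 -(cards0 M) rk_le_card.
case: (@arg_maxnP _ set0 P (fun F => #|F|) P0) => I /andP [sI iI] Imax.
exists I => //; rewrite iI /=; move: (iI) => /eqP <-; apply/eqP/rk_gen => // e eS.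
have [eI|eI] := boolP (e \in I); first by rewrite (setUidPr _) // sub1set.
have nP : ~~ indep (e |: I).
  apply/negP => ie; have := Imax (e |: I); rewrite /P subUset sub1set eS sI ie /=.
  by rewrite cardsU1 eI => /(_ isT); lia.
have := rk_mono (subsetUr [set e] I); have := rk_le_card (e |: I).
move: nP iI; rewrite /indep cardsU1 eI; lia.
Qed.

Lemma rk_indep (M N : matroid) (f : M -> N) : injective f ->
  (forall S : {set M}, indep (f @: S) = indep S) -> forall S : {set M}, rk (f @: S) = rk S.
Proof.
move=> fI H S; apply/eqP; rewrite eqn_leq; apply/andP; split.
  have [J sJ /andP [iJ /eqP ->]] := basis_ex (f @: S).
  pose I := f @^-1: J.
  have JE : J = f @: I.
    apply/setP => y; apply/idP/imsetP => [yJ|[x xI ->]]; last by rewrite inE in xI.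
    by have /imsetP [x xS yE] := subsetP sJ y yJ; exists x; rewrite // inE -yE.
  have sI : I \subset S.
    apply/subsetP => x; rewrite inE => /(subsetP sJ) /imsetP [x' xS' /fI ->] //.
  move: iJ; rewrite JE H card_imset // => /eqP <-; exact: rk_mono.
have [I sI /andP [iI /eqP ->]] := basis_ex S.
rewrite -(card_imset _ fI); move: iI; rewrite -H => /eqP <-; exact/rk_mono/imsetS.
Qed.

(* The rank-theoretic form of "N is M / C \ D with D the complement of C and the image of h". *)
Definition embeds (M N : matroid) (C : {set M}) (h : N -> M) : Prop :=
  [/\ injective h, forall x, h x \notin C & forall S : {set N}, rk (h @: S :|: C) = rk S + rk C].

Lemma minor_embeds M C D : @embeds M (minor C D) C val.
Proof.
split; first exact: val_inj.
  by move=> x; have := valP x; rewrite inE negb_or => /andP [].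
by move=> S /=; rewrite /minor_rk subnK // rk_mono // subsetUr.
Qed.

Lemma embeds_trans (M N Q : matroid) (C : {set M}) (h : N -> M) (C' : {set N}) (h' : Q -> N) :
  embeds C h -> embeds C' h' -> embeds (h @: C' :|: C) (h \o h').
Proof.
move=> [hI hC hr] [hI' hC' hr']; split.
- exact: inj_comp.
- move=> x; rewrite inE negb_or hC andbT; apply/imsetP => [[y yC' /hI E]].
  by have := hC' x; rewrite E yC'.
- move=> S; rewrite imset_comp setUA -imsetU !hr hr'; lia.
Qed.

Lemma embeds_iso (M N : matroid) (f : M -> N) : bijective f -> (forall S : {set M}, rk (f @: S) = rk S) -> embeds set0 f.
Proof.
move=> bf Hf; split; first exact: bij_inj.
  by move=> x; rewrite inE.
move=> S; rewrite setU0 Hf; have := rk_le_card (set0 : {set N}); rewrite cards0; lia.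
Qed.

Lemma embeds_minor_iso (M N : matroid) (C D : {set M}) (h : N -> M) :
  embeds C h -> D = ~: (C :|: [set h x | x : N]) -> matroid_iso N (minor C D).
Proof.
move=> [hI hC hr] DE.
have hP x : h x \notin C :|: D.
  by rewrite DE !inE negb_or hC /= negbK imset_f ?orbT.
pose f x : minor C D := Sub (h x) (hP x).
have fI : injective f by move=> x y /(congr1 val) /hI.
exists f.
  have sf (y : minor C D) : exists x, h x == val y.
    have : val y \notin C :|: D := valP y.
    move: (val y) => z; rewrite DE !inE; case: (z \in C) => //=; rewrite negbK.
    by case/imsetP => x _ ->; exists x.
  exists (fun y => xchoose (sf y)) => [x|y]; last by apply: val_inj; exact/eqP/(xchooseP (sf y)).
  by apply: hI; exact/eqP/(xchooseP (sf (f x))).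
move=> S /=; rewrite /minor_rk.
have -> : minor_lift (f @: S) = h @: S by rewrite /minor_lift -imset_comp; apply: eq_imset.
by rewrite hr addnK.
Qed.

Lemma has_minorP (M N : matroid) : has_minor M N <-> exists (C : {set M}) (h : N -> M), embeds C h.
Proof.
split=> [[C [D [_ /matroid_iso_sym [f bf Hf]]]]|[C [h e]]].
  by do 2!eexists; exact: embeds_trans (minor_embeds C D) (embeds_iso bf Hf).
exists C, (~: (C :|: [set h x | x : N])); split; last exact: matroid_iso_sym (embeds_minor_iso e erefl).
by rewrite -setI_eq0 setCU setIA setICr set0I.
Qed.

Lemma has_minor_trans (M N Q : matroid) : has_minor M N -> has_minor N Q -> has_minor M Q.
Proof.
move=> /has_minorP [C [h e]] /has_minorP [C' [h' e']]; apply/has_minorP.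
by exists (h @: C' :|: C), (h \o h'); exact: embeds_trans.
Qed.

Lemma iso_has_minor (M N : matroid) : matroid_iso M N -> has_minor M N.
Proof.
by move=> /matroid_iso_sym [f bf Hf]; apply/has_minorP; exists set0, f; exact: embeds_iso.
Qed.

(** Contracting more than [C] and staying clear of [D] factors through the minor. It serves
    templates, where [C] is contracted and [Y1] deleted in advance. *)
Lemma has_minor_minor (M N : matroid) (C D K : {set M}) (h : N -> M) :
  embeds K h -> C \subset K -> [disjoint K & D] -> (forall x, h x \notin D) ->
  has_minor (minor C D) N.
Proof.
move=> [hI hK hr] sCK dKD hD; apply/has_minorP.
have hP x : h x \notin C :|: D.
  by rewrite inE negb_or hD andbT; apply: contra (hK x); exact: (subsetP sCK).
pose h1 x : minor C D := Sub (h x) (hP x).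
pose K1 : {set minor C D} := [set x | val x \in K].
have h1E (S : {set N}) : val @: (h1 @: S) = h @: S by rewrite -imset_comp; apply: eq_imset.
have K1E : val @: K1 :|: C = K.
  apply/setP => x; rewrite inE; apply/orP/idP => [[/imsetP [y + ->]|]|xK].
  - by rewrite inE.
  - exact: (subsetP sCK).
  have [xC|xC] := boolP (x \in C); [by right|left].
  have xP : x \notin C :|: D by rewrite inE negb_or xC (disjointFr dKD xK).
  by apply/imsetP; exists (Sub x xP); rewrite // inE.
exists K1, h1; split.
- by move=> x y /(congr1 val) /hI.
- by move=> x; rewrite inE /=; exact: hK.
- move=> S /=; rewrite /minor_rk /minor_lift imsetU h1E -setUA K1E hr.
  by have := rk_mono sCK; lia.
Qed.

Lemma dual_rkE (M : matroid) (S : {set M}) : rk (m := dual M) S + rk [set: M] = #|S| + rk (~: S).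
Proof. by rewrite /= /dual_rk subnK // rk_setT_le. Qed.

Lemma dual_dual_rk (M : matroid) (S : {set M}) : rk (m := dual (dual M)) S = rk S.
Proof.
have aux x y z s t u m r : x + y = s + z -> z + u = t + r -> y + u = m + 0 -> s + t = m -> x = r.
  by lia.
have rk0 : rk (set0 : {set M}) = 0 by apply/eqP; rewrite -leqn0 -(cards0 M) rk_le_card.
have e1 := dual_rkE (S : {set dual M}).
have e2 : rk (m := dual M) (~: S) + rk [set: M] = #|~: S| + rk S.
  by have := dual_rkE (~: S : {set M}); rewrite setCK.
have e3 : rk (m := dual M) setT + rk [set: M] = #|M| + 0.
  by have := dual_rkE (setT : {set M}); rewrite setCT cardsT rk0.
exact: aux e1 e2 e3 (cardsC S).
Qed.

Lemma dual_dual_iso (M : matroid) : matroid_iso M (dual (dual M)).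
Proof. by exists id => [|S]; [exists id | rewrite imset_id dual_dual_rk]. Qed.

Lemma has_minor_dual (M N : matroid) : has_minor M N -> has_minor (dual M) (dual N).
Proof.
move=> /has_minorP [C [h [hI hC hr]]]; apply/has_minorP.
pose H := h @: [set: N]; pose K := ~: (C :|: H).
have hH (S : {set N}) : h @: S \subset H by apply: imsetS; exact: subsetT.
exists (K : {set dual M}), h; split=> // [x|S].
  by rewrite inE negbK inE imset_f ?orbT.
have aux a b c rM k rT rC s r :
  b + rM = k + (rT + rC) -> a + rM = (s + k) + (r + rC) -> c + rT = s + r -> a = c + b by lia.
have e1 : rk (m := dual M) K + rk [set: M] = #|K| + (rk [set: N] + rk C).
  by have := dual_rkE (K : {set M}); rewrite -hr setCK setUC.
have cE : #|h @: S :|: K| = #|S| + #|K|.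
  rewrite cardsU card_imset // (_ : _ :&: _ = set0) ?cards0 ?subn0 //.
  apply/setP => y; rewrite !inE; apply/negP => /andP [/(subsetP (hH S)) ->].
  by rewrite orbT.
have e2 : rk (m := dual M) (h @: S :|: K) + rk [set: M] = #|S| + #|K| + (rk (m := N) (~: S) + rk C).
  apply: etrans (dual_rkE (h @: S :|: K : {set M})) _.
  have -> : ~: (h @: S :|: K) = h @: (~: S) :|: C.
    apply/setP => y; rewrite !inE.
    have [/imsetP [x _ ->]|nH] := boolP (y \in H).
      by rewrite !(mem_imset _ _ hI) inE (negPf (hC x)) !orbT /= !orbF.
    have nI (T : {set N}) : y \in h @: T = false.
      by apply/negP => /(subsetP (hH T)); rewrite (negPf nH).
    by rewrite !nI /= orbF negbK.
  by rewrite hr; congr (_ + _); exact: cE.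
exact: aux e1 e2 (dual_rkE (S : {set N})).
Qed.

Section Represents.
Variable M : matroid.

Definition represents (vT : vectType 'F_2) (a : M -> vT) : Prop := forall S : {set M}, rk S = span_rk a S.

Lemma represents_indep (vT : vectType 'F_2) (a : M -> vT) : represents a ->
  forall S : {set M}, reflect (forall T : {set M}, T \subset S -> nul a T -> T = set0) (indep S).
Proof.
move=> ra S; have E : indep S = free [seq a e | e in S].
  by rewrite /indep ra /span_rk /free size_image.
by rewrite E; exact: free_nulP.
Qed.

Lemma represents_nul (vT wT : vectType 'F_2) (a : M -> vT) (b : M -> wT) :
  represents a -> represents b -> nul a =1 nul b.
Proof. by move=> ra rb; apply: nul_span_rk => S; rewrite -ra -rb. Qed.

End Represents.

Lemma represents_iso (M N : matroid) (vT : vectType 'F_2) (a : M -> vT) (h : N -> M) :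
  represents a -> (forall S : {set N}, rk (h @: S) = rk S) -> represents (a \o h).
Proof. by move=> ra H S; rewrite span_rk_inj -ra H. Qed.

Lemma represents_embeds (M N : matroid) (vT : vectType 'F_2) (a : M -> vT) (C : {set M}) (h : N -> M) (f : 'End(vT)) :
  represents a -> embeds C h -> lker f = <<[seq a e | e in C]>>%VS -> represents (f \o a \o h).
Proof.
move=> ra [hI hC hr] kf S; rewrite span_rk_inj (span_rk_quot _ kf) -!ra hr.
by rewrite addnK.
Qed.

(** Composing [a] with the quotient by the span of [C] gives a family on N with the null sets of
    [b], hence with the same ranks. *)
Lemma embeds_of_nul (M N : matroid) (vT wT : vectType 'F_2) (a : M -> vT) (b : N -> wT)
    (C : {set M}) (h : N -> M) :
  represents a -> represents b -> injective h -> (forall x, h x \notin C) ->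
  (forall S : {set N}, (sumv (a \o h) S \in <<[seq a e | e in C]>>%VS) = nul b S) -> embeds C h.
Proof.
move=> ra rb hI hC H; split=> // S.
have [f kf] := quot_ex <<[seq a e | e in C]>>%VS.
have := span_rk_quot (h @: S) kf; rewrite -span_rk_inj -!ra.
have -> : span_rk ((f \o a) \o h) S = rk S.
  rewrite rb; apply: span_rk_nul => T.
  by rewrite -H -kf memv_ker sumv_lin.
by have := rk_mono (subsetUr (h @: S) C); lia.
Qed.

Lemma vector_represents (B E : finType) (A : bmatrix B E) : @represents (vector_matroid A) _ (column A).
Proof. by []. Qed.

Lemma cycle_represents (G : graph) : @represents (cycle_matroid G) _ (@inc_vec G).
Proof. by move=> S; exact: cycle_rkE. Qed.

Lemma binaryP (M : matroid) :
  binary M <-> exists (B : finType) (a : M -> {ffun B -> ('F_2)^o}), represents a.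
Proof.
split=> [[B [E [A /matroid_iso_sym [f bf Hf]]]]|[B [a ra]]].
  by exists B, (column A \o f); apply: represents_iso.
exists B, M, (fun b e => a e b), id; first by exists id.
move=> S; rewrite imset_id ra /=; congr (\dim _); apply: eq_span => v.
have E x : column (fun b e => a e b) x = a x by apply/ffunP => b; rewrite ffunE.
by apply/imageP/imageP => [[x xS ->]|[x xS ->]]; exists x.
Qed.

Lemma binary_minor (M N : matroid) : binary M -> has_minor M N -> binary N.
Proof.
move=> /binaryP [B [a ra]] /has_minorP [C [h e]]; apply/binaryP.
have [f kf] := quot_ex <<[seq a e | e in C]>>%VS.
by exists B, (f \o a \o h); exact: represents_embeds e kf.
Qed.

(** S is independent in the dual when its complement spans M. If [a e] lies outside the span of the
    complement, a separating functional has its support in S, and this support is orthogonal to all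
    null sets of [a], hence null for [b]. Conversely, an element of a null set T inside S, written
    through the complement of S, gives a null set of [a] that meets T in this element only. *)
Lemma represents_dual (M : matroid) (vT wT : vectType 'F_2) (a : M -> vT) (b : M -> wT) :
  represents a ->
  (forall T : {set M}, nul b T <-> forall S, nul a S -> ~~ odd #|T :&: S|) ->
  @represents (dual M) _ b.
Proof.
move=> ra H.
pose V : matroid := Matroid (span_rk_le_card b) (@span_rk_mono _ _ _ b) (span_rk_submod b).
move=> S; rewrite -[span_rk b S]/(rk (m := V) S).
rewrite -[S in LHS](imset_id (S : {set V})); apply: (@rk_indep V (dual M) id) => // {}S; rewrite imset_id.
have dE : indep (S : {set dual M}) = (rk (m := M) (~: S) == rk [set: M]).
  have aux x r c s : x + r = c + s -> (x == c) = (s == r) by lia.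
  exact: aux (dual_rkE (S : {set M})).
have rV : @represents V _ b by [].
rewrite dE; apply/eqP/(represents_indep rV) => [rE T sTS nT|fS].
  apply/eqP/set0Pn => [[e eT]].
  have : a e \in <<[seq a x | x in ~: S]>>%VS.
    have eqV : <<[seq a x | x in ~: S]>>%VS = <<[seq a x | x in setT]>>%VS.
      apply/eqP; rewrite eqEdim -!/(span_rk a _) -!ra rE leqnn andbT.
      by apply: sub_span => v /imageP [x _ ->]; apply: image_f.
    by rewrite eqV; apply: memv_span; apply: image_f.
  move=> /mem_spanP [U sU aU].
  have := (H T).1 nT (symd [set e] U).
  rewrite /nul sumvD sumv1 aU addrr_F2 eqxx => /(_ isT).
  rewrite setI_symdr odd_symd (setIidPr _) ?sub1set // cards1.
  rewrite (_ : T :&: U = set0) ?cards0 //.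
  apply/eqP; rewrite setI_eq0 disjoint_sym; apply/(disjointWr sTS).
  by rewrite disjoints_subset.
apply/esym/rk_gen => [|e _]; first exact: subsetT.
suff ae : a e \in <<[seq a x | x in ~: S]>>%VS.
  rewrite !ra; congr (\dim _); apply/eqP; rewrite eqEsubv; apply/andP; split.
    apply/span_subvP => v /imageP [x]; rewrite inE => /orP [/set1P -> -> //|xS ->].
    by apply: memv_span; apply: image_f.
  by apply: sub_span => v /imageP [x xS ->]; apply: image_f; rewrite inE xS orbT.
apply/negPn/negP => /functional_sep [phi [phiD phi0 phie]].
have : [set x | phi (a x)] = set0.
  apply: fS.
    apply/subsetP => x; rewrite inE; apply: contraTT => xS; apply: phi0.
    by apply: memv_span; apply: image_f; rewrite inE.
  apply/H => U nU; rewrite setIC -(functional_sum phiD) (eqP nU).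
  by apply: phi0; rewrite mem0v.
by move/setP/(_ e); rewrite !inE phie.
Qed.

(** * Matroids conforming to a template *)

Lemma sumv_ffun (E B : finType) (a : E -> {ffun B -> ('F_2)^o}) (S : {set E}) b :
  (sumv a S b = \sum_(e in S) a e b)%R.
Proof. by rewrite /sumv sum_ffunE. Qed.

Lemma nul1 (E : finType) (vT : vectType 'F_2) (a : E -> vT) x : nul a [set x] = (a x == 0%R).
Proof. by rewrite /nul sumv1. Qed.

Lemma nul2 (E : finType) (vT : vectType 'F_2) (a : E -> vT) x y : x != y -> nul a [set x; y] = (a x == a y).
Proof. by move=> nxy; rewrite /nul /sumv big_setU1 ?inE // big_set1 addr_eq0_F2. Qed.

(** Since [b] has neither zero nor repeated vectors, the condition on sets of size one and two
    already shows that [h] avoids [C] and is injective. *)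
Lemma embeds_simple (M N : matroid) (vT wT : vectType 'F_2) (a : M -> vT) (b : N -> wT)
    (C : {set M}) (h : N -> M) :
  represents a -> represents b ->
  (forall x, b x != 0%R) -> injective b ->
  (forall S : {set N}, (sumv (a \o h) S \in <<[seq a e | e in C]>>%VS) = nul b S) -> embeds C h.
Proof.
move=> ra rb b0 bI H; apply: (embeds_of_nul ra rb) => // [x y hxy|x].
  apply/eqP/negPn/negP => nxy; have /eqP/bI exy : b x == b y.
    by rewrite -(nul2 _ nxy) -H /sumv big_setU1 ?big_set1 ?inE //= hxy addrr_F2 mem0v.
  by rewrite exy eqxx in nxy.
apply/negP => hC; case/negP: (b0 x); rewrite -nul1 -H sumv1; apply: memv_span; exact: image_f.
Qed.

(** [None] is the zero vector, so that a frame column, which may have fewer than two nonzero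
    entries, is always a sum of two vertices. *)
Definition vtx (R : eqType) (p : option R) (r : R) : 'F_2 := ((p == Some r)%:R)%R.

Lemma vtx_Some (R : eqType) (p r : R) : vtx (Some p) r = ((p == r)%:R)%R.
Proof. by []. Qed.

Section Member.
Variables (Phi : template) (R FZ FF : finType).
Variables (D : R -> {ffun tcols (tY0 Phi) (tY1 Phi) (tC Phi) -> 'F_2}).
Hypothesis D_Delta : forall r, D r \in tDelta Phi.
Variables (zr : FZ -> R) (zy : FZ -> tY1 Phi).
Variables (fp fq : FF -> option R) (lam : FF -> {ffun tX Phi -> 'F_2}).
Hypothesis lam_Lambda : forall f, lam f \in tLambda Phi.

Definition member_pre : bmatrix (brows Phi R) (ecols Phi (FZ + FF)%type) :=
  fun b e => match b, e with
  | inl x, inl d => tA1 x d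
  | inr r, inl d => D r d
  | inl x, inr (inl z) => 0%R
  | inr r, inr (inl z) => ((r == zr z)%:R)%R
  | inl x, inr (inr f) => lam f x
  | inr r, inr (inr f) => (vtx (fp f) r + vtx (fq f) r)%R
  end.

Definition member_mx : bmatrix (brows Phi R) (ecols Phi (FZ + FF)%type) :=
  fun b e => match e with
  | inr (inl z) => (member_pre b e + member_pre b (inl (inl (inr (zy z)))))%R
  | _ => member_pre b e
  end.

Definition C_cols (F : finType) : {set ecols Phi F} := [set inl (inr c) | c : tC Phi].
Definition Y1_cols (F : finType) : {set ecols Phi F} := [set inl (inl (inr j)) | j : tY1 Phi].

Definition member_of : matroid := @minor (vector_matroid member_mx) (C_cols _) (Y1_cols _).

Lemma member_conforms : conforms Phi member_of.
Proof.
exists R, (FZ + FF)%type, member_mx; split; last exact: matroid_iso_refl.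
exists member_pre, [set inl z | z : FZ]; split.
- split=> //.
  + by move=> _ /imsetP [z _ ->]; split=> //; exists (zr z).
  + move=> [z|f]; first by rewrite imset_f.
    move=> _; apply: (@leq_trans #|[set r | fp f == Some r] :|: [set r | fq f == Some r]|).
      apply: subset_leq_card; apply/subsetP => r; rewrite !inE /= /vtx.
      by case: (fp f == _); case: (fq f == _).
    apply: (leq_trans (leq_card_setU _ _)).
    have le1 (p : option R) : #|[set r | p == Some r]| <= 1.
      case: p => [r|]; last by rewrite (_ : [set _ | _] = set0) ?cards0 //; apply/setP => r; rewrite !inE.
      rewrite (_ : [set _ | _] = [set r]) ?cards1 //; apply/setP => r'; rewrite !inE.
      by rewrite -[Some r == Some r']/(r == r') eq_sym.
    by have := le1 (fp f); have := le1 (fq f); lia.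
  + move=> [z|f]; first by rewrite imset_f.
    move=> _; rewrite (_ : [ffun _ => _] = lam f) //; by apply/ffunP => x; rewrite ffunE.
  + move=> r; rewrite (_ : [ffun _ => _] = D r) //; by apply/ffunP => x; rewrite ffunE.
- by [].
- by move=> b [z|f] //; rewrite imset_f.
- by move=> _ /imsetP [z _ ->]; exists (zy z) => b.
Qed.

Lemma member_minor (Q : matroid) (vT : vectType 'F_2) (b : Q -> vT)
    (K : {set ecols Phi (FZ + FF)%type}) (h : Q -> FZ + FF) :
  represents b ->
  (forall x, b x != 0%R) -> injective b ->
  C_cols _ \subset K -> [disjoint K & Y1_cols (FZ + FF)%type] ->
  (forall S : {set Q}, (sumv (column member_mx \o (inr \o h)) S \in
     <<[seq column member_mx e | e in K]>>%VS) = nul b S) ->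
  has_minor member_of Q.
Proof.
move=> rb b0 bI sCK dKY H.
have emb := @embeds_simple (vector_matroid member_mx) Q _ _ _ _ K (inr \o h)
  (@vector_represents _ _ member_mx) rb b0 bI H.
apply: (has_minor_minor emb) => // x.
by apply/imsetP => [[j _]].
Qed.

End Member.

Definition H12_ends : seq (nat * nat) :=
  [:: (0, 3); (0, 3); (0, 4); (0, 4); (1, 2); (1, 2); (1, 4); (1, 4); (0, 2); (0, 2); (3, 4); (3, 4)].

(** H12 is a signed graph: the 5-cycle 0, 2, 1, 4, 3 with the chord 04, each edge doubled with
    opposite signs. Row 0 holds the signs; it may replace the row of vertex 0, which is the sum of
    the other rows of the incidence matrix. *)
Lemma H12_signed_graph (i : 'I_5) (j : 'I_12) :
  H12_matrix i j = if i == 0 :> nat then (~~ odd j)%:R%R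
    else (((nth (0, 0) H12_ends j).1 == i)%:R + ((nth (0, 0) H12_ends j).2 == i)%:R)%R.
Proof.
case: i => [[|[|[|[|[|i]]]]] Hi] //; rewrite /H12_matrix /=;
by case: j => [[|[|[|[|[|[|[|[|[|[|[|[|j]]]]]]]]]]]] Hj] //=; apply/eqP.
Qed.

Definition h12 : 'I_12 -> {ffun 'I_5 -> ('F_2)^o} := column H12_matrix.

Lemma H12_represents : @represents H12 _ h12.
Proof. exact: vector_represents. Qed.

Lemma h12_neq0 x : h12 x != 0%R.
Proof.
suff /existsP [i] : [exists i, h12 x i != 0%R] by apply: contra => /eqP ->; rewrite ffunE.
by case: x => [[|[|[|[|[|[|[|[|[|[|[|[|j]]]]]]]]]]]] Hj] //=; apply/existsP; 
 first [by (exists (inord 0); rewrite ffunE /H12_matrix inordK) | by (exists (inord 1); rewrite ffunE /H12_matrix inordK)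
 |by (exists (inord 2); rewrite ffunE /H12_matrix inordK)|by (exists (inord 3); rewrite ffunE /H12_matrix inordK)|by (exists (inord 4); rewrite ffunE /H12_matrix inordK)].
Qed.

Lemma h12_inj : injective h12.
Proof.
move=> x y E; pose w (j : 'I_12) := [seq nth 0 (nth [::] H12_rows i) j | i <- iota 0 5].
have {}E : w x = w y.
  apply: (@eq_from_nth _ 0); rewrite /w !size_map // size_iota => i i5.
  rewrite !(nth_map 0) ?size_iota // nth_iota // add0n.
  have := congr1 (fun g : {ffun 'I_5 -> ('F_2)^o} => g (Ordinal i5)) E; rewrite !ffunE /H12_matrix /=.
  case: x y i i5 {E} => [x Hx] [y Hy] i i5 /=.
  have le1 k z : k < 5 -> z < 12 -> nth 0 (nth [::] H12_rows k) z < 2.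
    by case: k => [|[|[|[|[|k]]]]] // _; case: z => [|[|[|[|[|[|[|[|[|[|[|[|z]]]]]]]]]]]].
  have := le1 _ _ i5 Hx; have := le1 _ _ i5 Hy.
  by case: (nth 0 _ x) => [|[|?]] //; case: (nth 0 _ y) => [|[|?]].
apply: val_inj; move: E; rewrite /w.
have U : uniq [seq [seq nth 0 (nth [::] H12_rows i) j | i <- iota 0 5] | j <- iota 0 12] by [].
have := @nth_uniq _ [::] _ x y _ _ U; rewrite !size_map size_iota !ltn_ord.
rewrite !(nth_map 0) ?size_iota ?ltn_ord // !nth_iota ?ltn_ord // !add0n.
by move=> /(_ isT isT) E1 E2; apply/eqP; rewrite -E1 E2.
Qed.

Lemma C_Y1_disjoint (Phi : template) (F : finType) : [disjoint C_cols Phi F & Y1_cols Phi F].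
Proof.
rewrite -setI_eq0; apply/eqP/setP => x; rewrite !inE; apply/negP => /andP [].
by move=> /imsetP [c _ ->] /imsetP [].
Qed.

Arguments ends : simpl never.

Lemma complete_card n (e : edge (complete_graph n)) : #|ends e| = 2.
Proof. exact: (eqP (valP e)). Qed.

Lemma complete_ends_inj n : injective (@ends (complete_graph n)).
Proof. exact: val_inj. Qed.

Lemma complete_inc n (e : edge (complete_graph n)) x : inc_vec e x = ((x \in ends e)%:R)%R.
Proof.
rewrite /inc_vec complete_card eqxx sum_ffunE.
have [xe|xe] := boolP (x \in ends e).
  rewrite (bigD1 x) //= big1 ?addr0 ?ffunE ?eqxx // => y /andP [_ nyx].
  by rewrite ffunE eq_sym (negPf nyx).
rewrite big1 // => y ye; rewrite ffunE; case: eqP => // xy.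
by rewrite xy ye in xe.
Qed.

Lemma complete_inc_neq0 n (e : edge (complete_graph n)) : inc_vec e != 0%R.
Proof.
have /card_gt0P [x xe] : 0 < #|ends e| by rewrite complete_card.
apply/eqP => /ffunP /(_ x); rewrite complete_inc xe ffunE => /eqP.
by rewrite oner_eq0.
Qed.

Lemma complete_inc_inj n : injective (@inc_vec (complete_graph n)).
Proof.
move=> e f E; apply: (@complete_ends_inj n); apply/setP => x; have := congr1 (fun g : {ffun _ -> _} => g x) E.
by rewrite !complete_inc; case: (x \in _); case: (x \in _) => // /eqP; rewrite ?oner_eq0 // eq_sym oner_eq0.
Qed.

Lemma complete_ends n (e : edge (complete_graph n)) :
  exists p : 'I_n * 'I_n, (p.1 != p.2) && (ends e == [set p.1; p.2]).
Proof.
have /eqP/cards2P [u [w [nuw E]]] := complete_card e.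
by exists (u, w); rewrite E /= nuw eqxx.
Qed.

(** With zero rows from Delta and zero columns from Lambda, the contracted columns live on the rows
    [X] and the edge columns on the new rows only, so contracting C does not touch the graph. *)
Lemma template_complete_minor (Phi : template) n :
  exists2 N, conforms Phi N & has_minor N (cycle_matroid (complete_graph n)).
Proof.
have D0 := (tDelta_subgroup Phi).1; have L0 := (tLambda_subgroup Phi).1.
pose fe (e : edge (complete_graph n)) := xchoose (complete_ends e).
pose mx := @member_mx Phi 'I_n void (edge (complete_graph n)) (fun _ => 0%R)
  (fun z => match z with end) (fun z => match z with end)
  (fun e => Some (fe e).1) (fun e => Some (fe e).2) (fun _ => 0%R).
exists (@member_of Phi 'I_n void (edge (complete_graph n)) (fun _ => 0%R)
  (fun z => match z with end) (fun z => match z with end)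
  (fun e => Some (fe e).1) (fun e => Some (fe e).2) (fun _ => 0%R)).
  exact: member_conforms.
apply: (@member_minor _ _ _ _ _ _ _ _ _ _ (cycle_matroid (complete_graph n)) _ _ (C_cols _ _) inr).
- exact: cycle_represents.
- exact: complete_inc_neq0.
- exact: complete_inc_inj.
- exact: subxx.
- exact: C_Y1_disjoint.
move=> S; rewrite -/mx.
have colX e x : (column mx \o (inr \o inr)) e (inl x) = 0%R by rewrite /= ffunE /= ffunE.
have colR e r : (column mx \o (inr \o inr)) e (inr r) = inc_vec e r.
  rewrite /= !ffunE complete_inc /= !vtx_Some.
  have /andP [nuw /eqP ->] := xchooseP (complete_ends e); rewrite !inE -/(fe e).
  rewrite !(eq_sym r); case: eqP => [<-|_]; last by rewrite add0r.
  by rewrite eq_sym (negPf nuw) addr0.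
apply/mem_spanP/eqP => [[T /subsetP sT E]|nS].
  apply/ffunP => r; rewrite sumv_ffun [RHS]ffunE.
  under eq_bigr do rewrite -colR.
  rewrite -sumv_ffun E sumv_ffun big1 // => e /sT /imsetP [c _ ->].
  by rewrite !ffunE /= ffunE.
exists set0; first exact: sub0set.
rewrite [RHS]/sumv big_set0; apply/ffunP => [[x|r]]; rewrite sumv_ffun [RHS]ffunE.
  by rewrite big1.
under eq_bigr do rewrite colR.
by rewrite -sumv_ffun nS ffunE.
Qed.

(* The columns phi, phi + lam over the edges phi of a 5-cycle with a chord, placed on four new rows. *)
Lemma template_H12_of_Lambda (Psi : template) (R : finType)
    (D : R -> {ffun tcols (tY0 Psi) (tY1 Psi) (tC Psi) -> 'F_2}) (lam : {ffun tX Psi -> 'F_2}) :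
  (forall r, D r \in tDelta Psi) -> lam \in tLambda Psi ->
  ([ffun b => match b with inl x => lam x | inr r => 0%R end] : {ffun brows Psi R -> ('F_2)^o})
    \notin <<[seq ([ffun b => match b with inl x => tA1 x (inr c) | inr r => D r (inr c) end]
        : {ffun brows Psi R -> ('F_2)^o}) | c in [set: tC Psi]]>>%VS ->
  exists2 N, conforms Psi N & has_minor N H12.
Proof.
move=> DD Llam nsp.
have D0 := (tDelta_subgroup Psi).1; have L0 := (tLambda_subgroup Psi).1.
pose D' (r : (R + 'I_4)%type) := if r is inl r' then D r' else 0%R.
(* Vertex 0 becomes the zero vector, because row 0 of H12 is taken up by the sign, here the multiple
   of [lam]. *)
pose vt k : option (R + 'I_4)%type := if k == 0 then None else Some (inr (inord k.-1)).
pose fp (j : 'I_12) := vt (nth (0, 0) H12_ends j).1.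
pose fq (j : 'I_12) := vt (nth (0, 0) H12_ends j).2.
pose la (j : 'I_12) : {ffun tX Psi -> 'F_2} := if odd j then 0%R else lam.
pose mx := @member_mx Psi _ void 'I_12 D' (fun z => match z with end) (fun z => match z with end) fp fq la.
exists (@member_of Psi _ void 'I_12 D' (fun z => match z with end) (fun z => match z with end) fp fq la).
  by apply: member_conforms => [[r|r]|j] /=; rewrite /la; try case: ifP.
apply: (@member_minor _ _ _ _ _ _ _ _ _ _ H12 _ h12 (C_cols _ _) inr).
- exact: H12_represents.
- exact: h12_neq0.
- exact: h12_inj.
- exact: subxx.
- exact: C_Y1_disjoint.
move=> S; rewrite -/mx.
have ends4 (j : 'I_12) : (nth (0, 0) H12_ends j).1 < 5 /\ (nth (0, 0) H12_ends j).2 < 5.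
  by case: j => [[|[|[|[|[|[|[|[|[|[|[|[|j]]]]]]]]]]]] Hj].
have vtE k (i : 'I_4) : k < 5 -> vtx (vt k) (inr i : (R + 'I_4)%type) = ((k == lift ord0 i)%:R)%R.
  case: k => [|k] k5; first by rewrite /vt /vtx.
  rewrite /vt /= vtx_Some; congr (nat_of_bool _)%:R%R.
  by rewrite -[inr _ == _]/(inord k == i) -val_eqE /= inordK // /bump /= add1n.
have colX e x : (column mx \o (inr \o inr)) e (inl x) = (h12 e ord0 * lam x)%R.
  rewrite /= !ffunE /= H12_signed_graph /= /la.
  by case: (odd e); rewrite ?ffunE ?mul0r ?mul1r.
have colR e r : (column mx \o (inr \o inr)) e (inr (inl r)) = 0%R.
  rewrite /= !ffunE /= /vtx /fp /fq /vt.
  by case: ifP; case: ifP; rewrite ?addr0.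
have colI e i : (column mx \o (inr \o inr)) e (inr (inr i)) = h12 e (lift ord0 i).
  by rewrite /= !ffunE /= H12_signed_graph /= /fp /fq !vtE //; case: (ends4 e).
have sumX x : (sumv (column mx \o (inr \o inr)) S (inl x) = sumv h12 S ord0 * lam x)%R.
  by rewrite !sumv_ffun mulr_suml; apply: eq_bigr => e _; exact: colX.
have sumR r : (sumv (column mx \o (inr \o inr)) S (inr (inl r)) = 0)%R.
  by rewrite sumv_ffun big1.
have sumI i : (sumv (column mx \o (inr \o inr)) S (inr (inr i)) = sumv h12 S (lift ord0 i))%R.
  by rewrite !sumv_ffun; apply: eq_bigr => e _; exact: colI.
apply/mem_spanP/eqP => [[T /subsetP sT E]|nS]; last first.
  exists set0; first exact: sub0set.
  rewrite [RHS]/sumv big_set0; apply/ffunP => [[x|[r|i]]]; rewrite ?sumX ?sumR ?sumI ?nS !ffunE //.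
  by rewrite mul0r.
pose T' : {set tC Psi} := [set c | inl (inr c) \in T].
have TE : T = [set inl (inr c) | c in T'].
  apply/setP => e; apply/idP/imsetP => [eT|[c]]; last by rewrite inE => ? ->.
  by have /imsetP [c _ ec] := sT e eT; exists c; rewrite // inE -ec.
have sumT b : (sumv (column mx) T b = \sum_(c in T') mx b (inl (inr c)))%R.
  rewrite sumv_ffun TE big_imset /=; last by move=> ? ? _ _ [].
  by apply: eq_bigr => c _; rewrite ffunE.
(* A nonzero sign sum would express [lam] through the contracted columns, against the hypothesis. *)
have h0 : sumv h12 S ord0 = 0%R.
  apply/eqP/negPn/negP => s0; case/negP: nsp; apply/mem_spanP; exists T'; first exact: subsetT.
  have s1 : sumv h12 S ord0 = 1%R by case: (F2P (sumv h12 S ord0)) s0 => ->; rewrite ?eqxx.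
  apply/ffunP => b; rewrite sumv_ffun ffunE; under eq_bigr do rewrite ffunE.
  case: b => [x|r]; first by rewrite -[lam x]mul1r -{1}s1 -sumX E sumT.
  by rewrite -[LHS](sumR r) E sumT.
apply/ffunP => i; rewrite [RHS]ffunE.
have [->//|[i' ->]] : i = ord0 \/ exists i', i = lift ord0 i'.
  by case: (unliftP ord0 i) => [i' ->|->]; [right; exists i'|left].
by rewrite -sumI E sumT big1 // => c _; rewrite /= ffunE.
Qed.

(** * Two affine relations force H12 *)

Lemma mem_span_quot (E : finType) (vT : vectType 'F_2) (a : E -> vT) (f : 'End(vT)) (C K : {set E}) (x : vT) :
  lker f = <<[seq a e | e in C]>>%VS ->
  (f x \in <<[seq (f \o a) e | e in K]>>%VS) = (x \in <<[seq a e | e in K :|: C]>>%VS).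
Proof.
move=> kf; apply/mem_spanP/mem_spanP => [[T sT E1]|[T sT ->]].
  have : (x + sumv a T)%R \in <<[seq a e | e in C]>>%VS.
    by rewrite -kf memv_ker linearD /= E1 -sumv_lin addrr_F2.
  move=> /mem_spanP [T' sT' E2]; exists (symd T T').
    by apply: symd_sub; [apply: (subset_trans sT); exact: subsetUl|apply: (subset_trans sT'); exact: subsetUr].
  by rewrite sumvD -E2 addrCA addrr_F2 addr0.
exists (T :\: C).
  by apply/subsetP => y; rewrite inE => /andP [yC /(subsetP sT)]; rewrite inE (negPf yC) orbF.
rewrite -sumv_lin; apply/eqP; rewrite -addr_eq0_F2 -linearD -memv_ker kf; apply/mem_spanP.
exists (T :&: C); first exact: subsetIr.
rewrite -sumvD; congr (sumv a _); apply/setP => y; rewrite in_symd !inE.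
by case: (y \in C); case: (y \in T).
Qed.

Section EdgeFamilies.
Variables (V : finType).
Implicit Types (T X : {set V}).

Definition edge_vec (vT : vectType 'F_2) (w : V -> vT) (e : V * V) : vT := (w e.1 + w e.2)%R.

(** The ambient matroid has one element for each ordered pair of points; in a template these are
    frame columns. *)
Definition edges_H12 (vT : vectType 'F_2) (w : V -> vT) : Prop :=
  exists (K : {set V * V}) (iota : 'I_12 -> V * V), forall S : {set 'I_12},
    (sumv (edge_vec w \o iota) S \in <<[seq edge_vec w e | e in K]>>%VS) = nul h12 S.

(* Affine relations between the points w, as even sets of vertices. *)
Definition rel0 (vT : vectType 'F_2) (w : V -> vT) T : bool := ~~ odd #|T| && nul w T.

Lemma rel0D (vT : vectType 'F_2) (w : V -> vT) T T' : rel0 w T -> rel0 w T' -> rel0 w (symd T T').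
Proof.
move=> /andP [/negPf o n] /andP [/negPf o' n']; apply/andP; split; last exact: nulD.
by rewrite odd_symd o o'.
Qed.

Lemma edge_vec_sum (vT : vectType 'F_2) (w : V -> vT) (I : finType) (p q : I -> V) (S : {set I}) :
  sumv (fun j => edge_vec w (p j, q j)) S = sumv w (\big[@symd V/set0]_(j in S) symd [set p j] [set q j]).
Proof.
rewrite [LHS]/sumv (big_morph (sumv w) (sumvD w) (_ : sumv w set0 = 0%R)); last first.
  by rewrite /sumv big_set0.
by apply: eq_bigr => j _; rewrite sumvD !sumv1.
Qed.

Lemma edge_vec_even (I : finType) (p q : I -> V) (S : {set I}) :
  ~~ odd #|\big[@symd V/set0]_(j in S) symd [set p j] [set q j]|.
Proof.
apply: (big_ind (fun T : {set V} => ~~ odd #|T|)).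
- by rewrite cards0.
- by move=> T T' /negPf o /negPf o'; rewrite odd_symd o o'.
- by move=> j _; rewrite odd_symd !cards1.
Qed.

Lemma edges_H12_contract (vT : vectType 'F_2) (w : V -> vT) (f : 'End(vT)) p q :
  lker f = <[edge_vec w (p, q)]>%VS -> edges_H12 (f \o w) -> edges_H12 w.
Proof.
move=> kf [K [i H]]; exists (K :|: [set (p, q)]), i => S; rewrite -H.
have kf' : lker f = <<[seq edge_vec w e | e in [set (p, q)]]>>%VS.
  by rewrite kf /image_mem enum_set1 /= span_seq1.
rewrite -(mem_span_quot _ _ kf') sumv_lin.
have E e : (f \o edge_vec w) e = edge_vec (f \o w) e by rewrite /edge_vec /= linearD.
by rewrite (eq_image (fun _ => erefl) E) /sumv (eq_bigr _ (fun j _ => E (i j))).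
Qed.

End EdgeFamilies.

(* The graph of H12 on 8 points modulo the relations 0123, 2345. *)
Definition H12_pts : seq (nat * nat) :=
  [:: (6, 2); (6, 3); (6, 4); (6, 5); (7, 0); (7, 1); (7, 4); (7, 5); (6, 0); (6, 1); (2, 5); (2, 4)].

Definition beta_rows : seq (seq nat) :=
  [:: [:: 1; 0; 1; 0; 1; 0; 0; 0];
      [:: 0; 0; 0; 0; 0; 0; 0; 1];
      [:: 1; 1; 0; 0; 0; 0; 0; 0];
      [:: 0; 0; 1; 1; 0; 0; 0; 0];
      [:: 0; 0; 0; 0; 1; 1; 0; 0]].

(** Point 6 is the origin, point 7 a free direction, and each of 0 + 1, 2 + 3, 4 + 5 is the first
    unit vector. *)
Definition beta (x : 'I_8) : {ffun 'I_5 -> ('F_2)^o} :=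
  [ffun i : 'I_5 => (nth 0 (nth [::] beta_rows i) x)%:R%R].

Definition H12_p (j : 'I_12) : 'I_8 := inord (nth (0, 0) H12_pts j).1.
Definition H12_q (j : 'I_12) : 'I_8 := inord (nth (0, 0) H12_pts j).2.

Lemma h12_beta j : h12 j = edge_vec beta (H12_p j, H12_q j).
Proof.
apply/ffunP => i; rewrite /edge_vec !ffunE /H12_matrix /H12_p /H12_q /=.
have [lp lq] : (nth (0, 0) H12_pts j).1 < 8 /\ (nth (0, 0) H12_pts j).2 < 8.
  by case: j => [[|[|[|[|[|[|[|[|[|[|[|[|j]]]]]]]]]]]] Hj].
rewrite !inordK //; case: i => [[|[|[|[|[|i]]]]] Hi] //=;
by case: j {lp lq} => [[|[|[|[|[|[|[|[|[|[|[|[|j]]]]]]]]]]]] Hj] //=; apply/eqP.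
Qed.

(** The four relations: the empty set, 0123, 2345 and their sum 0145. *)
Definition good8 (t : nat -> bool) : bool :=
  [&& ~~ t 7, ~~ t 6, t 0 == t 1, t 2 == t 3, t 4 == t 5 & ~~ (t 0 (+) t 2 (+) t 4)].

Lemma odd_card8 (T : {set 'I_8}) (t := fun k => inord k \in T) :
  odd #|T| = t 0 (+) t 1 (+) t 2 (+) t 3 (+) t 4 (+) t 5 (+) t 6 (+) t 7.
Proof.
rewrite -sum1_card big_mkcond /=.
rewrite (eq_bigr (fun i : 'I_8 => nat_of_bool (t i))); last by move=> i _; rewrite /t inord_val; case: (_ \in _).
rewrite !big_ord_recl big_ord0 /= !oddD !oddb addbF !addbA.
by rewrite /bump /=.
Qed.

(** Even size excludes sets such as {6}, which is null because point 6 is the origin but is no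
    affine relation. *)
Lemma good8P (t : nat -> bool) :
  ~~ (t 0 (+) t 1 (+) t 2 (+) t 3 (+) t 4 (+) t 5 (+) t 6 (+) t 7) ->
  all (fun i => ~~ odd (\sum_(x < 8) t x * nth 0 (nth [::] beta_rows i) x)) (iota 0 5) = good8 t.
Proof.
rewrite /= !big_ord_recl !big_ord0 /bump /= /good8.
by case: (t 0); case: (t 1); case: (t 2); case: (t 3); case: (t 4); case: (t 5); case: (t 6); case: (t 7).
Qed.

Lemma nul_beta (T : {set 'I_8}) : ~~ odd #|T| -> nul beta T = good8 (fun k => inord k \in T).
Proof.
rewrite odd_card8; set t := fun k => _ => od.
have E i : (sumv beta T i != 0%R) = odd (\sum_(x < 8) t x * nth 0 (nth [::] beta_rows i) x).
  rewrite sumv_ffun -F2_natr_neq0 natr_sum big_mkcond /=; congr (_ != _).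
  apply: eq_bigr => x _; rewrite ffunE /t inord_val.
  by case: (x \in T); rewrite ?mul1n ?mul0n.
have {}E : nul beta T = all (fun i => ~~ odd (\sum_(x < 8) t x * nth 0 (nth [::] beta_rows i) x)) (iota 0 5).
  apply/eqP/allP => [n0 i|H].
    by rewrite mem_iota => /= i5; rewrite -(E (Ordinal i5)) n0 ffunE eqxx.
  apply/ffunP => i; rewrite [RHS]ffunE; apply/eqP; rewrite -[_ == _]negbK E.
  by apply: H; rewrite mem_iota /=.
by rewrite E good8P.
Qed.

(** The even null sets are those of [beta], so the pairs listed in [H12_pts] form H12 and nothing is
    contracted. *)
Lemma edges_H12_base (V : finType) (vT : vectType 'F_2) (w : V -> vT) (vx : 'I_8 -> V) :
  (forall T : {set 'I_8}, ~~ odd #|T| -> nul (w \o vx) T = good8 (fun k => inord k \in T)) ->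
  edges_H12 w.
Proof.
move=> H; exists set0, (fun j => (vx (H12_p j), vx (H12_q j))) => S.
rewrite /image_mem enum_set0 span_nil memv0.
have -> : nul h12 S = nul (fun j => edge_vec beta (H12_p j, H12_q j)) S.
  by rewrite /nul /sumv; under eq_bigr do rewrite h12_beta.
rewrite -[X in X == _]/(sumv (fun j => edge_vec (w \o vx) (H12_p j, H12_q j)) S).
rewrite /nul !edge_vec_sum -!/(nul _ _) nul_beta ?edge_vec_even //.
by rewrite H // edge_vec_even.
Qed.

Section TwoRelations.
Variable V : finType.
Implicit Types (T X : {set V}).

Definition rels2 (vT : vectType 'F_2) (w : V -> vT) X : Prop :=
  exists T1 T2 : {set V}, [/\ T1 \subset X, T2 \subset X, rel0 w T1 & rel0 w T2] /\ [/\ T1 != set0, T2 != set0 & T1 != T2].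

Lemma card_symd (S T : {set V}) : #|symd S T| + #|S :&: T| * 2 = #|S| + #|T|.
Proof.
rewrite /symd cardsU; have -> : (S :\: T) :&: (T :\: S) = set0.
  by apply/setP => x; rewrite !inE; case: (x \in S); case: (x \in T).
by rewrite cards0 -(cardsID T S) -(cardsID S T) (setIC T S); lia.
Qed.

Lemma odd_rel (vT : vectType 'F_2) (w : V -> vT) T : rel0 w T -> odd #|T| = false.
Proof. by case/andP => /negPf. Qed.

(** Adding [T1] moves a relation off a chosen point x of [T1]. Were there a relation outside the
    span of [T1] and [T2], it and [T2], so corrected, would be two distinct nonempty relations
    without x. A point outside [T1] and [T2] could likewise be dropped. *)
Lemma rels2_minimal (vT : vectType 'F_2) (w : V -> vT) X T1 T2 :
  (forall x, x \in X -> ~ rels2 w (X :\ x)) ->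
  T1 \subset X -> T2 \subset X -> rel0 w T1 -> rel0 w T2 -> T1 != set0 -> T2 != set0 -> T1 != T2 ->
  X = T1 :|: T2 /\ forall T, T \subset X -> rel0 w T -> [|| T == set0, T == T1, T == T2 | T == symd T1 T2].
Proof.
move=> mX s1 s2 r1 r2 n1 n2 n12; split.
  apply/eqP; rewrite eqEsubset subUset s1 s2 !andbT; apply/subsetP => x xX.
  apply/negPn/negP; rewrite inE negb_or => /andP [x1 x2]; apply: (mX x xX).
  exists T1, T2; split; split=> //; apply/subsetP => y yT; rewrite !inE.
    by rewrite (subsetP s1) // andbT; apply: contraNneq x1 => <-.
  by rewrite (subsetP s2) // andbT; apply: contraNneq x2 => <-.
move=> T sT rT; apply/negPn/negP; rewrite !negb_or => /and4P [t0 t1 t2 t12].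
have [x xT1] := set0Pn _ n1; have xX := subsetP s1 x xT1; apply: (mX x xX).
pose fix_ (U : {set V}) := if x \in U then symd T1 U else U.
have fixP (U : {set V}) : U \subset X -> rel0 w U -> [/\ fix_ U \subset X :\ x & rel0 w (fix_ U)].
  move=> sU rU; rewrite /fix_; case: ifP => xU; split=> //; last 1 first.
  - by apply/subsetP => y yU; rewrite !inE (subsetP sU) // andbT; apply: contraFneq xU => <-.
  - have /subsetP sS : symd T1 U \subset X by exact: symd_sub.
    apply/subsetP => y yS; rewrite !inE sS // andbT; apply: contraTneq yS => ->.
    by rewrite in_symd xT1 xU.
  - exact: rel0D.
have [sf2 rf2] := fixP _ s2 r2; have [sf rf] := fixP _ sT rT.
have fix0 (U : {set V}) : U != set0 -> U != T1 -> fix_ U != set0.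
  by move=> u0 u1; rewrite /fix_; case: ifP => // _; rewrite symd_eq0 eq_sym.
exists (fix_ T2), (fix_ T); split; split=> //; first by rewrite fix0 // eq_sym.
  exact: fix0.
rewrite /fix_; case: ifP => _; case: ifP => _.
- by apply: contra t2 => /eqP E; rewrite -(symdK T1 T2) E symdK.
- by rewrite eq_sym.
- by apply: contra t12 => /eqP ->; rewrite symdK.
- by rewrite eq_sym.
Qed.

(* Three 4-sets contain at most 18 < 'C(7, 2) pairs. *)
Lemma two_subsets (X T1 T2 T3 : {set V}) : 6 < #|X| -> 
  exists p q : V, [/\ p \in X, q \in X, p != q &
    forall T, T \in [:: T1; T2; T3] -> #|T| = 4 -> ~~ ((p \in T) && (q \in T))].
Proof.
move=> X7; pose P (Y : {set V}) := [set A : {set V} | A \subset Y & #|A| == 2].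
pose c4 (T : {set V}) := if #|T| == 4 then P T else set0.
have c4le T : #|c4 T| <= 6.
  by rewrite /c4; case: eqP => [h|]; rewrite ?cards0 // cards_draws h.
have : ~~ (P X \subset c4 T1 :|: c4 T2 :|: c4 T3).
  apply/negP => /subset_leq_card; rewrite cards_draws => h.
  have b7 : 'C(7, 2) <= 'C(#|X|, 2) by apply: leq_bin2l.
  have := (leq_card_setU (c4 T1 :|: c4 T2) (c4 T3)).1; have := (leq_card_setU (c4 T1) (c4 T2)).1.
  have := c4le T1; have := c4le T2; have := c4le T3.
  move: b7 h; rewrite (_ : 'C(7, 2) = 21) //. lia.
case/subsetPn => A; rewrite inE => /andP [sA /cards2P [p [q [npq EA]]]] nA.
exists p, q; split=> //.
- by apply: (subsetP sA); rewrite EA !inE eqxx.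
- by apply: (subsetP sA); rewrite EA !inE eqxx orbT.
move=> T iT T4; apply: contra nA => /andP [pT qT].
have AT : A \in c4 T.
  by rewrite /c4 T4 eqxx inE EA subUset !sub1set pT qT cards2 npq.
by move: iT; rewrite !inE => /or3P [] /eqP E; rewrite -E AT ?orbT.
Qed.

(** Here x1, x2, x3 are the sizes of two sets and of their symmetric difference. Each element of the
    union lies in exactly two of the three sets, so x1 + x2 + x3 = 2u <= 12 and all three sizes are
    4. *)
Lemma sizes222 x1 x2 x3 i u a b : 3 < x1 -> 3 < x2 -> 3 < x3 -> x3 + i * 2 = x1 + x2 ->
  u + i = x1 + x2 -> u <= 6 -> i + a = x1 -> i + b = x2 -> [/\ a = 2, b = 2 & i = 2].
Proof. by move=> *; split; lia. Qed.

Lemma span1_F2 (vT : vectType 'F_2) (u v : vT) : (v \in <[u]>%VS) = (v == 0%R) || (v == u).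
Proof.
apply/vlineP/orP => [[k ->]|[/eqP ->|/eqP ->]].
- by case: (F2P k) => ->; rewrite ?scale0r ?scale1r eqxx; [left|right].
- by exists 0%R; rewrite scale0r.
- by exists 1%R; rewrite scale1r.
Qed.

(** The points [g] and [h] lie in no relation and become points 6 and 7 of [beta]. Points are
    dropped as long as two relations remain; by [rels2_minimal] exactly three nonempty relations are
    then left, all of size at least 4, and either a harmless pair can be contracted or the six-point
    configuration is reached. *)
Lemma two_relations_H12 g h (gh : g != h) (n : nat) : forall (vT : vectType 'F_2) (w : V -> vT) X, #|X| <= n ->
  g \notin X -> h \notin X ->
  (forall T, T \subset g |: (h |: X) -> rel0 w T -> T \subset X) ->
  (forall T, T \subset X -> rel0 w T -> #|T| != 2) ->
  rels2 w X -> edges_H12 w.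
Proof.
elim: n => [|n IH] vT w X leX gX hX H2 H3 R2.
  case: R2 => T1 [T2 [[s1 _ _ _] [n1 _ _]]]; move: leX; rewrite leqn0 cards_eq0 => /eqP X0.
  by move: s1 n1; rewrite X0 subset0 => /eqP ->; rewrite eqxx.
have [/existsP/sigW|] := boolP [exists x, (x \in X) && 
   [exists T1 : {set V}, exists T2 : {set V}, [&& T1 \subset X :\ x, T2 \subset X :\ x, rel0 w T1, rel0 w T2,
     T1 != set0, T2 != set0 & T1 != T2]]].
  case=> x /andP [xX /existsP [T1 /existsP [T2 /and5P [s1 s2 r1 r2 /and3P [n1 n2 n12]]]]].
  have sx : X :\ x \subset X by exact: subsetDl.
  apply: (IH _ w (X :\ x)).
  - by move: leX; rewrite (cardsD1 x) xX add1n ltnS.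
  - by apply: contra gX; exact: (subsetP sx).
  - by apply: contra hX; exact: (subsetP sx).
  - move=> T sT rT; have /subsetP sTX : T \subset X.
      by apply: H2 rT; apply: (subset_trans sT); rewrite !setUS.
    apply/subsetP => y yT; have := subsetP sT y yT; rewrite !inE sTX // andbT.
    by case/or3P => [/eqP E|/eqP E|//]; [have := sTX y yT; rewrite E (negPf gX)|have := sTX y yT; rewrite E (negPf hX)].
  - by move=> T sT; apply: H3; exact: subset_trans sT sx.
  - by exists T1, T2.
rewrite negb_exists => /forallP nx.
have mX x : x \in X -> ~ rels2 w (X :\ x).
  move=> xX [T1 [T2 [[s1 s2 r1 r2] [n1 n2 n12]]]]; have := nx x; rewrite xX /= => /negP; apply.
  by apply/existsP; exists T1; apply/existsP; exists T2; rewrite s1 s2 r1 r2 n1 n2 n12.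
case: R2 => T1 [T2 [[s1 s2 r1 r2] [n1 n2 n12]]].
have [XE RX] := rels2_minimal mX s1 s2 r1 r2 n1 n2 n12.
have r12 := rel0D r1 r2.
have s12 : symd T1 T2 \subset X by exact: symd_sub.
have n3 : symd T1 T2 != set0 by rewrite symd_eq0.
have ge4 (T : {set V}) : T \subset X -> rel0 w T -> T != set0 -> 3 < #|T|.
  move=> sT rT; rewrite -card_gt0; have := H3 T sT rT; have := odd_rel rT.
  by case: #|T| => [|[|[|[|k]]]].
have [X7|X6] := ltnP 6 #|X|.
  (* contracting a pair that lies in no 4-element relation keeps the other points distinct *)
  have [p [q [pX qX npq npqT]]] := two_subsets T1 T2 (symd T1 T2) X7.
  have [f kf] := quot_ex <[edge_vec w (p, q)]>%VS.
  have relf (T : {set V}) : rel0 (f \o w) T = rel0 w T || rel0 w (symd T [set p; q]).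
    rewrite /rel0 odd_symd cards2 npq addbF -andb_orr; congr (_ && _).
    rewrite /nul -sumv_lin -memv_ker kf span1_F2 sumvD addr_eq0_F2; congr (_ || (_ == _)).
    by rewrite /edge_vec /sumv big_setU1 ?inE // big_set1.
  have spq : [set p; q] \subset X by rewrite subUset !sub1set pX qX.
  apply: (edges_H12_contract kf); apply: (IH _ _ (X :\ q)).
  - by move: leX; rewrite (cardsD1 q) qX add1n ltnS.
  - by rewrite !inE negb_and (negPf gX) orbT.
  - by rewrite !inE negb_and (negPf hX) orbT.
  - move=> T sT; have sT' : T \subset g |: (h |: X).
      by apply: (subset_trans sT); rewrite !setUS // subsetDl.
    have nqT : q \notin T.
      apply/negP => /(subsetP sT); rewrite !inE eqxx /= orbF => /orP [] /eqP E.
        by rewrite -E qX in gX.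
      by rewrite -E qX in hX.
    have sTX : T \subset X -> T \subset X :\ q.
      by move=> /subsetP sX; apply/subsetP => y yT; rewrite !inE sX // andbT; apply: contraNneq nqT => <-.
    rewrite relf => /orP [rT|rT]; apply: sTX; first exact: H2.
    rewrite -[T](symdK [set p; q]); apply: symd_sub => //; rewrite symdC; apply: H2 => //.
    by apply: symd_sub => //; apply: (subset_trans spq); rewrite setUA subsetUr.
  - move=> T; rewrite subsetD1 => /andP [sT qT].
    rewrite relf => /orP [rT|rT]; first exact: H3.
    (* If the pair T becomes a relation, [symd T [set p; q]] was one before: either of size two, or
       of size four and through both [p] and [q]. Both are excluded. *)
    have sT' := symd_sub sT spq; apply/eqP => T2'.
    have c := card_symd T [set p; q]; rewrite T2' cards2 npq in c.
    have cI : #|T :&: [set p; q]| = (p \in T).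
      case: (boolP (p \in T)) => pT; last first.
        apply/eqP; rewrite cards_eq0; apply/eqP/setP => y; rewrite !inE.
        by apply/negP => /andP [yT /orP [] /eqP E]; [rewrite -E yT in pT|rewrite -E yT in qT].
      rewrite (_ : _ :&: _ = [set p]) ?cards1 //; apply/setP => y; rewrite !inE.
      by case: (eqVneq y p) => [->|_]; [rewrite pT|case: (eqVneq y q) => [->|_]; rewrite ?andbF // (negPf qT)].
    have := H3 _ sT' rT; rewrite cI in c.
    have [pT|pT] := boolP (p \in T); first by move/eqP: c; rewrite pT mul1n eqn_add2r => ->.
    have c4 : #|symd T [set p; q]| = 4 by rewrite -[LHS]addn0 -[4]/(2 + 2) -c (negPf pT).
    have : symd T [set p; q] \in [:: T1; T2; symd T1 T2].
      have := RX _ sT' rT; rewrite -[_ == set0]cards_eq0 c4 /= !inE => /or3P [] ->; rewrite ?orbT //.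
    move=> /npqT /(_ c4); rewrite !in_symd !inE !eqxx orbT (negPf pT) (negPf qT).
    by [].
  (* After the contraction [q] coincides with [p], so every relation can be rewritten without [q].
     Two of them become equal only if their sum is the pair [p], [q]. *)
  - pose cq T := if q \in T then symd T [set p; q] else T.
    have cqP T : T \subset X -> rel0 w T -> cq T \subset X :\ q /\ rel0 (f \o w) (cq T).
      move=> sT rT; rewrite /cq; case: ifP => qT; split.
      + by rewrite subsetD1 symd_sub //= in_symd qT !inE eqxx orbT.
      + by rewrite relf -symdA symdd symd0 rT orbT.
      + by rewrite subsetD1 sT qT.
      + by rewrite relf rT.
    have cq0 T : T \subset X -> rel0 w T -> T != set0 -> cq T != set0.
      move=> sT rT t0; rewrite /cq; case: ifP => // _; rewrite symd_eq0.
      by apply: contra (H3 T sT rT) => /eqP ->; rewrite cards2 npq.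
    have [a1 b1] := cqP _ s1 r1; have [a2 b2] := cqP _ s2 r2.
    exists (cq T1), (cq T2); split; split=> //; [exact: cq0|exact: cq0|].
    have npq12 : symd T1 T2 != [set p; q].
      by apply: contra (H3 _ s12 r12) => /eqP ->; rewrite cards2 npq.
    rewrite /cq; case: ifP => _; case: ifP => _ //; rewrite -symd_eq0.
    + by rewrite (symdC T2) symdA -(symdA T1) symdd symd0 symd_eq0.
    + by rewrite symdC symdA symd_eq0 symdC.
    + by rewrite symdA symd_eq0.
(* T1, T2 and their symmetric difference have size 4, their union has size 6 *)
have c1 := ge4 _ s1 r1 n1; have c2 := ge4 _ s2 r2 n2; have c3 := ge4 _ s12 r12 n3.
have c12 := card_symd T1 T2; have cU := cardsUI T1 T2; rewrite -XE in cU.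
have cA := cardsID T2 T1; have cB := cardsID T1 T2; rewrite setIC in cB.
have [/eqP/cards2P [a [b [nab EA]]] /eqP/cards2P [e [i [nei EE]]] /eqP/cards2P [c [d [ncd EC]]]] :=
  sizes222 c1 c2 c3 c12 cU X6 cA cB.
(* The order follows [beta]: [T1] is 0123 and [T2] is 2345. *)
pose s := [:: a; b; c; d; e; i; g; h].
have cl x : [/\ (x \in T1 :\: T2) = (x == a) || (x == b), (x \in T1 :&: T2) = (x == c) || (x == d)
    & (x \in T2 :\: T1) = (x == e) || (x == i)] by rewrite EA EC EE !inE.
have cla x : x \in T1 :\: T2 -> ((x \in T1) = true) * ((x \in T2) = false).
  by rewrite inE => /andP [/negPf -> ->].
have clc x : x \in T1 :&: T2 -> ((x \in T1) = true) * ((x \in T2) = true).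
  by rewrite inE => /andP [-> ->].
have cle x : x \in T2 :\: T1 -> ((x \in T1) = false) * ((x \in T2) = true).
  by rewrite inE => /andP [/negPf -> ->].
have clX x : x \notin X -> ((x \in T1) = false) * ((x \in T2) = false).
  by rewrite XE inE negb_or => /andP [/negPf -> /negPf ->].
have ma : a \in T1 :\: T2 by rewrite EA !inE eqxx.
have mb : b \in T1 :\: T2 by rewrite EA !inE eqxx orbT.
have mc : c \in T1 :&: T2 by rewrite EC !inE eqxx.
have md : d \in T1 :&: T2 by rewrite EC !inE eqxx orbT.
have me : e \in T2 :\: T1 by rewrite EE !inE eqxx.
have mi : i \in T2 :\: T1 by rewrite EE !inE eqxx orbT.
pose clE := (cla _ ma, cla _ mb, clc _ mc, clc _ md, cle _ me, cle _ mi, clX _ gX, clX _ hX).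
have ne x y : (x \in T1, x \in T2) != (y \in T1, y \in T2) -> (x == y) = false.
  by move=> h1; apply/negbTE; apply: contraNneq h1 => ->.
have Us : uniq s.
  rewrite /= !inE (negPf nab) (negPf ncd) (negPf nei) (negPf gh).
  by do !(rewrite ne; last by rewrite !clE).
have sX x : x \in X -> x \in s.
  rewrite XE => xX; have [] := cl x; move: xX; rewrite !inE.
  by case: (x \in T1); case: (x \in T2) => //= _; do 6!case: (_ == _).
pose vx (x : 'I_8) := nth a s x.
have vxI : injective vx by move=> x y /eqP; rewrite nth_uniq // => /eqP /val_inj.
apply: (@edges_H12_base _ _ _ vx) => T oT; set t := fun k => _.
have tE k : k < 8 -> t k = (nth a s k \in vx @: T).
  by move=> k8; rewrite -[k in nth a s k](@inordK 7 k) // (mem_imset _ _ vxI).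
have eqT (S : {set V}) : S \subset X ->
    (vx @: T == S) = all (fun k => t k == (nth a s k \in S)) (iota 0 8).
  move=> /subsetP sS; apply/eqP/allP => [<- k|H].
    by rewrite mem_iota => /tE ->.
  apply/setP => x; have [xs|xs] := boolP (x \in s).
    have i8 : index x s < 8 by rewrite -index_mem in xs.
    have := H (index x s); rewrite mem_iota => /(_ i8) /eqP; rewrite tE //.
    by rewrite nth_index.
  have [/sS/sX xS|_] := boolP (x \in S); first by rewrite xS in xs.
  by apply/imsetP => [[k _ E]]; rewrite E mem_nth in xs.
have -> : nul (w \o vx) T = [|| vx @: T == set0, vx @: T == T1, vx @: T == T2 | vx @: T == symd T1 T2].
  have rT : nul (w \o vx) T = rel0 w (vx @: T).
    by rewrite /rel0 card_imset // oT /nul sumv_inj.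
  rewrite rT; apply/idP/idP => [rT'|/or4P [] /eqP -> //]; last by rewrite /rel0 cards0 nul0.
  apply: (RX _ _ rT'); apply: (H2 _ _ rT').
  apply/subsetP => _ /imsetP [k _ ->].
  have : vx k \in s by rewrite mem_nth.
  rewrite !inE XE !inE => /or4P [||| /or4P [||| /orP []]] /eqP ->; rewrite ?clE ?eqxx ?orbT //.
rewrite !eqT ?sub0set // /= !inE !clE /good8.
by case: (t 0); case: (t 1); case: (t 2); case: (t 3); case: (t 4); case: (t 5); case: (t 6); case: (t 7).
Qed.

End TwoRelations.

Lemma sumv0 (E : finType) (vT : vectType 'F_2) (a : E -> vT) : sumv a set0 = 0%R.
Proof. by rewrite /sumv big_set0. Qed.

Lemma sumv_option (T : finType) (vT : vectType 'F_2) (a : option T -> vT) (S : {set option T}) :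
  a None = 0%R -> sumv a S = sumv (a \o Some) [set x | Some x \in S].
Proof.
move=> a0; rewrite [RHS]sumv_inj; last by move=> ? ? [].
rewrite /sumv [LHS]big_mkcond [RHS]big_mkcond; apply: eq_bigr => -[x|] _.
  by rewrite mem_imset ?inE // => ? ? [].
by rewrite a0; case: ifP; case: ifP.
Qed.

Lemma sumv_sum (T1 T2 : finType) (vT : vectType 'F_2) (a : T1 + T2 -> vT) (S : {set T1 + T2}) :
  sumv a S = (sumv (a \o inl) [set x | inl x \in S] + sumv (a \o inr) [set x | inr x \in S])%R.
Proof.
have il : injective (@inl T1 T2) by move=> ? ? [].
have ir : injective (@inr T1 T2) by move=> ? ? [].
rewrite (sumv_inj a _ il) (sumv_inj a _ ir) -sumvD; congr (sumv a _); apply/setP => x; rewrite in_symd.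
case: x => x; first by rewrite mem_imset // inE (_ : _ \in inr @: _ = false) ?addbF //; apply/imsetP => [[]].
by rewrite addbC mem_imset // inE (_ : _ \in inl @: _ = false) ?addbF //; apply/imsetP => [[]].
Qed.

(** * Affine relations between the points of a template *)

Section Points.
Variables (Psi : template) (R : finType) (D : R -> {ffun tcols (tY0 Psi) (tY1 Psi) (tC Psi) -> 'F_2}).

Definition tcol (d : tcols (tY0 Psi) (tY1 Psi) (tC Psi)) : {ffun brows Psi R -> ('F_2)^o} :=
  [ffun b => match b with inl x => tA1 x d | inr r => D r d end].

Definition row_vec (r : R) : {ffun brows Psi R -> ('F_2)^o} := [ffun b => ((b == inr r)%:R)%R].

Definition point (p : option (R + tY1 Psi)) : {ffun brows Psi R -> ('F_2)^o} :=
  match p with None => 0%R | Some (inl r) => row_vec r | Some (inr j) => tcol (inl (inr j)) end.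

(** The columns of Y1 are left out because they are deleted in every member of the class. *)
Definition contracted (Y : {set tY0 Psi}) : {set tcols (tY0 Psi) (tY1 Psi) (tC Psi)} :=
  [set d | match d with inl (inl y) => y \in Y | inl (inr _) => false | inr _ => true end].

Definition relm (Y : {set tY0 Psi}) (T : {set option (R + tY1 Psi)}) : bool :=
  ~~ odd #|T| && (sumv point T \in <<[seq tcol d | d in contracted Y]>>%VS).

Lemma point_sum (T : {set option (R + tY1 Psi)}) :
  sumv point T = (sumv row_vec [set r | Some (inl r) \in T] + sumv (fun j => tcol (inl (inr j))) [set j | Some (inr j) \in T])%R.
Proof.
rewrite sumv_option // sumv_sum; congr (_ + _)%R; congr (sumv _ _);
by apply/setP => x; rewrite !inE.
Qed.

Lemma sum_row_vec (S : {set R}) r : sumv row_vec S (inr r) = ((r \in S)%:R)%R.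
Proof.
rewrite sumv_ffun; have [rS|rS] := boolP (r \in S).
  rewrite (bigD1 r) //= ffunE eqxx big1 ?addr0 // => x /andP [_ nx].
  by rewrite ffunE -[inr r == inr x]/(r == x) eq_sym (negPf nx).
rewrite big1 // => x xS; rewrite ffunE -[inr r == inr x]/(r == x).
by case: eqP => // E; rewrite E xS in rS.
Qed.

Lemma sum_row_vecX (S : {set R}) x : sumv row_vec S (inl x) = 0%R.
Proof. by rewrite sumv_ffun big1 // => y _; rewrite ffunE. Qed.

Hypothesis D_Delta : forall r, D r \in tDelta Psi.

(* Contracting the element e_(zr j) + y_j of Z turns the new row zr j into the point y_j; the two rows
   inr (inr b) are free vertices. *)
Let R' : finType := (R + (tY1 Psi + bool))%type.
Let D' (r : R') := if r is inl r' then D r' else 0%R.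
Let zr (j : tY1 Psi) : R' := inr (inl j).
Let FF : finType := (option R' * option R')%type.
Let mx := @member_mx Psi R' (tY1 Psi) FF D' zr id fst snd (fun _ => 0%R).
Let N := @member_of Psi R' (tY1 Psi) FF D' zr id fst snd (fun _ => 0%R).
Let col := column mx.

Let Nconf : conforms Psi N.
Proof.
have D0 := (tDelta_subgroup Psi).1; have L0 := (tLambda_subgroup Psi).1.
by apply: member_conforms => [[r|r]|] /=.
Qed.

Let ev (p : option R') : {ffun brows Psi R' -> ('F_2)^o} :=
  [ffun b => match b with inl _ => 0%R | inr r => vtx p r end].

Let K0 (Y : {set tY0 Psi}) : {set ecols Psi (tY1 Psi + FF)%type} :=
  [set e | match e with inl d => d \in contracted Y | inr (inl _) => true | inr (inr _) => false end].

Let ev_sum (T : {set option R'}) r : sumv ev T (inr r) = ((Some r \in T)%:R)%R.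
Proof.
rewrite sumv_option; last by apply/ffunP => -[x|r']; rewrite !ffunE.
rewrite sumv_ffun; have [rS|rS] := boolP (Some r \in T).
  rewrite (bigD1 r) ?inE //= ffunE vtx_Some eqxx big1 ?addr0 // => x /andP [_ nx].
  by rewrite ffunE vtx_Some (negPf nx).
rewrite big1 // => x; rewrite inE => xS; rewrite ffunE vtx_Some.
by case: eqP => // E; rewrite -E xS in rS.
Qed.

Let ev_sumX (T : {set option R'}) x : sumv ev T (inl x) = 0%R.
Proof. by rewrite sumv_ffun big1 // => y _; rewrite ffunE. Qed.

Let emb (p : option (R + tY1 Psi)) : option R' :=
  match p with None => None | Some (inl r) => Some (inl r) | Some (inr j) => Some (inr (inl j)) end.

Let embI : injective emb.
Proof. by move=> [[r|j]|] [[r'|j']|] //= [->]. Qed.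

Let mkA (B : {set tcols (tY0 Psi) (tY1 Psi) (tC Psi)}) (J : {set tY1 Psi}) :
    {set ecols Psi (tY1 Psi + FF)%type} :=
  [set e | match e with inl d => d \in B | inr (inl j) => j \in J | inr (inr _) => false end].

Let mkA_sub Y B J : (mkA B J \subset K0 Y) = (B \subset contracted Y).
Proof.
apply/subsetP/subsetP => H x; last by case: x => [d|[j|f]]; rewrite !inE // => /H; rewrite inE.
by have := H (inl x); rewrite !inE.
Qed.

Let mkA_ex Y (A : {set ecols Psi (tY1 Psi + FF)%type}) : A \subset K0 Y -> exists B J, A = mkA B J.
Proof.
move=> /subsetP sA; exists [set d | inl d \in A], [set j | inr (inl j) \in A].
apply/setP => -[d|[j|f]]; rewrite !inE //.
by apply/negP => /sA; rewrite inE.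
Qed.

Let colE B J : sumv col (mkA B J) = (sumv (col \o inl) B + sumv (col \o (inr \o inl)) J)%R.
Proof.
rewrite sumv_sum; congr (_ + _)%R; first by congr (sumv _ _); apply/setP => x; rewrite !inE.
rewrite sumv_sum [X in (_ + sumv _ X)%R](_ : _ = set0).
  by rewrite sumv0 addr0; congr (sumv _ _); apply/setP => x; rewrite !inE.
by apply/setP => x; rewrite !inE.
Qed.

Let colX B J b : sumv col (mkA B J) (match b with inl x => inl x | inr r => inr (inl r) end) =
  (sumv tcol B + sumv (fun j => tcol (inl (inr j))) J)%R b.
Proof.
rewrite colE !ffunE !sumv_ffun; congr (_ + _)%R; apply: eq_bigr => d _;
by case: b => [x|r]; rewrite /= !ffunE /= ?add0r.
Qed.

Let colJ B J j : sumv col (mkA B J) (inr (inr (inl j))) = ((j \in J)%:R)%R.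
Proof.
rewrite colE ffunE !sumv_ffun [X in (X + _)%R]big1 ?add0r; last first.
  by move=> d _; rewrite /= ffunE /= ffunE.
have cj x : (col \o (inr \o inl)) x (inr (inr (inl j))) = ((j == x)%:R)%R.
  by rewrite /= ffunE /= ffunE addr0.
have [rS|rS] := boolP (j \in _).
  rewrite (bigD1 j) //= cj eqxx big1 ?addr0 // => x /andP [_ nx].
  by rewrite cj eq_sym (negPf nx).
rewrite big1 // => x xS; rewrite cj.
by case: eqP => // EE; rewrite EE xS in rS.
Qed.

Let colb B J b : sumv col (mkA B J) (inr (inr (inr b))) = 0%R.
Proof.
rewrite colE ffunE !sumv_ffun !big1 ?addr0 // => d _; rewrite /= ffunE /= ffunE //.
by rewrite addr0.
Qed.

Let free_vtx Y (T : {set option R'}) b : sumv ev T \in <<[seq col e | e in K0 Y]>>%VS -> Some (inr (inr b)) \notin T.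
Proof.
move=> /mem_spanP [A /mkA_ex [B [J ->]] E].
by have := colb B J b; rewrite -E ev_sum; case: (_ \in T).
Qed.

(** In the row [zr j] the only nonzero entries belong to the vertex itself and to the j-th element
    of Z. A sum of contracted columns must therefore use exactly the elements of Z whose points
    occur in T, and these exchange the new vertices for the columns of Y1. *)
Let emb_rel Y (T : {set option (R + tY1 Psi)}) :
  (sumv ev (emb @: T) \in <<[seq col e | e in K0 Y]>>%VS) = (sumv point T \in <<[seq tcol d | d in contracted Y]>>%VS).
Proof.
have mR r : (Some (inl r) \in emb @: T) = (Some (inl r) \in T).
  by rewrite -(mem_imset T (Some (inl r)) embI).
have mJ j : (Some (inr (inl j)) \in emb @: T) = (Some (inr j) \in T).
  by rewrite -(mem_imset T (Some (inr j)) embI).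
have mb b : (Some (inr (inr b)) \in emb @: T) = false.
  by apply/imsetP => [[[[?|?]|] _]].
apply/idP/mem_spanP => [/mem_spanP [A sA E]|[B sB E]].
  have [B [J AE]] := mkA_ex sA; move: sA E; rewrite {}AE mkA_sub => sB E; exists B => //.
  have JE : [set j | Some (inr j) \in T] = J.
    apply/setP => j; have := colJ B J j; rewrite -E ev_sum mJ inE.
    by case: (_ \in T); case: (_ \in J) => // /eqP; rewrite ?oner_eq0 // eq_sym oner_eq0.
  rewrite point_sum JE; apply/eqP; rewrite -addr_eq0_F2 -addrA addr_eq0_F2 addrC; apply/eqP/ffunP => b.
  rewrite -colX -E; case: b => [x|r]; first by rewrite ev_sumX sum_row_vecX.
  by rewrite ev_sum mR sum_row_vec inE.
apply/mem_spanP; pose J := [set j | Some (inr j) \in T].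
exists (mkA B J); first by rewrite mkA_sub.
have {}E b : sumv row_vec [set r | Some (inl r) \in T] b = (sumv tcol B + sumv (fun j => tcol (inl (inr j))) J)%R b.
  by rewrite -E point_sum -addrA addrr_F2 addr0.
apply/ffunP => [[x|[r|[j|b]]]].
- by rewrite ev_sumX (colX B J (inl x)) -E sum_row_vecX.
- by rewrite ev_sum mR (colX B J (inr r)) -E sum_row_vec inE.
- by rewrite ev_sum mJ colJ inE.
- by rewrite ev_sum mb colb.
Qed.

(** All pairs of vertices, [None] included, occur among the frame columns [FF], so whatever edges
    [two_relations_H12] asks for are present. The two extra rows supply its free points. *)
Lemma template_H12_of_relations (Y : {set tY0 Psi}) (X T1 T2 : {set option (R + tY1 Psi)}) :
  (forall T : {set option (R + tY1 Psi)}, T \subset X -> relm Y T -> #|T| != 2) ->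
  T1 \subset X -> T2 \subset X -> relm Y T1 -> relm Y T2 -> T1 != set0 -> T2 != set0 -> T1 != T2 ->
  exists2 N, conforms Psi N & has_minor N H12.
Proof.
move=> X2 s1 s2 r1 r2 n1 n2 n12; exists N; first exact: Nconf.
have [f kf] := quot_ex <<[seq col e | e in K0 Y]>>%VS.
pose w := f \o ev.
have nw (T : {set option R'}) : nul w T = (sumv ev T \in <<[seq col e | e in K0 Y]>>%VS).
  by rewrite /nul -sumv_lin -memv_ker kf.
have relE (T : {set option (R + tY1 Psi)}) : rel0 w (emb @: T) = relm Y T.
  by rewrite /rel0 nw emb_rel card_imset.
pose g b : option R' := Some (inr (inr b)).
have gX b : g b \notin emb @: X by apply/imsetP => [[[[?|?]|] _]].
have subE (T : {set option R'}) : T \subset emb @: X -> exists2 T' : {set option (R + tY1 Psi)}, T' \subset X & T = emb @: T'.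
  move=> /subsetP sT; exists (emb @^-1: T).
    by apply/subsetP => x; rewrite inE => /sT; rewrite mem_imset.
  apply/setP => y; apply/idP/imsetP => [yT|[x]]; last by rewrite inE => ? ->.
  by have /imsetP [x _ E] := sT y yT; exists x; rewrite // inE -E.
have [] := @two_relations_H12 _ (g true) (g false) isT #|emb @: X| _ w (emb @: X) (leqnn _) (gX _) (gX _).
- move=> T /subsetP sT /andP [_]; rewrite nw => nT; apply/subsetP => y yT.
  have := sT y yT; rewrite !inE => /or3P [/eqP E|/eqP E|//].
    by have := free_vtx true nT; rewrite -/(g true) -E yT.
  by have := free_vtx false nT; rewrite -/(g false) -E yT.
- by move=> _ /subE [T sT ->]; rewrite relE card_imset //; exact: X2.
- exists (emb @: T1), (emb @: T2); split; split; rewrite ?relE ?imsetS //.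
  + by rewrite -card_gt0 card_imset // card_gt0.
  + by rewrite -card_gt0 card_imset // card_gt0.
  + by apply: contra n12 => /eqP/(imset_inj embI) ->.
move=> K [iota H].
pose K1 : {set ecols Psi (tY1 Psi + FF)%type} :=
  [set e | match e with inr (inr f) => f \in K | _ => false end].
apply: (@member_minor _ _ _ _ _ _ _ _ _ _ H12 _ h12 (K1 :|: K0 Y) (fun j => inr (iota j))).
- exact: H12_represents.
- exact: h12_neq0.
- exact: h12_inj.
- by apply/subsetP => _ /imsetP [c _ ->]; rewrite !inE.
- rewrite -setI_eq0; apply/eqP/setP => x; rewrite !inE; apply/negP => /andP [+ /imsetP [j _ E]].
  by rewrite E !inE.
move=> S; rewrite -H -/mx -/col -(mem_span_quot _ _ kf) sumv_lin.
have E p : col (inr (inr p)) = edge_vec ev p.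
  apply/ffunP => -[x|r]; rewrite /edge_vec !ffunE /= ?ffunE ?addr0 //.
have E' p : f (col (inr (inr p))) = edge_vec w p by rewrite E /edge_vec linearD.
have spE : <<[seq edge_vec w e | e in K]>>%VS = <<[seq (f \o col) e | e in K1]>>%VS.
  apply: eq_span => v; apply/imageP/imageP => [[p pK ->]|[[d|[j|p]]]]; rewrite ?inE //.
    by exists (inr (inr p)); rewrite ?inE //= E'.
  by move=> pK ->; exists p; rewrite //= E'.
by rewrite spE /sumv (eq_bigr (edge_vec w \o iota)) // => j _; exact: E'.
Qed.

End Points.

(** * Quotients of graphic matroids by one vector *)

Lemma sumv_neq0 (B E : finType) (a : E -> {ffun B -> ('F_2)^o}) (T : {set E}) b :
  (sumv a T b != 0%R) = odd #|T :&: [set e | a e b != 0%R]|.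
Proof.
rewrite sumv_ffun -sum1_card (big_morph odd oddD (erefl : odd 0 = false)).
rewrite (big_morph (fun x : 'F_2 => x != 0%R) F2_neq0D (_ : (0 != 0)%R = false)) ?eqxx //.
rewrite big_mkcond [RHS]big_mkcond /=; apply: eq_bigr => e _.
by rewrite !inE; case: (e \in T); case: (a e b != 0%R).
Qed.

Lemma nul_ffun (B E : finType) (a : E -> {ffun B -> ('F_2)^o}) (T : {set E}) :
  nul a T = [forall b, ~~ odd #|T :&: [set e | a e b != 0%R]|].
Proof.
apply/eqP/forallP => [n0 b|h]; first by rewrite -sumv_neq0 n0 ffunE eqxx.
by apply/ffunP => b; rewrite [RHS]ffunE; apply/eqP; rewrite -[_ == _]negbK sumv_neq0.
Qed.

Lemma nul_column (B E : finType) (A : bmatrix B E) (T : {set E}) :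
  nul (column A) T = [forall b, ~~ odd #|T :&: [set e | A b e != 0%R]|].
Proof.
rewrite nul_ffun; apply: eq_forallb => b; congr (~~ odd #|pred_of_set (_ :&: _)|).
by apply/setP => e; rewrite !inE ffunE.
Qed.

Section EvenCut.
Variables (M : matroid) (V : finType) (vT : vectType 'F_2).
Variables (a : M -> vT) (w : V -> vT) (p q : M -> V) (X kappa : {set V}).
Hypothesis ra : @represents (dual M) _ a.
Hypothesis aE : forall e, a e = edge_vec w (p e, q e).
Hypotheses (pX : forall e, p e \in X) (qX : forall e, q e \in X).
Hypothesis relX : forall T : {set V}, T \subset X -> rel0 w T -> T = set0 \/ T = kappa.

Fact edge_ends_card e : 0 < #|[set p e; q e]| <= 2.
Proof. by rewrite cards2; case: (_ != _). Qed.

Definition edge_graph : graph := Graph edge_ends_card.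

Let bd (S : {set M}) : {set V} := \big[@symd V/set0]_(e in S) symd [set p e] [set q e].

Lemma inc_edge_vec e : inc_vec (e : edge edge_graph) = edge_vec (@vertex_vec edge_graph) (p e, q e).
Proof.
rewrite /inc_vec /= cards2; case: (eqVneq (p e) (q e)) => [E|npq] /=; first by rewrite /edge_vec /= E addrr_F2.
by rewrite big_setU1 ?inE //= ?big_set1.
Qed.

Lemma nul_vertex_vec (G : graph) (T : {set vertex G}) : nul (@vertex_vec G) T = (T == set0).
Proof.
apply/eqP/eqP => [H|->]; last by rewrite sumv0.
apply/setP => x; have := congr1 (fun g : {ffun _ -> _} => g x) H.
rewrite /sumv sum_ffunE ffunE inE; have [xT|//] := boolP (x \in T).
rewrite (bigD1 x) //= ffunE eqxx big1 ?addr0; last first.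
  by move=> y /andP [_ nyx]; rewrite ffunE eq_sym (negPf nyx).
by move/eqP; rewrite oner_eq0.
Qed.

Let bdD (S S' : {set M}) : bd (symd S S') = symd (bd S) (bd S').
Proof.
rewrite /bd !(big_mkcond (fun e => e \in _)) -big_split; apply: eq_bigr => e _ /=.
by rewrite in_symd; case: (e \in S); case: (e \in S'); rewrite /= ?symd0 ?sym0d ?symdd.
Qed.

Let nul_inc (S : {set M}) : nul (@inc_vec edge_graph) S = (bd S == set0).
Proof.
rewrite -(nul_vertex_vec (bd S : {set vertex edge_graph})) /nul -edge_vec_sum; congr (_ == _).
by apply: eq_bigr => e _; exact: inc_edge_vec.
Qed.

Let nul_a (S : {set M}) : nul a S = rel0 w (bd S).
Proof.
rewrite /rel0 edge_vec_even /= /nul -edge_vec_sum; congr (_ == _).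
by apply: eq_bigr => e _; exact: aE.
Qed.

Let bdX (S : {set M}) : bd S \subset X.
Proof.
apply: (big_ind (fun T : {set V} => T \subset X)); first exact: sub0set.
  by move=> ? ?; exact: symd_sub.
by move=> e _; apply: symd_sub; rewrite sub1set.
Qed.

(** An edge set with boundary [kappa]. If there is none, the default yields a zero row, which does
    no harm. *)
Let S0 : {set M} := odflt set0 [pick S : {set M} | nul a S && (bd S == kappa)].

Let rows (b : option {S : {set M} | nul (@inc_vec edge_graph) S}) : {set M} :=
  if b is Some U then val U else S0.

Let A : bmatrix _ M := fun b e => ((e \in rows b)%:R)%R.

Let rowE b : [set e | A b e != 0%R] = rows b.
Proof.
by apply/setP => e; rewrite inE /A; case: (e \in rows b); rewrite ?eqxx ?oner_eq0.
Qed.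

Let nS0 : nul a S0.
Proof. by rewrite /S0; case: pickP => [S /andP [] //|_]; exact: nul0. Qed.

Let nul_inc_a (S : {set M}) : nul (@inc_vec edge_graph) S -> nul a S.
Proof. by rewrite nul_inc nul_a => /eqP ->; rewrite /rel0 cards0 nul0. Qed.

Let rowsP (T : {set M}) :
  nul (column A) T <-> forall S, nul a S -> ~~ odd #|T :&: S|.
Proof.
rewrite nul_column; split=> [/forallP H S nS|H]; last first.
  apply/forallP => b; rewrite rowE; apply: H; rewrite /rows.
  by case: b => [[S nS] /=|]; [exact: nul_inc_a|exact: nS0].
have H1 (S' : {set M}) : nul (@inc_vec edge_graph) S' -> ~~ odd #|T :&: S'|.
  by move=> nS'; have := H (Some (Sub S' nS')); rewrite rowE.
have := nS; rewrite nul_a => rS; have [b0|bk] := relX (bdX S) rS.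
  by apply: H1; rewrite nul_inc b0.
have [k0|k0] := eqVneq kappa set0; first by apply: H1; rewrite nul_inc bk k0.
have : bd S0 = kappa.
  by rewrite /S0; case: pickP => [S' /andP [_ /eqP] //|/(_ S)]; rewrite nS bk eqxx.
move=> bS0; have := H None; rewrite rowE /= => h0.
rewrite -(symdK S0 S) setI_symdr odd_symd (negPf h0) /=; apply: H1.
by rewrite nul_inc bdD bS0 bk symdd.
Qed.

(** The null sets of [a] are the cycles of the graph together with the edge sets of boundary
    [kappa], and these form one coset of the cycles. Taken as rows, the cycles and [S0] represent M;
    without the row [None] only the cycles remain, and they represent the dual of the cycle
    matroid. *)
Lemma edges_even_cut : even_cut M.
Proof.
exists _, M, A, None; split.
  exists id; first by exists id.
  move=> S; rewrite imset_id -dual_dual_rk.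
  exact: (represents_dual ra rowsP).
exists edge_graph; exists id; first by exists id.
move=> S; rewrite imset_id; symmetry.
apply: (represents_dual (@cycle_represents edge_graph)) => T.
rewrite nul_column; split=> [/forallP H S' nS'|H].
  by have := H (Sub (Some (Sub S' nS')) isT); rewrite /delete_row (rowE (Some _)).
apply/forallP => -[[[S' nS']|//] nb].
by rewrite /delete_row /= (rowE (Some _)); exact: H.
Qed.

End EvenCut.

Lemma two_set (V : finType) (A : {set V}) x y : #|A| = 2 -> x \in A -> y \in A -> x != y -> A = [set x; y].
Proof.
move=> A2 xA yA nxy; apply/esym/eqP; rewrite eqEcard A2 cards2 nxy leqnn andbT.
by rewrite subUset !sub1set xA yA.
Qed.

(** Edges that meet pairwise in one vertex form a star or a triangle, and the last hypothesis
    forbids a triangle. If neither end of [E i0] were common, an edge missing [v] and an edge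
    missing [x] would meet in a third vertex and close a triangle. *)
Lemma star_or_triangle (V I : finType) (P : pred I) (E : I -> {set V}) i0 : P i0 ->
  (forall i, P i -> #|E i| = 2) ->
  (forall i j, P i -> P j -> i != j -> #|symd (E i) (E j)| = 2) ->
  (forall i j k, P i -> P j -> P k -> i != j -> j != k -> i != k ->
     symd (E i) (symd (E j) (E k)) != set0) ->
  exists2 v, v \in E i0 & forall i, P i -> v \in E i.
Proof.
move=> P0 E2 Ed Et.
have /eqP/cards2P [v [x [nvx E0]]] := E2 _ P0.
have [/forallP Hv|] := boolP [forall i, P i ==> (v \in E i)].
  by exists v; [rewrite E0 !inE eqxx|move=> i Pi; have := Hv i; rewrite Pi].
rewrite negb_forall => /existsP [i]; rewrite negb_imply => /andP [Pi vi].
have [/forallP Hx|] := boolP [forall i, P i ==> (x \in E i)].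
  by exists x; [rewrite E0 !inE eqxx orbT|move=> j Pj; have := Hx j; rewrite Pj].
rewrite negb_forall => /existsP [j]; rewrite negb_imply => /andP [Pj xj].
have n0i : i0 != i by apply: contraNneq vi => <-; rewrite E0 !inE eqxx.
have n0j : i0 != j by apply: contraNneq xj => <-; rewrite E0 !inE eqxx orbT.
have I1 (k l : I) : P k -> P l -> k != l -> #|E k :&: E l| = 1.
  move=> Pk Pl nkl; have := card_symd (E k) (E l); rewrite Ed // !E2 //; lia.
have xi : x \in E i.
  have /eqP/cards1P [y Ey] := I1 _ _ P0 Pi n0i.
  have : y \in E i0 :&: E i by rewrite Ey inE.
  by rewrite E0 !inE => /andP [/orP [] /eqP ->] //; rewrite (negPf vi).
have vj : v \in E j.
  have /eqP/cards1P [y Ey] := I1 _ _ P0 Pj n0j.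
  have : y \in E i0 :&: E j by rewrite Ey inE.
  by rewrite E0 !inE => /andP [/orP [] /eqP ->] //; rewrite (negPf xj).
have nij : i != j by apply: contraNneq xj => <-.
have /eqP/cards1P [y Ey] := I1 _ _ Pi Pj nij.
have /setIP [yi yj] : y \in E i :&: E j by rewrite Ey inE.
have nxy : x != y by apply: contraNneq xj => ->.
have nvy : v != y by apply: contraNneq vi => ->.
have /eqP [] := Et _ _ _ P0 Pi Pj n0i nij n0j.
rewrite E0 (two_set (E2 _ Pi) xi yi nxy) (two_set (E2 _ Pj) vj yj nvy).
apply/setP => z; rewrite !in_symd !inE.
case: (eqVneq z v) => [->|_]; first by rewrite (negPf nvx) (negPf nvy).
case: (eqVneq z x) => [->|_]; first by rewrite (negPf nxy).
by case: (z == y).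
Qed.

(** * Turning the elements of [Y0] into edges *)

Section Finish.
Variables (M : matroid) (V : finType) (vT : vectType 'F_2).
Variables (a : M -> vT) (w : V -> vT) (SY : {set M}).
Hypothesis ra : @represents (dual M) _ a.
Hypothesis aE : forall e, e \notin SY -> exists p q, a e = edge_vec w (p, q).
Hypothesis SY_indep : forall T : {set M}, T \subset SY -> nul a T -> T = set0.
Hypothesis SY_coindep : forall e, e \in SY -> a e \in <<[seq a x | x in ~: SY]>>%VS.

Let relY (Y : {set M}) (T : {set V}) : bool := ~~ odd #|T| && (sumv w T \in <<[seq a e | e in Y]>>%VS).

Hypothesis few_relations : forall (Y : {set M}) (X T1 T2 : {set V}), Y \subset SY ->
  (forall T : {set V}, T \subset X -> relY Y T -> #|T| != 2) ->
  T1 \subset X -> T2 \subset X -> relY Y T1 -> relY Y T2 -> T1 != set0 -> T2 != set0 -> T1 == T2.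

(** Several vertices may carry the same vector; one is kept for each vector, which excludes
    relations of size two. *)
Let rep (x : V) : V := odflt x [pick y | w y == w x].

Let wrep x : w (rep x) = w x.
Proof. by rewrite /rep; case: pickP => [y /eqP|]. Qed.

Let rep_eq x y : w x = w y -> rep x = rep y.
Proof.
move=> E; rewrite /rep (eq_pick (Q := fun z => w z == w y)); last by move=> z; rewrite E.
by case: pickP => // /(_ y); rewrite eqxx.
Qed.

Let X0 : {set V} := [set rep x | x : V].

Let repX x : rep x \in X0. Proof. exact: imset_f. Qed.

Let X0I x y : x \in X0 -> y \in X0 -> w x = w y -> x = y.
Proof. by move=> /imsetP [x' _ ->] /imsetP [y' _ ->]; rewrite !wrep => /rep_eq. Qed.

Let is_edge e := [exists p in X0, exists q in X0, a e == edge_vec w (p, q)].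

(** An element of [SY] lies in the span of the other elements by coindependence. Those are edge
    vectors, and a sum of edge vectors is a sum over an even set of points. *)
Let tau_ex e : exists T : {set V}, [&& T \subset X0, ~~ odd #|T| & a e == sumv w T].
Proof.
suff main (S : {set M}) : S \subset ~: SY -> exists T : {set V}, [&& T \subset X0, ~~ odd #|T| & sumv a S == sumv w T].
  have [eS|eS] := boolP (e \in SY); last first.
    by have := main [set e]; rewrite sumv1 => H; apply: H; rewrite sub1set inE.
  by have /mem_spanP [S sS ->] := SY_coindep eS; exact: main.
elim: {S}_.+1 {-2}S (ltnSn #|S|) => // n IH S leS sS.
have [->|[x xS]] := set_0Vmem S; first by exists set0; rewrite sub0set cards0 !sumv0 eqxx.
have [|T /and3P [sT oT /eqP ET]] := IH (S :\ x) _ (subset_trans (subsetDl _ _) sS).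
  by move: leS; rewrite (cardsD1 x) xS add1n ltnS.
have [|p [q pqE]] := @aE x; first by have := subsetP sS x xS; rewrite inE.
exists (symd (symd [set rep p] [set rep q]) T).
rewrite !symd_sub ?sub1set //= !odd_symd !cards1 /= oT !sumvD -ET !sumv1 !wrep.
rewrite -[(w p + w q)%R]/(edge_vec w (p, q)) -pqE -(sumv1 a x) -sumvD; apply/eqP; congr (sumv a _).
by apply/setP => y; rewrite in_symd !inE; case: eqP => // ->; rewrite xS.
Qed.

Let tau e : {set V} := xchoose (tau_ex e).
Let tauX e : tau e \subset X0. Proof. by have /and3P [] := xchooseP (tau_ex e). Qed.
Let tau_odd e : odd #|tau e| = false. Proof. by have /and3P [_ /negPf] := xchooseP (tau_ex e). Qed.
Let tauE e : a e = sumv w (tau e). Proof. by have /and3P [_ _ /eqP] := xchooseP (tau_ex e). Qed.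

Let nonedge_SY e : ~~ is_edge e -> e \in SY.
Proof.
apply: contraNT => /aE [p [q E]]; apply/existsP; exists (rep p); rewrite repX /=.
by apply/existsP; exists (rep q); rewrite repX E /edge_vec /= !wrep eqxx.
Qed.

Let a0 e : e \in SY -> a e != 0%R.
Proof.
move=> eS; apply/negP; rewrite -nul1 => n0; have /setP/(_ e) : [set e] = set0.
  by apply: SY_indep; rewrite ?sub1set.
by rewrite !inE eqxx.
Qed.

Let sumv2 x y : x != y -> sumv w [set x; y] = edge_vec w (x, y).
Proof. by move=> nxy; rewrite /sumv big_setU1 ?inE // big_set1. Qed.

Let suma2 x y : x != y -> sumv a [set x; y] = sumv w (symd (tau x) (tau y)).
Proof. by move=> nxy; rewrite /sumv big_setU1 ?inE // big_set1 sumv_symd !tauE. Qed.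

Let rel_edge p q : p \in X0 -> q \in X0 -> p != q -> edge_vec w (p, q) != 0%R.
Proof.
by move=> pX qX; apply: contra; rewrite /edge_vec addr_eq0_F2 => /eqP /(X0I pX qX) ->.
Qed.

(** This supplies the distinctness hypothesis of [few_relations]: a pair related modulo [Y] is an
    edge vector equal to a sum over a subset of [Y], and subsets of size zero, one and more are
    excluded in turn. *)
Let no_rel2 (Y : {set M}) : (forall e, e \in Y -> ~~ is_edge e) ->
  (forall T : {set M}, T \subset Y -> 1 < #|T| -> forall p q, p \in X0 -> q \in X0 -> sumv a T != edge_vec w (p, q)) ->
  forall T : {set V}, T \subset X0 -> relY Y T -> #|T| != 2.
Proof.
move=> HY H T sT /andP [_ /mem_spanP [U sU E]]; apply/negP => /cards2P [p [q [npq ET]]].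
have pX : p \in X0 by apply: (subsetP sT); rewrite ET !inE eqxx.
have qX : q \in X0 by apply: (subsetP sT); rewrite ET !inE eqxx orbT.
rewrite ET sumv2 // in E.
have [U2|] := ltnP 1 #|U|; first by have := H U sU U2 p q pX qX; rewrite -E eqxx.
case: (set_0Vmem U) => [U0 _|[e eU] le1].
  by have := rel_edge pX qX npq; rewrite E U0 sumv0 eqxx.
have UE : U = [set e].
  by apply/esym/eqP; rewrite eqEcard sub1set eU cards1.
case/negP: (HY e (subsetP sU e eU)).
by apply/existsP; exists p; rewrite pX; apply/existsP; exists q; rewrite qX E UE sumv1 eqxx.
Qed.

Lemma all_edges_even_cut kappa : (forall e, is_edge e) ->
  (forall T : {set V}, T \subset X0 -> rel0 w T -> T = set0 \/ T = kappa) -> even_cut M.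
Proof.
move=> H Hk.
have H1 e : exists pq : V * V, [&& pq.1 \in X0, pq.2 \in X0 & a e == edge_vec w pq].
  by have /existsP [p /andP [pX /existsP [q /andP [qX E]]]] := H e; exists (p, q); rewrite pX qX.
pose f e := xchoose (H1 e).
apply: (@edges_even_cut M V vT a w (fun e => (f e).1) (fun e => (f e).2) X0 kappa) => //.
- by move=> e; have /and3P [_ _ /eqP] := xchooseP (H1 e); rewrite -/(f e); case: (f e).
- by move=> e; have /and3P [] := xchooseP (H1 e).
- by move=> e; have /and3P [] := xchooseP (H1 e).
Qed.

Lemma quotient_graph_even_cut : even_cut M.
Proof.
have relY0 (T : {set V}) : relY set0 T = rel0 w T.
  by rewrite /relY /image_mem enum_set0 span_nil memv0.
have tau_rel (Y : {set M}) e : e \in Y -> relY Y (tau e).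
  by move=> eY; rewrite /relY tau_odd -tauE; apply: memv_span; apply: image_f.
have tau0 e : e \in SY -> tau e != set0.
  by move=> eS; apply: contra (a0 eS) => /eqP E; rewrite tauE E sumv0.
have no_rel0 : forall T : {set V}, T \subset X0 -> relY set0 T -> #|T| != 2.
  apply: no_rel2 => [e|T]; first by rewrite inE.
  by rewrite subset0 => /eqP ->; rewrite cards0.
have [/existsP [kappa /and3P [sk rk k0]]|] :=
    boolP [exists T : {set V}, [&& T \subset X0, rel0 w T & T != set0]].
  apply: (@all_edges_even_cut kappa) => [e|T sT rT]; last first.
    have [->|T0] := eqVneq T set0; [by left|right; apply/eqP].
    by apply: (few_relations (sub0set _) no_rel0); rewrite ?relY0.
  (* For a non-edge [e] both [kappa] and [tau e] are relations modulo [e], hence equal. Then [a e]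
     is zero, against the independence of [SY]. *)
  have [//|ne] := boolP (is_edge e); exfalso; have eS := nonedge_SY ne.
  have : kappa == tau e.
    apply: (@few_relations [set e] X0) => //; rewrite ?sub1set //.
    - apply: no_rel2 => [e'|T]; first by rewrite inE => /eqP ->.
      by move=> /subset_leq_card; rewrite cards1 leqNgt => /negPf ->.
    - by case/andP: rk => o /eqP s0; rewrite /relY o s0 mem0v.
    - by apply: tau_rel; rewrite inE.
    - exact: tau0.
  move=> /eqP kt; case/andP: rk => _; rewrite /nul kt -tauE.
  by rewrite (negPf (a0 eS)).
rewrite negb_exists => /forallP nr.
have rel_eq0 (T : {set V}) : T \subset X0 -> rel0 w T -> T = set0.
  by move=> sT rT; have := nr T; rewrite sT rT /= negbK => /eqP.
have [/forallP|] := boolP [forall e, is_edge e].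
  by move=> H; apply: (@all_edges_even_cut set0) => // T sT rT; left; exact: rel_eq0.
rewrite negb_forall => /existsP [y1 n1].
have S1 := nonedge_SY n1.
(* Both [tau x] and [tau y] are relations modulo {x, y}. Were their sum not a pair, no relation of
   size two would exist and [few_relations] would make them equal, so that [a x = a y]. *)
have tau2 x y : ~~ is_edge x -> ~~ is_edge y -> x != y -> #|symd (tau x) (tau y)| = 2.
  move=> nx ny nxy; apply/eqP/negPn/negP => n2.
  have Sx := nonedge_SY nx; have Sy := nonedge_SY ny.
  have : tau x == tau y.
    apply: (@few_relations [set x; y] X0) => //; last 4 first.
    - by apply: tau_rel; rewrite !inE eqxx.
    - by apply: tau_rel; rewrite !inE eqxx orbT.
    - exact: tau0.
    - exact: tau0.
    - by rewrite subUset !sub1set Sx Sy.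
    apply: no_rel2 => [e|T sT T2 p q pX qX]; first by rewrite !inE => /orP [] /eqP ->.
    have -> : T = [set x; y] by apply/eqP; rewrite eqEcard sT cards2 nxy.
    apply: contra n2 => /eqP; rewrite suma2 // => E.
    have npq : p != q.
      apply/negP => /eqP pq.
      have := SY_indep (T := [set x; y]); rewrite subUset !sub1set Sx Sy => /(_ isT).
      rewrite /nul suma2 // E pq /edge_vec /= addrr_F2 eqxx.
      by move=> /(_ isT) /setP /(_ x); rewrite !inE eqxx.
    have : symd (symd (tau x) (tau y)) [set p; q] = set0.
      apply: rel_eq0; first by rewrite !symd_sub ?tauX // subUset !sub1set pX qX.
      by rewrite /rel0 !odd_symd !tau_odd cards2 npq /nul sumvD E sumv2 // addrr_F2 eqxx.
    by move/eqP; rewrite symd_eq0 => /eqP ->; rewrite cards2 npq.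
  move=> /eqP E; have := SY_indep (T := [set x; y]); rewrite subUset !sub1set Sx Sy => /(_ isT).
  rewrite /nul suma2 // E symdd sumv0 eqxx.
  by move=> /(_ isT) /setP /(_ x); rewrite !inE eqxx.
pose P y := ~~ is_edge y && (y != y1).
(* The pairs [symd (tau y1) (tau y)] meet pairwise by [tau2], and a triangle would be a null set of
   four elements of [SY]. So they share a vertex [v]; [sigma] is [tau y1] with [v] switched, and
   every [tau y] is [sigma] with one vertex switched. *)
have [sigma [ssig osig sigP]] : exists sigma : {set V}, [/\ sigma \subset X0, odd #|sigma| &
    forall y, ~~ is_edge y -> exists2 v, v \in X0 & tau y = symd sigma [set v]].
  suff [v vX vP] : exists2 v, v \in X0 & forall y, P y -> v \in symd (tau y1) (tau y).
    exists (symd (tau y1) [set v]); split.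
    - by rewrite symd_sub ?tauX // sub1set.
    - by rewrite odd_symd tau_odd cards1.
    move=> y ny; have [->|nyy] := eqVneq y y1.
      by exists v; rewrite // -symdA symdd symd0.
    have vy := vP y; rewrite /P ny nyy in vy; have {}vy := vy isT.
    have t2 : #|symd (tau y1) (tau y)| = 2 by apply: tau2; rewrite // eq_sym.
    have /cards1P [u Eu] : #|symd (tau y1) (tau y) :\ v| == 1.
      by move: t2; rewrite (cardsD1 v) vy add1n => -[->].
    exists u.
      have : u \in symd (tau y1) (tau y) :\ v by rewrite Eu inE.
      by rewrite inE => /andP [_]; apply/subsetP; rewrite symd_sub ?tauX.
    rewrite -symdA -Eu -[LHS](symdK (tau y1)); congr symd.
    apply/setP => z; rewrite [RHS]in_symd in_set1 in_setD1; case: (eqVneq z v) => [->|_] /=; rewrite ?vy ?addbF //.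
  have [/existsP [y2 P2]|] := boolP [exists y, P y]; last first.
    rewrite negb_exists => /forallP nP; have [v vt] := set0Pn _ (tau0 _ S1).
    exists v; first exact: (subsetP (tauX y1)).
    by move=> y Py; have := nP y; rewrite Py.
  have [v v2 vP] : exists2 v, v \in symd (tau y1) (tau y2) & forall i, P i -> v \in symd (tau y1) (tau i).
    apply: (star_or_triangle P2) => [i /andP [ni n1i]|i j /andP [ni _] /andP [nj _] nij|].
    - by apply: tau2 => //; rewrite eq_sym.
    - by rewrite (symdC (tau y1)) symdA -(symdA (tau i)) symdd symd0; apply: tau2.
    move=> i j k /andP [ni n1i] /andP [nj n1j] /andP [nk n1k] nij njk nik.
    apply/eqP => E0; pose T := symd (symd [set y1] [set i]) (symd [set j] [set k]).
    have sT : T \subset SY by rewrite !symd_sub // sub1set; exact: nonedge_SY.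
    have : T = set0.
      apply: SY_indep => //; rewrite /nul !sumvD !sumv1 !tauE -!sumvD.
      suff -> : symd (symd (tau y1) (tau i)) (symd (tau j) (tau k)) = set0 by rewrite sumv0.
      rewrite -E0; congr symd; rewrite (symdC (tau y1) (tau j)) -symdA (symdA (tau y1)) symdd sym0d //.
    move/setP/(_ y1); rewrite !in_symd !inE eqxx.
    by rewrite !(eq_sym y1) (negPf n1i) (negPf n1j) (negPf n1k).
  by exists v => //; apply: (subsetP _ _ v2); rewrite symd_sub ?tauX.
(* The new vertex [None] carries the vector of [sigma], so non-edges become edges at [None]. As [X0]
   has no relation, the only one now is [None] together with [sigma]. *)
pose w' (x : option V) := if x is Some v then w v else sumv w sigma.
pose X' := None |: Some @: X0.
have SomeI : injective (@Some V) by move=> ? ? [].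
have H1 e : exists pq : option V * option V, [&& pq.1 \in X', pq.2 \in X' & a e == edge_vec w' pq].
  have [/existsP [p /andP [pX /existsP [q /andP [qX E]]]]|ne] := boolP (is_edge e).
    by exists (Some p, Some q); rewrite !in_setU1 /= !mem_imset // pX qX.
  have [v vX E] := sigP e ne; exists (None, Some v); rewrite !in_setU1 eqxx /= mem_imset // vX /=.
  by rewrite tauE E sumvD sumv1.
pose f e := xchoose (H1 e).
apply: (@edges_even_cut M (option V) vT a w' (fun e => (f e).1) (fun e => (f e).2) X' (None |: Some @: sigma)) => //.
- by move=> e; have /and3P [_ _ /eqP] := xchooseP (H1 e); rewrite -/(f e); case: (f e).
- by move=> e; have /and3P [] := xchooseP (H1 e).
- by move=> e; have /and3P [] := xchooseP (H1 e).
move=> T sT /andP [oT nT].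
pose T' : {set V} := [set x | Some x \in T].
have sT' : T' \subset X0.
  by apply/subsetP => x; rewrite inE => /(subsetP sT); rewrite in_setU1 /= mem_imset.
have E : T = (if None \in T then None |: Some @: T' else Some @: T').
  by apply/setP => -[x|]; case: ifP => nT0; rewrite ?inE ?mem_imset ?inE ?nT0 //; apply/esym/imsetP => [[]].
have sE : sumv w T' = sumv w' (Some @: T') by rewrite -sumv_inj.
have cE : #|T'| = #|Some @: T'| by rewrite card_imset.
have nN : None \notin Some @: T' by apply/imsetP => [[]].
move: oT nT; rewrite E; case: ifP => _.
  rewrite cardsU1 nN -cE /= negbK => oT'.
  rewrite /nul [sumv _ _]big_setU1 //= -/(sumv _ _) -sE -sumvD => n0; right.
  have : symd sigma T' = set0.
    by apply: rel_eq0; [rewrite symd_sub|rewrite /rel0 odd_symd osig oT' /=].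
  by move/eqP; rewrite symd_eq0 => /eqP <-.
rewrite -cE /nul -sE => oT' n0; left.
by rewrite (rel_eq0 T') ?imset0 // /rel0 oT'.
Qed.

End Finish.

Lemma vtx_pair (R : finType) (phi : R -> 'F_2) : #|[set r | phi r != 0%R]| <= 2 ->
  exists p q : option R, forall r, phi r = (vtx p r + vtx q r)%R.
Proof.
set S := [set r | _] => le2.
have phiE r : phi r = ((r \in S)%:R)%R.
  by rewrite inE; case: (F2P (phi r)) => ->; rewrite ?eqxx ?oner_eq0.
move: le2; rewrite leq_eqVlt => /orP [/cards2P [x [y [nxy E]]]|].
  exists (Some x), (Some y) => r; rewrite phiE E !inE !vtx_Some !(eq_sym r).
  by case: (eqVneq x r) nxy => [->|_] /=; rewrite ?add0r // eq_sym => /negPf ->; rewrite addr0.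
rewrite ltnS leq_eqVlt => /orP [/cards1P [x E]|].
  by exists (Some x), None => r; rewrite phiE E !inE vtx_Some addr0 eq_sym.
rewrite ltnS leqn0 cards_eq0 => /eqP E.
by exists None, None => r; rewrite phiE E inE addr0.
Qed.

Lemma conforming_even_cut (Psi : template) (M : matroid) :
  (forall N, conforms Psi N -> ~ has_minor N H12) ->
  conforms Psi (dual M) ->
  (forall S : {set M}, 0 < #|S| <= #|tY0 Psi| -> rk S = #|S| /\ rk (~: S) = rk [set: M]) ->
  even_cut M.
Proof.
move=> noH12 [R [F [A [[A' [Z [[rX rZ rF rL rD] AE AF AZ]]] iso]]]] conn.
have [g bg rg] := matroid_iso_sym iso.
have := embeds_trans (minor_embeds _ _) (embeds_iso bg rg).
rewrite imset0 set0U; set h := val \o g => emb.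
pose D r : {ffun tcols (tY0 Psi) (tY1 Psi) (tC Psi) -> 'F_2} := [ffun d => A' (inr r) (inl d)].
have colD d : column A (inl d) = tcol D d.
  by apply/ffunP => -[x|r]; rewrite !ffunE AE ?rX // ffunE.
have [f kf] := quot_ex <<[seq tcol D d | d in contracted set0]>>%VS.
have kC : lker f = <<[seq column A e | e in C_cols Psi F]>>%VS.
  rewrite kf; apply: eq_span => v; apply/imageP/imageP => [[[[y|j]|c]]|[_ /imsetP [c _ ->] ->]]; rewrite ?inE //.
    by move=> _ ->; exists (inl (inr c)); rewrite ?colD //; apply: imset_f.
  by exists (inr c); rewrite ?inE.
pose a : M -> {ffun brows Psi R -> ('F_2)^o} := f \o column A \o h.
have ra : @represents (dual M) _ a by exact: (represents_embeds (@vector_represents _ _ A) emb kC).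
have hI : injective h by case: emb.
pose w := f \o point D.
have hP e : (exists y, h e = inl (inl (inl y))) \/ (exists u, h e = inr u).
  have := valP (g e); rewrite -/(h e) -[val (g e)]/(h e) !inE negb_or.
  case: (h e) => [[[y|j]|c]|u] /andP [nC nY]; [by left; exists y| | |by right; exists u].
    by case/negP: nY; exact: imset_f.
  by case/negP: nC; exact: imset_f.
(* The elements of M that come from Y0. There are at most [#|tY0 Psi|] of them, so [conn] applies to
   the whole set. *)
pose SY : {set M} := [set e : M | if h e is inl (inl (inl _)) then true else false].
have SYc : SY != set0 -> rk SY = #|SY| /\ rk (~: SY) = rk [set: M].
  move=> SY0; apply: conn; rewrite card_gt0 SY0 -(card_imset _ hI) -cardsT.
  rewrite -(card_imset [set: tY0 Psi] (_ : injective (fun y => inl (inl (inl y)) : ecols Psi F))).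
    apply: subset_leq_card; apply/subsetP => _ /imsetP [e eS ->]; move: eS; rewrite inE.
    by case: (hP e) => [[y ->] _|[u -> //]]; exact: imset_f.
  by move=> ? ? [].
have fk x : x \in lker f -> f x = 0%R by rewrite memv_ker => /eqP.
apply: (@quotient_graph_even_cut M _ _ a w SY ra).
- move=> e; rewrite inE; case: (hP e) => [[y ->] //|[u hu] _].
  have [uZ|uZ] := boolP (u \in Z).
    have [z0 [r0 zr]] := rZ u uZ; have [j AZj] := AZ u uZ.
    exists (Some (inl r0)), (Some (inr j)); rewrite /edge_vec /= -linearD /a /= hu.
    congr (f _); apply/ffunP => -[x|r]; rewrite !ffunE AZj.
      by rewrite z0 rX.
    by rewrite zr.
  pose lam := [ffun x => A' (inl x) (inr u)].
  pose lv : {ffun brows Psi R -> ('F_2)^o} := [ffun b => match b with inl x => lam x | inr r => 0%R end].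
  (* The Lambda part of a frame column must vanish modulo the contracted columns, as otherwise H12
     appears; only the edge part survives. *)
  have lk : lv \in lker f.
    rewrite kf; have [//|ns] := boolP (lv \in _).
    have [|N cN hN] := @template_H12_of_Lambda Psi R D lam rD (rL u uZ).
      apply: contra ns; apply: subvP; apply: sub_span => v /imageP [c _ ->].
      by apply/imageP; exists (inr c); rewrite ?inE.
    by case: (noH12 N cN).
  have [p [q pq]] := vtx_pair (rF u uZ).
  pose ip (p : option R) := omap (@inl R (tY1 Psi)) p.
  exists (ip p), (ip q); rewrite /edge_vec /= -linearD /a /= hu.
  have -> : column A (inr u) = (lv + (point D (ip p) + point D (ip q)))%R.
    have pE s r : point D (ip s) (inr r) = vtx s r.
      case: s => [s|] /=; last by rewrite ffunE.
      by rewrite ffunE vtx_Some -[inr r == inr s]/(r == s) eq_sym.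
    have pX s x : point D (ip s) (inl x) = 0%R by case: s => [s|] /=; rewrite ffunE.
    apply/ffunP => -[x|r]; rewrite ffunE AF // [RHS]ffunE [lv _]ffunE [X in (_ + X)%R]ffunE ?pE ?pX ?addr0.
      by rewrite ffunE.
    by rewrite add0r.
  by rewrite linearD /= (fk _ lk) add0r.
(* Independence in the dual means that the complement of [SY] spans M. *)
- move=> T sT nT; have [S0|/SYc [r1 r2]] := eqVneq SY set0.
    by move: sT; rewrite S0 subset0 => /eqP.
  have /(represents_indep ra) iS : indep (SY : {set dual M}).
    have aux x r s s' : x + r = s + s' -> s' = r -> x == s by lia.
    exact: (aux _ _ _ _ (dual_rkE SY) r2).
  exact: iS.
- move=> e eS; have [r1 r2] : rk SY = #|SY| /\ rk (~: SY) = rk [set: M].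
    by apply: SYc; apply/set0Pn; exists e.
  have eqV : <<[seq a x | x in ~: SY]>>%VS = <<[seq a x | x in setT]>>%VS.
    apply/eqP; rewrite eqEdim -!/(span_rk a _) -!ra; apply/andP; split.
      by apply: sub_span => v /imageP [x _ ->]; apply: image_f.
    have aux x y t n s s' : x + t = n + 0 -> y + t = s' + s -> s + s' = n -> x <= y by lia.
    have rk0 : rk (set0 : {set M}) = 0 by apply/eqP; rewrite -leqn0 -(cards0 M) rk_le_card.
    have e1 : rk (m := dual M) setT + rk [set: M] = #|M| + 0.
      by have := dual_rkE (setT : {set M}); rewrite setCT cardsT rk0.
    have e2 : rk (m := dual M) (~: SY) + rk [set: M] = #|~: SY| + #|SY|.
      by have := dual_rkE (~: SY : {set M}); rewrite setCK r1.
    exact: (aux _ _ _ _ _ _ e1 e2 (cardsC SY)).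
  by rewrite eqV; apply: memv_span; apply: image_f.
- move=> Y X T1 T2 sY X2 s1 s2 r1 r2 n1 n2; apply/negPn/negP => n12.
  pose Y' := [set y | [exists e in Y, h e == inl (inl (inl y))]].
  have rE T : (sumv w T \in <<[seq a e | e in Y]>>%VS) = (sumv (point D) T \in <<[seq tcol D d | d in contracted Y']>>%VS).
    have -> : contracted Y' = [set inl (inl y) | y in Y'] :|: contracted set0.
      have iI : injective (fun y => inl (inl y) : tcols (tY0 Psi) (tY1 Psi) (tC Psi)) by move=> ? ? [].
      apply/setP => -[[y|j]|c]; rewrite in_setU.
      - by rewrite mem_imset // !inE orbF.
      - by rewrite !inE orbF; apply/esym/imsetP => [[]].
      - by rewrite !inE orbT.
    rewrite -(mem_span_quot _ _ kf) sumv_lin.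
    suff -> : <<[seq a e | e in Y]>>%VS = <<[seq (f \o tcol D) d | d in [set inl (inl y) | y in Y']]>>%VS by [].
    apply: eq_span => v; apply/imageP/imageP => [[e eY ->]|[_ /imsetP [y yY ->] ->]].
      have := subsetP sY e eY; rewrite inE; case: (hP e) => [[y hy] _|[u -> //]].
      exists (inl (inl y)); last by rewrite /a /= hy colD.
      by apply: imset_f; rewrite inE; apply/existsP; exists e; rewrite eY hy eqxx.
    move: yY; rewrite inE => /existsP [e /andP [eY /eqP hy]]; exists e => //.
    by rewrite /a /= hy colD.
  have [N cN hN] : exists2 N, conforms Psi N & has_minor N H12.
    apply: (@template_H12_of_relations Psi R D rD Y' X T1 T2) => //.
    - by move=> T sT; rewrite /relm -rE; exact: X2.
    - by rewrite /relm -rE.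
    - by rewrite /relm -rE.
  exact: noH12 cN hN.
Qed.

(** * Minors of even-cut matroids *)

Section Cuts.
Variables (V E : finType).
Implicit Types (p q : E -> V) (c : V -> bool) (F : {set E}).

Definition cut p q c : {set E} := [set e | c (p e) (+) c (q e)].

Lemma cutD p q c c' : cut p q (fun x => c x (+) c' x) = symd (cut p q c) (cut p q c').
Proof. by apply/setP => e; rewrite in_symd !inE addbACA. Qed.

(* The contraction of D as a retraction rho of the vertex set. *)
Lemma contract_ex p q (D : {set E}) : exists rho : V -> V,
  (forall e, e \in D -> rho (p e) = rho (q e)) /\
  (forall c, [disjoint cut p q c & D] -> forall x, c (rho x) = c x).
Proof.
pose compat (c : {ffun V -> bool}) := [disjoint cut p q c & D].
pose eqv x y := [forall c : {ffun V -> bool}, compat c ==> (c x == c y)].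
exists (fun x => odflt x [pick y | eqv x y]); split=> [e eD|c dc x].
  have H y : eqv (p e) y = eqv (q e) y.
    apply: eq_forallb => c; case dc: (compat c) => //=.
    have : e \notin cut p q c by rewrite (disjointFl dc eD).
    by rewrite inE; case: (c (p e)); case: (c (q e)).
  rewrite (eq_pick H); case: pickP => //= /(_ (q e)) /negP [].
  by apply/forallP => c; rewrite eqxx implybT.
case: pickP => //= y /forallP /(_ [ffun x => c x]); rewrite !ffunE.
have -> : compat [ffun x => c x].
  by rewrite /compat (_ : cut p q _ = cut p q c) //; apply/setP => e; rewrite !inE !ffunE.
by move=> /eqP.
Qed.

(** Each edge of [F] lies in at most two vertex stars, and a nonempty star has at least [g] edges.
    Having 2 ^ r different cuts requires at least r + 1 vertices with a nonempty star. *)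
Lemma cut_count0 p q F g r : 0 < r ->
  (forall c, cut p q c :&: F = set0 \/ g <= #|cut p q c :&: F|) ->
  2 ^ r <= #|[set cut p q c :&: F | c : {ffun V -> bool}]| ->
  g * r.+1 <= 2 * #|F|.
Proof.
move=> r0 Hg Hr; pose star v := cut p q (pred1 v) :&: F.
pose V1 := [set v | star v != set0].
have inV1 e : e \in F -> p e != q e -> (p e \in V1) && (q e \in V1).
  move=> eF ne; rewrite !inE; apply/andP; split; apply/set0Pn; exists e; rewrite !inE eF andbT /=.
    by rewrite eqxx eq_sym (negPf ne).
  by rewrite eqxx (negPf ne).
have leV1 : g * #|V1| <= 2 * #|F|.
  have s1 : \sum_(v in V1) #|star v| <= 2 * #|F|.
    apply: (@leq_trans (\sum_v #|star v|)).
      by rewrite big_mkcond /=; apply: leq_sum => v _; case: ifP.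
    have sE v : #|star v| = \sum_(e in F) ((p e == v) (+) (q e == v)).
      rewrite -sum1_card big_mkcond [RHS]big_mkcond /=; apply: eq_bigr => e _.
      by rewrite !inE /=; case: (e \in F); rewrite ?andbF // andbT; case: (_ (+) _).
    under eq_bigr do rewrite sE.
    rewrite exchange_big /= mulnC -sum_nat_const; apply: leq_sum => e _.
    apply: (@leq_trans (\sum_v ((p e == v) + (q e == v)))).
      by apply: leq_sum => v _; case: (p e == v); case: (q e == v).
    have d x : \sum_v (x == v) = 1.
      rewrite (bigD1 x) //= eqxx big1 ?addn0 // => y ny.
      by rewrite eq_sym (negPf ny).
    by rewrite big_split /= !d.
  apply: leq_trans s1; rewrite mulnC -sum_nat_const; apply: leq_sum => v; rewrite inE => vn.
  by have [E0|//] := Hg (pred1 v); rewrite /star E0 eqxx in vn.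
apply: leq_trans leV1; rewrite leq_mul2l; apply/orP; right.
have [V0|[v0 v0V]] := set_0Vmem V1.
  suff le1 : #|[set cut p q c :&: F | c : {ffun V -> bool}]| <= 1.
    by move: (leq_trans Hr le1); rewrite -[1 in X in _ <= X](expn0 2) leq_exp2l //; lia.
  rewrite -(cards1 (set0 : {set E})); apply: subset_leq_card; apply/subsetP => _ /imsetP [c _ ->].
  rewrite inE; apply/eqP/setP => e; rewrite !inE; apply/negP => /andP [ce eF].
  have := inV1 e eF; rewrite V0 !inE => H.
  by have [E1|/H //] := eqVneq (p e) (q e); rewrite E1 addbb in ce.
pose cs (W : {set V}) := cut p q (fun x => x \in W) :&: F.
(* A cut depends on [c] only up to complement, so [c] may be taken false at [v0], and only its
   values on [V1] matter. This gives the r + 1. *)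
have : #|[set cut p q c :&: F | c : {ffun V -> bool}]| <= 2 ^ #|V1 :\ v0|.
  rewrite -card_powerset; apply: leq_trans (leq_imset_card cs _).
  apply: subset_leq_card; apply/subsetP => _ /imsetP [c _ ->].
  apply/imsetP; exists [set x in V1 | c x (+) c v0].
    rewrite inE; apply/subsetP => x; rewrite !inE => /andP [-> cx]; rewrite andbT.
    by apply: contraTneq cx => ->; rewrite addbb.
  apply/setP => e; rewrite !inE; case eF: (e \in F); rewrite ?andbF // !andbT.
  have [E1|ne] := eqVneq (p e) (q e); first by rewrite E1 !addbb.
  have /andP [] := inV1 e eF ne; rewrite !inE => -> -> /=.
  by case: (c (p e)); case: (c (q e)); case: (c v0).
move=> h; have := leq_trans Hr h; rewrite leq_exp2l // (cardsD1 v0 V1) v0V; lia.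
Qed.

(* Double counting: in G / C1 at least r + 1 vertices have a nonempty star, hence one of size at least g. *)
Lemma cut_count p q (C1 F : {set E}) g r (L : {set {set E}}) : 0 < r ->
  (forall c, [disjoint cut p q c & C1] -> cut p q c :&: F = set0 \/ g <= #|cut p q c :&: F|) ->
  (forall S, S \in L -> exists2 c, [disjoint cut p q c & C1] & S = cut p q c :&: F) ->
  2 ^ r <= #|L| -> g * r.+1 <= 2 * #|F|.
Proof.
move=> r0 Hg HL Lr; have [rho [rD rc]] := contract_ex p q C1.
have cE c : cut (rho \o p) (rho \o q) c = cut p q (c \o rho) by apply/setP => e; rewrite !inE.
have dj c : [disjoint cut p q (c \o rho) & C1].
  rewrite -setI_eq0; apply/eqP/setP => e; rewrite !inE /=; apply/negP => /andP [+ eC].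
  by rewrite rD // addbb.
apply: (@cut_count0 (rho \o p) (rho \o q) F g r r0) => [c|].
  by rewrite cE; apply: Hg.
apply: leq_trans Lr _; apply: subset_leq_card; apply/subsetP => S /HL [c dc ->].
apply/imsetP; exists [ffun x => c x] => //; congr (_ :&: F); apply/setP => e; rewrite !inE !ffunE /=.
by rewrite !(rc _ dc).
Qed.

End Cuts.

(** The matrix whose rows are the null sets of [a] represents the dual as well, and two
    representations of a matroid have the same null sets. *)
Lemma represents_dual_nul (M : matroid) (vT wT : vectType 'F_2) (a : M -> vT) (b : M -> wT) :
  represents a -> @represents (dual M) _ b ->
  forall T : {set M}, nul b T <-> forall S, nul a S -> ~~ odd #|T :&: S|.
Proof.
move=> ra rb T.
pose A : bmatrix {S : {set M} | nul a S} M := fun S e => ((e \in val S)%:R)%R.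
have H (U : {set M}) : nul (column A) U <-> forall S, nul a S -> ~~ odd #|U :&: S|.
  have rE S : [set e | A S e != 0%R] = val S.
    by apply/setP => e; rewrite inE /A; case: (e \in val S); rewrite ?eqxx ?oner_eq0.
  rewrite nul_column; split=> [/forallP h S nS|h].
    by have := h (Sub S nS); rewrite rE.
  by apply/forallP => S; rewrite rE; apply: h; exact: valP.
by rewrite (represents_nul rb (represents_dual ra H)).
Qed.

Lemma graph_ends (G : graph) (e : edge G) : exists uw : vertex G * vertex G, ends e == [set uw.1; uw.2].
Proof.
have /andP [] := ends_card e; rewrite leq_eqVlt => /orP [/eqP H _|H1 H2].
  have /cards1P [u ->] : #|ends e| == 1 by rewrite -H.
  by exists (u, u); rewrite setUid.
have /cards2P [u [w [_ ->]]] : #|ends e| == 2 by rewrite eqn_leq H2 H1.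
by exists (u, w).
Qed.

Definition tail_of (G : graph) (e : edge G) : vertex G := (xchoose (graph_ends e)).1.
Definition head_of (G : graph) (e : edge G) : vertex G := (xchoose (graph_ends e)).2.

Lemma inc_ends (G : graph) (e : edge G) : inc_vec e = edge_vec (@vertex_vec G) (tail_of e, head_of e).
Proof.
have := xchooseP (graph_ends e); rewrite -/(tail_of e) -/(head_of e) => /eqP E.
rewrite /inc_vec E cards2; case: (eqVneq (tail_of e) (head_of e)) => [->|n] /=.
  by rewrite /edge_vec /= addrr_F2.
by rewrite big_setU1 ?inE //= ?big_set1.
Qed.

(** A functional on the vertex space is a two-colouring of the vertices, and its value at an edge
    vector tells whether the edge is cut. *)
Lemma orthogonal_cycles_cut (G : graph) (T : {set edge G}) :
  (forall S, nul (@inc_vec G) S -> ~~ odd #|T :&: S|) <->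
  exists c, T = cut (@tail_of G) (@head_of G) c.
Proof.
split=> [/functional_ex [phi phiD phiE]|[c ->] S nS].
  exists (fun v => phi (vertex_vec v)); apply/setP => e.
  by rewrite inE phiE inc_ends /edge_vec phiD.
pose phi (x : {ffun vertex G -> ('F_2)^o}) := ((\sum_(v | c v) x v)%R != 0%R :> 'F_2).
have phiD x y : phi (x + y)%R = phi x (+) phi y.
  rewrite /phi -F2_neq0D -big_split; congr (_ != _).
  by apply: eq_bigr => v _; rewrite ffunE.
have phiv v : phi (vertex_vec v) = c v.
  rewrite /phi; case cv: (c v).
    rewrite (bigD1 v) //= ffunE eqxx big1 ?addr0 // => y /andP [_ ny].
    by rewrite ffunE (negPf ny).
  rewrite big1 ?eqxx // => y cy; rewrite ffunE; case: eqP => // E.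
  by rewrite E cv in cy.
rewrite setIC (_ : cut _ _ c = [set e | phi (inc_vec e)]); last first.
  by apply/setP => e; rewrite !inE inc_ends /edge_vec phiD !phiv.
rewrite -(functional_sum phiD) (eqP nS) /phi big1 ?eqxx // => v _; by rewrite ffunE.
Qed.

(** The last clause expresses, without counting, that the null sets form a subgroup of index at most
    two in the cut space. *)
Lemma even_cut_minor (M Q : matroid) (wT : vectType 'F_2) (b : Q -> wT) :
  even_cut M -> has_minor M Q -> represents b ->
  exists (V : finType) (p q : Q -> V),
    (forall T : {set Q}, nul b T -> exists c, T = cut p q c) /\
    (forall c c', [|| nul b (cut p q c), nul b (cut p q c') | nul b (cut p q (fun x => c x (+) c' x))]).
Proof.
move=> [B [E [A [b0 [isoA [G [t [t' tK tK'] rt]]]]]]] mQ rb.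
have /has_minorP [C [h emb]] := has_minor_trans (iso_has_minor isoA) mQ.
have [hI hC _] := emb.
have [f kf] := quot_ex <<[seq column A e | e in C]>>%VS.
have rb' := represents_embeds (@vector_represents _ _ A) emb kf.
have nb (T : {set Q}) : reflect (exists2 U : {set E}, U \subset C & nul (column A) (symd (h @: T) U)) (nul b T).
  rewrite (represents_nul rb rb') /nul -[sumv _ T]/(sumv ((f \o column A) \o h) T) sumv_inj //.
  apply: (iffP (nul_quot _ kf)) => -[U sU E1]; exists U => //.
    by rewrite sumvD E1 addrr_F2.
  by apply/eqP; move: E1; rewrite sumvD addr_eq0_F2.
pose p0 e := tail_of (t' e); pose q0 e := head_of (t' e).
have tI := can_inj tK.
(* The rows other than [b0] represent the dual of a cycle matroid, so their null sets are the cuts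
   of [G]. *)
have ndel (X : {set E}) : nul (column (delete_row A b0)) X <-> exists c, X = cut p0 q0 c.
  have rd : @represents (dual (cycle_matroid G)) _ (column (delete_row A b0) \o t).
    exact: (represents_iso (@vector_represents _ _ (delete_row A b0)) rt).
  have XE : X = t @: (t' @: X) by rewrite -imset_comp (eq_imset _ tK') imset_id.
  have -> : nul (column (delete_row A b0)) X = nul (column (delete_row A b0) \o t) (t' @: X).
    by rewrite /nul [in RHS]sumv_inj // -XE.
  rewrite (represents_dual_nul (@cycle_represents G) rd) orthogonal_cycles_cut.
  split=> -[c Ec]; exists c.
    rewrite XE Ec; apply/setP => e; rewrite -(tK' e) (mem_imset _ _ tI) !inE /p0 /q0 tK //.
  apply/setP => e; rewrite -(tK e) (mem_imset _ _ (can_inj tK')) Ec !inE /p0 /q0 !tK //.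
have nA (X : {set E}) : nul (column A) X = nul (column (delete_row A b0)) X && ~~ odd #|X :&: [set e | A b0 e != 0%R]|.
  rewrite !nul_column; apply/forallP/andP => [H|[/forallP H H0] x].
    by split; [apply/forallP => x; exact: H|exact: H].
  have [->//|nx] := eqVneq x b0.
  exact: (H (Sub x nx)).
(* Null sets of the minor come from cuts that avoid the deleted elements, so these are contracted in
   the graph; the contracted elements [C] are just forgotten. *)
pose Del := ~: (C :|: h @: setT).
have [rho [rD rc]] := contract_ex p0 q0 Del.
exists (vertex G), (rho \o p0 \o h), (rho \o q0 \o h).
have cutE c : h @: cut (rho \o p0 \o h) (rho \o q0 \o h) c = cut p0 q0 (c \o rho) :&: h @: setT.
  apply/setP => e; rewrite inE; apply/imsetP/andP => [[x + ->]|[+ /imsetP [x _ E1]]].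
    by rewrite !inE /= => ->; rewrite imset_f.
  by rewrite E1 => H; exists x => //; move: H; rewrite !inE.
split=> [T /nb [U sU nU]|c c'].
  have /andP [/ndel [c Ec] _] : nul (column (delete_row A b0)) (symd (h @: T) U) && true.
    by move: nU; rewrite nA => /andP [-> _].
  exists c; apply: (imset_inj hI); rewrite cutE.
  have dc : [disjoint cut p0 q0 c & Del].
    rewrite -Ec disjoints_subset setCK; apply: symd_sub; apply/subsetP => x xT; rewrite inE.
      by apply/orP; right; move: xT; apply/subsetP; apply: imsetS; exact: subsetT.
    by rewrite (subsetP sU).
  have -> : cut p0 q0 (c \o rho) = cut p0 q0 c by apply/setP => e; rewrite !inE /= !(rc c dc).
  rewrite -Ec; apply/setP => e; rewrite inE in_symd; apply/idP/andP => [eT|[+ /imsetP [x _ E1]]].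
    have /imsetP [x _ E1] := eT; split; last by rewrite E1 imset_f.
    by rewrite eT /=; apply: contra (hC x); rewrite -E1; exact: (subsetP sU).
  rewrite E1 (mem_imset _ _ hI); case: (x \in T) => //= xU.
  by have := hC x; rewrite (subsetP sU).
(* The row [b0] adds a single parity condition. At least one of [c], [c'] and their sum satisfies
   it. *)
pose even c := ~~ odd #|[set e | A b0 e != 0%R] :&: cut p0 q0 (c \o rho)|.
have main c1 : even c1 -> nul b (cut (rho \o p0 \o h) (rho \o q0 \o h) c1).
  move=> ev; apply/nb; exists (cut p0 q0 (c1 \o rho) :&: C); first exact: subsetIr.
  have -> : symd (h @: cut (rho \o p0 \o h) (rho \o q0 \o h) c1) (cut p0 q0 (c1 \o rho) :&: C) = cut p0 q0 (c1 \o rho).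
    rewrite cutE -setI_symdr; apply/setIidPl; apply/subsetP => e eX; rewrite in_symd.
    have eD : e \notin Del.
      by apply/negP => /rD E1; move: eX; rewrite !inE /= E1 addbb.
    have [/imsetP [x _ ->]|eh] := boolP (e \in h @: setT); first by rewrite (negPf (hC x)).
    by move: eD; rewrite !inE (negPf eh) orbF negbK.
  by rewrite nA setIC; apply/andP; split=> //; apply/ndel; exists (c1 \o rho).
have [e1|n1] := boolP (even c); first by rewrite main.
have [e2|n2] := boolP (even c'); first by rewrite (main c') ?orbT.
rewrite (main (fun x => c x (+) c' x)) ?orbT // /even.
have -> : cut p0 q0 ((fun x => c x (+) c' x) \o rho) = symd (cut p0 q0 (c \o rho)) (cut p0 q0 (c' \o rho)).
  by rewrite -cutD.
by rewrite setI_symdr odd_symd; move: n1 n2; rewrite /even !negbK => -> ->.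
Qed.

(** * Cycle spaces of complete graphs and the exclusion of M(K_6) *)

Definition edges_in n (X : {set 'I_n}) : {set edge (complete_graph n)} := [set e : edge (complete_graph n) | ends e \subset X].

Lemma in_edges_in n (X : {set 'I_n}) e : (e \in edges_in X) = (ends e \subset X).
Proof. by rewrite inE. Qed.

Lemma card_complete_edges n (X : {set 'I_n}) :
  #|edges_in X| = 'C(#|X|, 2).
Proof.
rewrite -(card_imset _ (@complete_ends_inj n)) -cards_draws; apply: eq_card => S; rewrite !inE.
apply/imsetP/andP => [[e + ->]|[sS S2]]; first by rewrite in_edges_in => ->; rewrite complete_card.
by exists (exist (fun S : {set 'I_n} => #|S| == 2) S S2); rewrite // in_edges_in.
Qed.

Lemma complete_edge_ex n (x y : 'I_n) : x != y -> exists e : edge (complete_graph n), ends e = [set x; y].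
Proof.
move=> nxy; have S2 : #|[set x; y]| == 2 by rewrite cards2 nxy.
by exists (exist (fun S : {set 'I_n} => #|S| == 2) _ S2).
Qed.

Lemma complete_nul_ge3 n (T : {set edge (complete_graph n)}) : nul (@inc_vec _) T -> T = set0 \/ 3 <= #|T|.
Proof.
move=> nT; have [->|[e eT]] := set_0Vmem T; [by left|right].
case T1: #|T| => [|[|[|k]]] //.
- by move/eqP: T1; rewrite cards_eq0 => /eqP T0; rewrite T0 inE in eT.
- by move/eqP/cards1P: T1 => [x Tx]; move: nT; rewrite Tx nul1 (negPf (complete_inc_neq0 x)).
move/eqP/cards2P: T1 => [x [y [nxy Tx]]]; move: nT.
by rewrite Tx nul2 // (inj_eq (@complete_inc_inj n)) (negPf nxy).
Qed.

Lemma complete_star n (v : 'I_n) :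
  [set e : edge (complete_graph n) | inc_vec e v != 0%R] = ~: edges_in (~: [set v]).
Proof.
apply/setP => e; rewrite in_setC in_edges_in inE complete_inc.
have -> : (ends e \subset ~: [set v]) = (v \notin ends e).
  apply/subsetP/idP => [H|nv x xe]; first by apply/negP => /H; rewrite !inE eqxx.
  by rewrite !inE; apply: contraNneq nv => <-.
by case: (v \in ends e); rewrite ?oner_eq0 ?eqxx.
Qed.

(* The triangles through u are independent: each contains exactly one edge inside X. *)
Lemma complete_cycles_count n (u : 'I_n) (X : {set 'I_n}) : u \notin X ->
  2 ^ 'C(#|X|, 2) <= #|[set T : {set edge (complete_graph n)} | nul (@inc_vec _) T & T \subset edges_in (u |: X)]|.
Proof.
move=> uX; pose F' := edges_in X.
rewrite -card_complete_edges -card_powerset -/F'.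
have tri (e : edge (complete_graph n)) : exists D : {set edge (complete_graph n)},
    (e \in F') ==> [&& nul (@inc_vec _) D, D \subset edges_in (u |: X) & D :&: F' == [set e]].
  have [eF|] := boolP (e \in F'); last by exists set0.
  have [[x y] /andP [/= nxy /eqP Ee]] := complete_ends e.
  move: (eF); rewrite in_edges_in Ee subUset !sub1set => /andP [xX yX].
  have nux : u != x by apply: contraNneq uX => ->.
  have nuy : u != y by apply: contraNneq uX => ->.
  have [e1 E1] := complete_edge_ex nux; have [e2 E2] := complete_edge_ex nuy.
  have uE : u \notin ends e by rewrite Ee !inE negb_or nux nuy.
  have uE1 : u \in ends e1 by rewrite E1 !inE eqxx.
  have uE2 : u \in ends e2 by rewrite E2 !inE eqxx.
  exists (symd [set e] (symd [set e1] [set e2])); apply/and3P; split.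
  - rewrite /nul !sumvD !sumv1; apply/eqP/ffunP => z; rewrite !ffunE !complete_inc Ee E1 E2 !inE.
    case: (eqVneq z u) => [->|_]; first by rewrite (negPf nux) (negPf nuy) /= add0r addrr_F2.
    case: (eqVneq z x) => [->|_]; first by rewrite (negPf nxy) /= addr0 addrr_F2.
    by case: (z == y); rewrite /= ?add0r ?addr0 ?addrr_F2.
  - by rewrite !symd_sub // sub1set in_edges_in ?Ee ?E1 ?E2 subUset !sub1set !inE ?xX ?yX ?eqxx ?orbT.
  apply/eqP/setP => f; rewrite in_setI !in_symd !in_set1.
  have [->|nfe] := eqVneq f e.
    have ne1 : e != e1 by apply: contraTneq uE1 => <-.
    have ne2 : e != e2 by apply: contraTneq uE2 => <-.
    by rewrite eF andbT (negPf ne1) (negPf ne2).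
  apply/negP => /andP [h]; rewrite in_edges_in.
  have : u \in ends (f : edge (complete_graph n)).
    by move: h => /=; case: eqP => [->|_] //; case: eqP => [->|_].
  by move=> uf /subsetP /(_ u uf); rewrite (negPf uX).
pose D (e : edge (complete_graph n)) := xchoose (tri e).
have DP (e : edge (complete_graph n)) : e \in F' -> [/\ nul (@inc_vec _) (D e), D e \subset edges_in (u |: X) & D e :&: F' = [set e]].
  by move=> eF; have /implyP/(_ eF)/and3P [? ? /eqP ?] := xchooseP (tri e).
pose cyc (W : {set edge (complete_graph n)}) := \big[@symd _/set0]_(e in W) D e.
have cycF (W : {set edge (complete_graph n)}) : W \subset F' -> F' :&: cyc W = W.
  move=> /subsetP sW; rewrite /cyc (big_morph (fun A => F' :&: A) (setI_symdr F') (setI0 F')).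
  rewrite (eq_bigr (fun e => [set e])); last by move=> e /sW /DP [_ _ <-]; rewrite setIC.
  apply/setP => x; rewrite (big_morph (fun A : {set edge (complete_graph n)} => x \in A) (id1 := false) (op1 := addb)).
  - have [xW|xW] := boolP (x \in W).
      rewrite (bigD1 x) //= inE eqxx big1 ?addbF // => y /andP [_ nyx].
      by rewrite inE eq_sym (negPf nyx).
    rewrite big1 // => y yW; rewrite inE; apply/eqP => E; by rewrite E yW in xW.
  - by move=> ? ?; rewrite in_symd.
  - by rewrite inE.
have cI : {in powerset F' &, injective cyc}.
  by move=> W W'; rewrite !inE => /cycF E /cycF E' EE; rewrite -E EE E'.
rewrite -(card_in_imset cI); apply: subset_leq_card; apply/subsetP => _ /imsetP [W sW ->].
rewrite inE in sW; rewrite inE /cyc.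
apply: (big_ind (fun T => nul (@inc_vec _) T && (T \subset _))).
- by rewrite nul0 sub0set.
- by move=> ? ? /andP [? ?] /andP [? ?]; rewrite nulD // symd_sub.
- by move=> e /(subsetP sW) /DP [-> -> _].
Qed.

Lemma even_cut_K6_free (M : matroid) : even_cut M -> ~ has_minor M (cycle_matroid (complete_graph 6)).
Proof.
move=> eM mK; have [V [p [q [H1 H2]]]] := even_cut_minor eM mK (@cycle_represents _).
pose st (v : 'I_6) := [set e : edge (complete_graph 6) | @inc_vec (complete_graph 6) e v != 0%R].
(* A cut that is not null meets some vertex star oddly. Adding a cut disjoint from that star keeps
   the parity odd, so the sum is not null either, and by the index bound the disjoint cut is
   null. *)
have [v vP] : exists v : 'I_6, forall c, [disjoint cut p q c & st v] -> nul (@inc_vec (complete_graph 6)) (cut p q c).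
  have [/forallP Hn|] := boolP [forall c : {ffun V -> bool}, nul (@inc_vec (complete_graph 6)) (cut p q c)].
    exists ord0 => c _; have := Hn [ffun x => c x]; congr (nul _ _).
    by apply/setP => e; rewrite !inE !ffunE.
  rewrite negb_forall => /existsP [c0 n0].
  move: (n0); rewrite nul_ffun negb_forall => /existsP [v]; rewrite negbK => ov.
  exists v => c dc; have := H2 c0 c; rewrite (negPf n0) /=.
  case/orP => //; rewrite nul_ffun cutD => /forallP /(_ v).
  rewrite setIC setI_symdr odd_symd setIC ov /= negbK setIC -setI_eq0 in dc *.
  by move/eqP: dc => ->; rewrite cards0.
pose F := edges_in (~: [set v]).
have dF c : [disjoint cut p q c & st v] -> cut p q c :&: F = cut p q c.
  by rewrite /st complete_star disjoints_subset setCK => /setIidPl.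
have [u uv] : exists u : 'I_6, u != v.
  by have [->|] := eqVneq v ord0; [exists (inord 1); rewrite -val_eqE /= inordK|exists ord0; rewrite eq_sym].
have vu : u |: ~: [set u; v] = ~: [set v].
  by apply/setP => x; rewrite !inE; case: (eqVneq x u) => [->|_] //=; rewrite uv.
have c4 : #|~: [set u; v]| = 4 by rewrite cardsCs setCK card_ord cards2 uv.
have c5 : #|~: [set v]| = 5 by rewrite cardsCs setCK card_ord cards1.
pose L := [set T : {set edge (complete_graph 6)} | nul (@inc_vec (complete_graph 6)) T & T \subset F].
have L6 : 2 ^ 6 <= #|L|.
  have := @complete_cycles_count 6 u (~: [set u; v]); rewrite vu c4 => h; apply: h.
  by rewrite !inE eqxx.
have := @cut_count V _ p q (st v) F 3 6 L isT _ _ L6.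
rewrite [#|F|]card_complete_edges c5 => h; suff : 3 * 7 <= 2 * 'C(5, 2) by [].
apply: h => [c dc|S]; first by rewrite dF //; apply: complete_nul_ge3; exact: vP.
rewrite inE => /andP [nS sS]; have [c Ec] := H1 S nS; exists c; last first.
  by rewrite -Ec (setIidPl sS).
by rewrite -Ec /st complete_star disjoints_subset setCK.
Qed.

(* Subsets of 'I_12 as bit words of length 12, for computation. *)
Definition word (T : {set 'I_12}) : seq bool := [seq inord i \in T | i <- iota 0 12].

Definition xorw (s t : seq bool) : seq bool := [seq x.1 (+) x.2 | x <- zip s t].

Definition H12_words : seq (seq bool) := [seq [seq x == 1 | x <- r] | r <- H12_rows].

Definition comb (b : seq bool) : seq bool :=
  foldr (fun x acc => if x.1 then xorw x.2 acc else acc) (nseq 12 false) (zip b H12_words).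

Fixpoint words n : seq (seq bool) :=
  if n is n'.+1 then [seq false :: t | t <- words n'] ++ [seq true :: t | t <- words n'] else [:: [::]].

Lemma mem_words (t : seq bool) : t \in words (size t).
Proof.
elim: t => [|[] t IH] //=; rewrite mem_cat; apply/orP; [right|left]; exact: map_f.
Qed.

(* The coset representatives vanishing on the information set {0, 1, 2, 4, 6}. *)
Definition coset_word (t : seq bool) : seq bool :=
  let b := nth false t in
  [:: false; false; false; b 0; false; b 1; false; b 2; b 3; b 4; b 5; b 6].

Definition coset_bits (t : seq bool) : seq bool := [seq nth false t i | i <- [:: 3; 5; 7; 8; 9; 10; 11]].

(** The solution of the linear system asking a sum of rows to agree with [t] at the positions 0, 1,
    2, 4, 6. *)
Definition info_coeffs (t : seq bool) : seq bool :=
  let b := nth false t in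
  [:: b 0 (+) b 1; b 2 (+) b 6; b 0 (+) b 1 (+) b 2 (+) b 4 (+) b 6; b 1; b 0 (+) b 1 (+) b 2].

Lemma coset_wordP (t : seq bool) : size t = 12 ->
  xorw (comb (info_coeffs t)) t = coset_word (coset_bits (xorw (comb (info_coeffs t)) t)).
Proof.
case: t => [|t0 [|t1 [|t2 [|t3 [|t4 [|t5 [|t6 [|t7 [|t8 [|t9 [|t10 [|t11 [|]]]]]]]]]]]]] // _.
by case: t0; case: t1; case: t2; case: t4; case: t6.
Qed.

Definition vanishes (C : seq nat) (t : seq bool) : bool := all (fun i => ~~ nth false t i) C.
Definition weight (F : seq nat) (t : seq bool) : nat := count (nth false t) F.
Definition restrict (F : seq nat) (t : seq bool) : seq bool := [seq nth false t i | i <- F].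

(* For a word s, the cut space of a graph cannot be spanned by s and the rows of H12 if, after contracting
   C and restricting to F, it would have rank at least r and minimum weight at least g with 2|F| < g(r + 1). *)
Definition refutes (s : seq bool) (c : seq nat * seq nat * (nat * nat)) : bool :=
  let '(C, F, (g, r)) := c in
  let R := [seq comb b | b <- words 5] in
  [&& all (fun i => i < 12) C, all (fun i => i < 12) F, uniq F, 0 < r, 2 * size F < g * r.+1,
      all (fun t => vanishes C t ==> ((weight F t == 0) || (g <= weight F t))) (R ++ [seq xorw s t | t <- R])
    & 2 ^ r <= size (undup [seq restrict F t | t <- R & vanishes C t])].

(* F7 by contracting an even triangle, F7 by contracting one element of a pair, F7* by deletion. *)
Definition certificates : seq (seq nat * seq nat * (nat * nat)) :=
  [:: ([:: 1; 3; 11], [:: 0; 4; 5; 6; 7; 8; 9], (4, 3));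
      ([:: 0; 2; 11], [:: 1; 4; 5; 6; 7; 8; 9], (4, 3));
      ([:: 0; 3; 10], [:: 1; 4; 5; 6; 7; 8; 9], (4, 3));
      ([:: 1; 2; 10], [:: 0; 4; 5; 6; 7; 8; 9], (4, 3));
      ([:: 4], [:: 0; 1; 2; 3; 10; 11; 5], (4, 3));
      ([:: 6], [:: 0; 1; 2; 3; 10; 11; 7], (4, 3));
      ([:: 8], [:: 0; 1; 2; 3; 10; 11; 9], (4, 3));
      ([::], [:: 4; 5; 6; 7; 8; 9; 2], (3, 4));
      ([::], [:: 4; 5; 6; 7; 8; 9; 3], (3, 4))].

(** The seven free positions run through all cosets of the row space, whose dimension is 5, in the
    words of length 12. *)
Lemma all_cosets_refuted : all (fun t => has (refutes (coset_word t)) certificates) (words 7).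
Proof. by vm_compute. Qed.

Lemma size_word T : size (word T) = 12.
Proof. by rewrite size_map size_iota. Qed.

Lemma nth_word T i : i < 12 -> nth false (word T) i = (inord i \in T).
Proof. by move=> i12; rewrite (nth_map 0) ?size_iota // nth_iota. Qed.

Lemma word_symd S T : word (symd S T) = xorw (word S) (word T).
Proof.
rewrite /word /xorw; elim: (iota 0 12) => //= i s ->.
by rewrite in_symd.
Qed.

Lemma word0 : word set0 = nseq 12 false.
Proof.
by apply: (@eq_from_nth _ false); rewrite ?size_word // => i i12; rewrite nth_word // inE nth_nseq if_same.
Qed.

Definition row_set (i : 'I_5) : {set 'I_12} := [set e | h12 e i != 0%R].

Lemma word_row (i : 'I_5) : word (row_set i) = nth [::] H12_words i.
Proof.
apply: (@eq_from_nth _ false); rewrite size_word; first by case: i => [[|[|[|[|[|i]]]]] Hi].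
move=> e e12; rewrite nth_word // inE ffunE /H12_matrix inordK //.
by case: i => [[|[|[|[|[|i]]]]] Hi] //=; case: e e12 => [|[|[|[|[|[|[|[|[|[|[|[|e]]]]]]]]]]]] //=; rewrite ?eqxx ?oner_eq0.
Qed.

Definition comb_set (b : seq bool) : {set 'I_12} :=
  foldr (fun x acc => if x.1 then symd x.2 acc else acc) set0 (zip b [seq row_set i | i <- enum 'I_5]).

Lemma word_comb b : word (comb_set b) = comb b.
Proof.
rewrite /comb_set /comb.
have -> : H12_words = [seq word (row_set i) | i <- enum 'I_5].
  have := map_comp (nth [::] H12_words) val (enum 'I_5); rewrite val_enum_ord => E.
  by rewrite (eq_map word_row) -[RHS]/(map (nth [::] H12_words \o val) _) E.
elim: (enum 'I_5) b => [|i s IH] [|x b] //=; rewrite ?word0 //.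
by case: x; rewrite /= ?word_symd IH.
Qed.

Lemma card_word (T : {set 'I_12}) (F : seq nat) : uniq F -> all (fun i => i < 12) F ->
  #|T :&: [set i : 'I_12 | nat_of_ord i \in F]| = weight F (word T).
Proof.
move=> uF /allP F12; rewrite /weight -size_filter.
pose s : seq 'I_12 := [seq inord i | i <- F & nth false (word T) i].
have -> : size [seq i <- F | nth false (word T) i] = size s by rewrite size_map.
have us : uniq s.
  rewrite map_inj_in_uniq ?filter_uniq // => x y; rewrite !mem_filter => /andP [_ /F12 x12] /andP [_ /F12 y12] E.
  by rewrite -(inordK x12) E inordK.
rewrite -(card_uniqP us); apply: eq_card => x; rewrite !inE; apply/andP/mapP => [[xT xF]|[i]].
  exists (nat_of_ord x); last by rewrite inord_val.
  by rewrite mem_filter xF andbT (nth_word T (ltn_ord x)) inord_val.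
rewrite mem_filter => /andP [+ iF] ->; rewrite nth_word ?F12 // => ->.
by rewrite inordK ?F12.
Qed.

Lemma weight_setT (F : seq nat) : uniq F -> all (fun i => i < 12) F -> #|[set i : 'I_12 | nat_of_ord i \in F]| = size F.
Proof.
move=> uF F12; rewrite -[LHS](congr1 (fun S : {set _} => #|S|) (setTI _)) card_word // /weight.
by apply/eqP; rewrite -all_count; apply/allP => i /(allP F12) i12; rewrite nth_word // inE.
Qed.

Lemma disjoint_word (T : {set 'I_12}) (C : seq nat) : all (fun i => i < 12) C ->
  [disjoint T & [set i : 'I_12 | nat_of_ord i \in C]] = vanishes C (word T).
Proof.
move=> /allP C12; apply/idP/allP => [dj i iC|H].
  rewrite nth_word ?C12 //; apply/negP => iT; have := disjointFr dj iT.
  by rewrite inE inordK ?C12 // iC.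
rewrite disjoint_sym disjoints_subset; apply/subsetP => i; rewrite !inE => /H.
by rewrite nth_word // inord_val.
Qed.

Lemma restrict_word (T : {set 'I_12}) (F : seq nat) : all (fun i => i < 12) F ->
  restrict F (word (T :&: [set i : 'I_12 | nat_of_ord i \in F])) = restrict F (word T).
Proof.
move=> /allP F12; apply/eq_in_map => i iF; rewrite !nth_word ?F12 // !inE inordK ?F12 //.
by rewrite iF andbT.
Qed.

Lemma even_cut_H12_free (M : matroid) : even_cut M -> ~ has_minor M (dual H12).
Proof.
move=> eM mH.
pose Ah : bmatrix {S : {set 'I_12} | nul h12 S} 'I_12 := fun S e => ((e \in val S)%:R)%R.
have nAh (T : {set 'I_12}) : nul (column Ah) T <-> forall S, nul h12 S -> ~~ odd #|T :&: S|.
  have rE S : [set e | Ah S e != 0%R] = val S.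
    by apply/setP => e; rewrite inE /Ah; case: (e \in val S); rewrite ?eqxx ?oner_eq0.
  rewrite nul_column; split=> [/forallP h S nS|h].
    by have := h (Sub S nS); rewrite rE.
  by apply/forallP => S; rewrite rE; apply: h; exact: valP.
have rb : @represents (dual H12) _ (column Ah) := represents_dual H12_represents nAh.
have [V [p [q [H1 H2]]]] := even_cut_minor eM mH rb.
pose R := [seq comb b | b <- words 5].
have n_comb b : nul (column Ah) (comb_set b).
  rewrite /comb_set; elim: (enum 'I_5) b => [|i s IH] [|x b] //=; rewrite ?nul0 //.
  case: x => //=; apply: nulD => //; apply/nAh => S; rewrite nul_ffun => /forallP /(_ i).
  by rewrite setIC.
(* A set orthogonal to all null sets is read off from a functional, so it is the sum of the rows
   weighted by the values at the unit vectors. *)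
have n_R T : nul (column Ah) T -> word T \in R.
  move=> /nAh /functional_ex [phi phiD phiE].
  pose dl (i : 'I_5) : {ffun 'I_5 -> ('F_2)^o} := [ffun k => (k == i)%:R%R].
  pose b := [seq phi (dl i) | i <- enum 'I_5].
  suff -> : T = comb_set b.
    by rewrite word_comb; apply: map_f; have := mem_words b; rewrite size_map size_enum_ord.
  apply/setP => e; rewrite phiE.
  have -> : h12 e = sumv dl [set i | e \in row_set i].
    apply/ffunP => k; rewrite sumv_ffun.
    have [ek|ek] := boolP (e \in row_set k).
      have ik : k \in [set i | e \in row_set i] by rewrite inE.
      rewrite (bigD1 k ik) /= big1 => [|i /andP [_ nik]].
        rewrite addr0 [RHS]ffunE eqxx; move: ek; rewrite inE.
        by case: (F2P (h12 e k)) => ->; rewrite ?eqxx.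
      by rewrite ffunE eq_sym (negPf nik).
    rewrite big1 => [|i]; first by move: ek; rewrite inE negbK => /eqP.
    by rewrite inE ffunE => ei; case: eqP => // E; rewrite E ei in ek.
  rewrite (functional_sum phiD) -sum1_card big_mkcond /= (big_morph odd oddD (erefl : odd 0 = false)).
  rewrite -big_enum /comb_set /b; elim: (enum 'I_5) => [|i s IH]; first by rewrite big_nil inE.
  rewrite big_cons /= IH !inE; case: (phi (dl i)); rewrite /= ?andbF //.
  by rewrite in_symd inE; case: (h12 e i != 0%R).
have [w1 [[t1 Ew1] cutR]] : exists w1, (exists t1, size t1 = 7 /\ w1 = coset_word t1) /\
    forall c, word (cut p q c) \in R ++ [seq xorw w1 t | t <- R].
  have [/forallP Hn|] := boolP [forall c : {ffun V -> bool}, nul (column Ah) (cut p q c)].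
    exists (coset_word (nseq 7 false)); split; first by exists (nseq 7 false).
    move=> c; rewrite mem_cat n_R // (_ : cut p q c = cut p q [ffun x => c x]) //.
    by apply/setP => e; rewrite !inE !ffunE.
  rewrite negb_forall => /existsP [c0 n0].
  set t := word (cut p q c0); have st : size t = 12 by rewrite size_word.
  (* The sum of rows that clears the information positions is itself a cut; adding it to [c0] gives
     a cut whose word is the chosen representative of the coset. *)
  have [c' Ec'] := H1 _ (n_comb (info_coeffs t)).
  pose c1 x := c' x (+) c0 x.
  have Ec1 : word (cut p q c1) = xorw (comb (info_coeffs t)) t by rewrite cutD word_symd -Ec' word_comb.
  exists (word (cut p q c1)); split.
    by eexists; rewrite {1}Ec1 coset_wordP //; split; last reflexivity.
  move=> c; rewrite mem_cat.
  have n1 : ~~ nul (column Ah) (cut p q c1).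
    apply: contra n0 => n1; rewrite -(symdK (cut p q c') (cut p q c0)) -cutD -Ec'.
    by apply: nulD.
  have /or3P [n2|n2|n2] := H2 c1 c; first by case/negP: n1.
    by apply/orP; left; exact: n_R.
  rewrite (cutD p q c1 c) in n2; apply/orP; right.
  by rewrite -[X in word X](symdK (cut p q c1)) word_symd; apply: map_f; exact: n_R.
have /hasP [[[C F] [g r]] _] : has (refutes w1) certificates.
  by case: Ew1 => st ->; apply: (allP all_cosets_refuted); rewrite -st mem_words.
case/and5P => C12 F12 uF r0 /and3P [lt /allP Hw Hr].
pose C1 := [set i : 'I_12 | nat_of_ord i \in C]; pose F1 := [set i : 'I_12 | nat_of_ord i \in F].
pose L : {set {set 'I_12}} := [set cut p q c :&: F1 | c : {ffun V -> bool} & vanishes C (word (cut p q c))].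
suff : g * r.+1 <= 2 * #|F1| by rewrite weight_setT // leqNgt lt.
apply: (@cut_count V _ p q C1 F1 g r L r0) => [c|S /imsetP [c]|].
- rewrite disjoint_word // => vC; have := Hw _ (cutR c); rewrite vC /= -card_word // -/F1 cards_eq0.
  by case/orP => [/eqP ->|]; [left|right].
- by rewrite inE => vC ->; exists c => //; rewrite disjoint_word.
apply: leq_trans Hr _; rewrite cardE -(size_map (restrict F \o word)).
apply: uniq_leq_size; first exact: undup_uniq.
move=> y; rewrite mem_undup => /mapP [t]; rewrite mem_filter => /andP [vt /mapP [b _ Et]] ->.
have [c Ec] := H1 _ (n_comb b).
apply/mapP; exists (cut p q c :&: F1); last by rewrite /= restrict_word // -Ec word_comb Et.
rewrite mem_enum; apply/imsetP; exists [ffun x => c x].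
  rewrite inE (_ : cut p q _ = cut p q c); first by rewrite -Ec word_comb -Et.
  by apply/setP => e; rewrite !inE !ffunE.
by congr (_ :&: F1); apply/setP => e; rewrite !inE !ffunE.
Qed.

(** * The theorem *)

Lemma conforms_iso (Phi : template) (M N : matroid) : matroid_iso M N -> conforms Phi M -> conforms Phi N.
Proof.
move=> iMN [R [F [A [cA iA]]]]; exists R, F, A; split=> //; exact: matroid_iso_trans iA iMN.
Qed.

Definition K6_H12_free (M : matroid) : Prop :=
  [/\ binary M, ~ has_minor M (cycle_matroid (complete_graph 6)) & ~ has_minor M (dual H12)].

Lemma K6_binary : binary (cycle_matroid (complete_graph 6)).
Proof.
by apply/binaryP; exists (vertex (complete_graph 6)), (@inc_vec (complete_graph 6)); exact: cycle_represents.
Qed.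

Lemma K6_H12_free_proper : proper_minor_closed_binary K6_H12_free.
Proof.
split=> [M []|M N [bM k6 h12] mMN|] //.
  split; first exact: binary_minor bM mMN.
    by move=> /(has_minor_trans mMN).
  by move=> /(has_minor_trans mMN).
exists (cycle_matroid (complete_graph 6)); first exact: K6_binary.
by case=> _ + _; apply; apply: iso_has_minor; exact: matroid_iso_refl.
Qed.

(** As 2k <= |M|, the complement of [S] has at least [#|S|] elements, so only the rank condition of
    a separation can fail. Its failure forces both ranks to be as large as possible. *)
Lemma k_connected_small (M : matroid) k (S : {set M}) : k_connected k M -> 2 * k <= #|M| ->
  0 < #|S| < k -> rk S = #|S| /\ rk (~: S) = rk [set: M].
Proof.
move=> cM szM lk; have := cM #|S| S lk; rewrite /separation leqnn /=.
have cS : #|S| + #|~: S| = #|M| := cardsC S.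
rewrite negb_and -!ltnNge => /orP []; first by lia.
have := rk_le_card S; have := rk_mono (subsetT (~: S)); lia.
Qed.

Theorem theorem1p3 :
  template_hypothesis ->
  exists k : nat, 0 < k /\
    forall M : matroid, binary M -> k_connected k M -> 2 * k <= #|M| ->
      (~ has_minor M (cycle_matroid (complete_graph 6)) /\
       ~ has_minor M (dual H12)
       <-> even_cut M).
Proof.
move=> TH; have [k0 [s [t [Phi [Psi [k0_gt0 HPhi HPsi HP]]]]]] := TH _ K6_H12_free_proper.
(* The sum makes [k] larger than every [#|tY0 (Psi j)|], so that all sets of at most this size fall
   under [k_connected_small]. *)
pose k := k0 + \sum_(j < t) #|tY0 (Psi j)|.+1.
have k0k : k0 <= k by rewrite /k leq_addr.
exists k; split; first exact: leq_trans k0k.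
move=> M bM cM szM; split=> [[nK6 nH12]|eM]; last first.
  by split; [exact: even_cut_K6_free|exact: even_cut_H12_free].
have [||[i _]|[j cj]] := HP M (And3 bM nK6 nH12).
- by move=> l S /andP [l0 lk]; apply: cM; rewrite l0 (leq_trans lk).
- by apply: leq_trans szM; rewrite leq_mul2l.
- have [N cN mN] := template_complete_minor (Phi i) 6.
  by have [_ /(_ mN)] := HPhi i N cN.
apply: conforming_even_cut cj _ => [N cN mN|S /andP [S0 leS]].
  (* The hypothesis speaks of matroids whose dual conforms, so it is applied to [dual N]; an H12
     minor of N is an H12* minor of [dual N]. *)
  have cdN := conforms_iso (dual_dual_iso N) cN.
  by have [_ _ /(_ (has_minor_dual mN))] := HPsi j (dual N) cdN.
apply: k_connected_small cM szM _; rewrite S0 /=.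
apply: leq_trans (leq_addl _ _); rewrite (bigD1 j) //=.
by apply: leq_trans (leq_addr _ _).
Qed.
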